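(* Let $G$ and $\mu$ satisfy the standing assumptions listed in the context, and let $b\colon G\to\mathcal{H}$ be a $\mu$-harmonic $1$-cocycle with coefficients in an orthogonal representation of $G$. Then $b$ is a direct sum of (possibly infinitely many) finite-dimensional cocycles if and only if \[ \limsup_{n}\ \mathbb{P}\bigl(\|b(X_n)\|<c\sqrt{n}\bigr)>0\quad\text{for every } c>0. \]
   Context: Standing assumptions. $G$ is a compactly generated locally compact group with identity $e$ and Haar measure $m$. $Q\subset G$ is a fixed relatively compact symmetric subset containing an open neighborhood of $e$ that generates $G$. Put $|x|_G:=\min\{n: x\in Q^n\}$ for $x\neq e$ and $|e|_G:=0$. $\mu$ is a symmetric probability measure on $G$ such that: $\mu$ is absolutely continuous with respect to $m$; $\inf\{\frac{d\mu}{dm}(x): x\in Q\}>0$; and $\int|x|_G^d\,d\mu(x)<\infty$ for all $d$. All Hilbert spaces are real and $\pi$ is a (strongly continuous) orthogonal representation of $G$ on $\mathcal{H}$. A $1$-cocycle is a continuous map $b\colon G\to\mathcal{H}$ with $b(gx)=b(g)+\pi_g b(x)$ for all $g,x\in G$. It is $\mu$-harmonic if $\int b(x)\,d\mu(x)=0$. A $1$-cocycle $b$ is finite-dimensional if $\overline{\mathrm{span}}\,b(G)$ is finite-dimensional. If $\mathcal{H}=\bigoplus_i\mathcal{H}_i$ is an orthogonal decomposition into $\pi(G)$-invariant closed subspaces, then $b=\bigoplus_iP_{\mathcal{H}_i}b$ is a decomposition of $b$ as a direct sum of $1$-cocycles, where $P_{\mathcal{H}_i}$ is the orthogonal projection onto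 $\mathcal{H}_i$; ''direct sum'' refers to such decompositions. $X_n=s_1s_2\cdots s_n$ is the random walk on $G$ with independent increments $s_i$ of law $\mu$; $\mathbb{P}$ is the corresponding probability. *)

(* Defs.v *)
From HB Require Import structures.
From mathcomp Require Import all_boot all_order all_algebra finmap.
From mathcomp Require Import all_classical all_reals all_analysis.
From mathcomp Require Import measurable_realfun.

Set Implicit Arguments.
Unset Strict Implicit.
Unset Printing Implicit Defensive.

Import Order.TTheory GRing.Theory Num.Theory.
Import numFieldNormedType.Exports.

Local Open Scope classical_set_scope.
Local Open Scope ring_scope.

(* [Pointed] is only there because measurable types are pointed; the point
   need not be the identity. *)
HB.mixin Record isTopologicalGroup G of PointedTopological G & Group G := {
  mulg_continuous : continuous (fun xy : G * G => (xy.1 * xy.2)%g) ;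
  invg_continuous : continuous (fun x : G => (x^-1)%g)
}.

#[short(type="topologicalGroupType")]
HB.structure Definition TopologicalGroup :=
  {G of PointedTopological G & Group G & isTopologicalGroup G}.

HB.mixin Record CompleteNormedModule_isHilbert (R : realType) H
    of CompleteNormedModule R H := {
  inner : H -> H -> R ;
  innerC : forall u v, inner u v = inner v u ;
  innerDl : forall u v w, inner (u + v) w = inner u w + inner v w ;
  innerZl : forall (a : R) u v, inner (a *: u) v = a * inner u v ;
  normr_inner : forall u, `|u| ^+ 2 = inner u u
}.

(* Real Hilbert spaces, of arbitrary dimension and density character. *)
#[short(type="hilbertType")]
HB.structure Definition Hilbert (R : realType) :=
  {H of CompleteNormedModule R H & CompleteNormedModule_isHilbert R H}.

Notation borel G := (g_sigma_algebraType (@open G)).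

Section Groups.
Variable G : topologicalGroupType.

Definition generates (S : set G) := forall K : set G,
  K 1%g -> (forall x y, K x -> K y -> K (x * y^-1)%g) -> S `<=` K -> K = setT.

Definition compactly_generated := exists2 K : set G, compact K & generates K.

Fixpoint setpow (Q : set G) (n : nat) : set G :=
  if n is n'.+1 then [set (x * y)%g | x in setpow Q n' & y in Q]
  else [set 1%g].

(* The least n with x \in Q^n; the default value 0 of [xget] is irrelevant when
   Q is symmetric and generates G. *)
Definition word_length (Q : set G) (x : G) : nat :=
  if x == 1%g then 0%N
  else xget 0%N [set n | setpow Q n x /\ forall k, setpow Q k x -> (n <= k)%N].

(* It is the open neighborhood of the identity, not only Q, that generates G:
   as the density of mu is defined up to null sets, a null part of Q would
   not be seen by mu. *)
Record generating_neighborhood (Q : set G) : Prop := {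
  gn_precompact : precompact Q ;
  gn_symmetric : forall x, Q x -> Q (x^-1)%g ;
  gn_open : exists U : set G, [/\ open U, U 1%g, U `<=` Q & generates U]
}.

End Groups.

Section Measures.
Context {R : realType} {G : topologicalGroupType}.

(* Left Haar measures; as these and the right ones have the same null sets and
   the modular function is bounded above and below on relatively compact sets,
   the side does not matter in [driving_measure]. *)
Record haar_measure (m : {measure set (borel G) -> \bar R}) : Prop := {
  haar_neq0 : m setT != 0%E ;
  haar_invariant : forall (g : G) (A : set (borel G)), measurable A ->
    m [set (g * x)%g | x in (A : set G)] = m A ;
  haar_compact : forall K : set G, compact K -> (m K < +oo)%E ;
  haar_outer : forall A : set (borel G), measurable A ->
    m A = ereal_inf [set m U | U in [set U : set G | open U /\ A `<=` U]] ;
  haar_inner : forall U : set G, open U ->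
    m U = ereal_sup [set m K | K in [set K : set G | compact K /\ K `<=` U]]
}.

(* Q need not be a Borel set, so that [word_length Q] need not be Borel
   measurable; the integral of a nonnegative function is then the lower
   integral, whose finiteness here is equivalent to the finiteness of the upper
   integral since the word length of a generating neighborhood is within a
   constant factor of that of an open one. *)
Record driving_measure (m : {measure set (borel G) -> \bar R}) (Q : set G)
    (mu : probability (borel G) R) : Prop := {
  dm_symmetric : forall A : set (borel G), measurable A ->
    mu [set (x^-1)%g | x in (A : set G)] = mu A ;
  dm_dominated : mu `<< m ;
  dm_density : exists f : borel G -> \bar R,
    [/\ measurable_fun setT f,
        forall x, (0 <= f x)%E,
        forall A, measurable A -> mu A = (\int[m]_(x in A) f x)%E
      & (0 < ereal_inf [set f x | x in Q])%E] ;
  dm_moments : forall d : nat,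
    (\int[mu]_x ((word_length Q x)%:R ^+ d : R)%:E < +oo)%E
}.

End Measures.

Section Bochner.
Context d (T : measurableType d) (R : realType) (H : hilbertType R).
Variable P : probability T R.

Definition simple_function (g : T -> H) :=
  finite_set (range g) /\ forall y, measurable (g @^-1` [set y]).

Definition simple_integral (g : T -> H) : H :=
  \sum_(y \in range g) fine (P (g @^-1` [set y])) *: y.

Definition is_bochner_integral (f : T -> H) (I : H) :=
  exists g : nat -> T -> H,
    [/\ forall n, simple_function (g n),
        forall n, measurable_fun setT (fun x => `|f x - g n x|),
        (\int[P]_x (`|f x - g n x|)%:E)%E @[n --> \oo] --> 0%E
      & simple_integral (g n) @[n --> \oo] --> I].

End Bochner.

Section Hilbert.
Context {R : realType} {H : hilbertType R}.

Definition linear_span (S : set H) : set H :=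
  [set x | exists (n : nat) (a : 'I_n -> R) (v : 'I_n -> H),
     (forall i, S (v i)) /\ x = \sum_(i < n) a i *: v i].

Definition closed_subspace (V : set H) :=
  [/\ closed V, V 0 & forall (a : R) u v, V u -> V v -> V (a *: u + v)].

Definition finite_dimensional (V : set H) :=
  exists s : seq H, V = linear_span [set` s].

(* The point of V at which x - y is orthogonal to V, which exists and is unique
   when V is a closed subspace. *)
Definition orthogonal_projection (V : set H) (x : H) : H :=
  xget 0 [set y | V y /\ forall z, V z -> inner (x - y) z = 0].

(* H is the closed span of the pairwise orthogonal closed subspaces V i. *)
Record orthogonal_decomposition (I : Type) (V : I -> set H) : Prop := {
  od_closed : forall i, closed_subspace (V i) ;
  od_orthogonal : forall i j u v, i <> j -> V i u -> V j v -> inner u v = 0 ;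
  od_total : closure (linear_span (\bigcup_i V i)) = setT
}.

End Hilbert.

Section Cocycles.
Context {R : realType} {G : topologicalGroupType} {H : hilbertType R}.

Record orthogonal_representation (pi : G -> {linear H -> H}) : Prop := {
  rep1 : forall v, pi 1%g v = v ;
  repM : forall g h v, pi (g * h)%g v = pi g (pi h v) ;
  rep_inner : forall g u v, inner (pi g u) (pi g v) = inner u v ;
  rep_continuous : forall v, continuous (fun g => pi g v)
}.

Definition cocycle (pi : G -> {linear H -> H}) (b : G -> H) :=
  continuous b /\ forall g x, b (g * x)%g = b g + pi g (b x).

Definition harmonic_cocycle (mu : probability (borel G) R) (b : G -> H) :=
  is_bochner_integral mu (b : borel G -> H) 0.

Definition finite_dimensional_cocycle (b : G -> H) :=
  finite_dimensional (closure (linear_span (range b))).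

(* The components of b along pi-invariant closed subspaces are automatically
   cocycles. *)
Definition sum_of_finite_dimensional (pi : G -> {linear H -> H}) (b : G -> H) :=
  exists (I : Type) (V : I -> set H),
    [/\ orthogonal_decomposition V,
        forall i g v, V i v -> V i (pi g v)
      & forall i, finite_dimensional_cocycle (orthogonal_projection (V i) \o b)].

End Cocycles.

Section Walk.
Context {R : realType} {G : topologicalGroupType}.
Context d (Omega : measurableType d) (P : probability Omega R).

Definition mutually_independent (s : nat -> {RV P >-> borel G}) :=
  forall (J : {fset nat}) (A : nat -> set (borel G)),
    (forall i, measurable (A i)) ->
    P (\bigcap_(i in [set` J]) (s i @^-1` A i)) =
      (\prod_(i <- J) P (s i @^-1` A i))%E.

Record iid_increments (mu : probability (borel G) R)
    (s : nat -> {RV P >-> borel G}) : Prop := {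
  iid_independent : mutually_independent s ;
  iid_law : forall n (A : set (borel G)), measurable A ->
    distribution P (s n) A = mu A
}.

(* The product of n increments, indexed from 0. If G is not second countable,
   multiplication need not be measurable for the product sigma-algebra, and the
   walk need not be a random variable; but the norm of a cocycle along it is
   one, since a cocycle on a sigma-compact group has separable range. *)
Definition random_walk (s : nat -> {RV P >-> borel G}) (n : nat) (w : Omega) : G :=
  (\big[*%g/1%g]_(i < n) (s i w : G))%g.

End Walk.

(* Main.v *)
Require Import Defs.
From HB Require Import structures.
From mathcomp Require Import all_boot all_order all_algebra finmap.
From mathcomp Require Import all_classical all_reals all_analysis.
From mathcomp Require Import ring lra measurable_realfun.

Set Implicit Arguments.
Unset Strict Implicit.
Unset Printing Implicit Defensive.

Import Order.TTheory GRing.Theory Num.Theory.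
Import numFieldNormedType.Exports.

Local Open Scope classical_set_scope.
Local Open Scope ring_scope.

(** Write X_n.u for the affine action of the walk on H and M for the Markov
    operator of this action, so that E f(b X_n) = (M^n f)(0).

    If b is a sum of finite-dimensional cocycles, it is approximated in L^2(mu),
    and by harmonicity uniformly in n for b(X_n)/sqrt n, by its projection to a
    finite-dimensional invariant subspace. The law of b(X_n)/sqrt n thus has, up
    to a small mass, a totally bounded support with a cover independent of n.
    By the pigeonhole principle one of the balls of this cover has mass bounded
    below; two independent walks that end in it combine, mu being symmetric,
    into a walk of length 2n along which b ends near 0.

    Conversely let W be the orthogonal complement of a maximal orthogonal family
    of finite-dimensional invariant subspaces and suppose that the projection of
    b to W is not zero; take b for it. Then E |b(X_n)|^2 = n sigma^2, and
    E |b(X_n)|^4 - n^2 sigma^4 is bounded by O(n) plus 4 n times the sum for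
    j < n of c_j := E B_j(b(x), b(x)), where x has law mu and B_j is the average
    over X_j of the covariance form of b moved by pi. If the averages of the c_j
    tend to 0, so do the small ball probabilities by Chebyshev's inequality.
    Otherwise an ultralimit of the averages of the B_j is a nonzero nonnegative
    form of finite trace, harmonic under pi: its top eigenspace is
    finite-dimensional, and invariant by the maximum principle, contradicting
    the maximality. *)

(** * Hilbert spaces and bounded forms *)

(** Two obstacles shape the proof. First, [G] need not be second countable, so that the walk need
    not have a law on [G] to integrate against. The test functions are therefore functions on [H],
    Lipschitz up to polynomial weights, and [b] is approximated by maps with countably many values,
    which the sigma-compactness of [G] permits. Indicators of balls give way to the Lipschitz
    cutoffs [bump]; their loss of a factor 2 in the radius is harmless, as c is arbitrary in one
    direction and may be chosen in the other. Second, the averages of the B_j need not converge. An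
    ultralimit always exists, inherits the trace bound, and is exactly harmonic because the averages
    are so up to O(1/n). It might vanish, however: that it does not is due to the interchange of the
    ultralimit with the integral of the form at b(x). The B_j come from the expansion of |b(x) +
    pi_x u|^4, whose mean contains, besides powers of |u|^2, a constant and a linear term, the
    covariance form of b at u. This form is not invariant, and its mean along the walk is the sum of
    the c_j. *)

Section InnerProduct.
Context {R : realType} {H : hilbertType R}.
Implicit Types (u v w : H) (a : R) (e s : seq H).

Lemma innerDr u v w : inner u (v + w) = inner u v + inner u w.
Proof. by rewrite innerC innerDl (innerC v) (innerC w). Qed.

Lemma innerZr a u v : inner u (a *: v) = a * inner u v.
Proof. by rewrite innerC innerZl innerC. Qed.

Lemma inner0l u : inner 0 u = 0.
Proof. by rewrite -(scale0r (0 : H)) innerZl mul0r. Qed.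

Lemma inner0r u : inner u 0 = 0.
Proof. by rewrite innerC inner0l. Qed.

Lemma innerNl u v : inner (- u) v = - inner u v.
Proof. by rewrite -scaleN1r innerZl mulN1r. Qed.

Lemma innerNr u v : inner u (- v) = - inner u v.
Proof. by rewrite innerC innerNl innerC. Qed.

Lemma innerBl u v w : inner (u - v) w = inner u w - inner v w.
Proof. by rewrite innerDl innerNl. Qed.

Lemma innerBr u v w : inner u (v - w) = inner u v - inner u w.
Proof. by rewrite innerDr innerNr. Qed.

Lemma inner_ge0 u : 0 <= inner u u.
Proof. by rewrite -normr_inner sqr_ge0. Qed.

Lemma inner_eq0 u : inner u u = 0 -> u = 0.
Proof.
rewrite -normr_inner => /eqP; rewrite sqrf_eq0 normr_eq0; by move=> /eqP.
Qed.

Lemma inner_suml I (r : seq I) (F : I -> H) v :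
  inner (\sum_(i <- r) F i) v = \sum_(i <- r) inner (F i) v.
Proof.
elim: r => [|i r IH]; first by rewrite !big_nil inner0l.
by rewrite !big_cons innerDl IH.
Qed.

Lemma inner_sumr I (r : seq I) (F : I -> H) v :
  inner v (\sum_(i <- r) F i) = \sum_(i <- r) inner v (F i).
Proof. by rewrite innerC inner_suml; apply: eq_bigr => i _; rewrite innerC. Qed.

Lemma normr_sqD u v : `|u + v| ^+ 2 = `|u| ^+ 2 + 2 * inner u v + `|v| ^+ 2.
Proof. rewrite !normr_inner !innerDl !innerDr (innerC v u); ring. Qed.

Lemma normr_sqB u v : `|u - v| ^+ 2 = `|u| ^+ 2 - 2 * inner u v + `|v| ^+ 2.
Proof. by rewrite normr_sqD innerNr normrN; ring. Qed.

Lemma cauchy_schwarz_sqr u v : inner u v ^+ 2 <= `|u| ^+ 2 * `|v| ^+ 2.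
Proof.
have [->|v0] := eqVneq v 0; first by rewrite inner0r normr0 expr0n mulr0.
have vp : 0 < `|v| ^+ 2 by rewrite exprn_gt0 // normr_gt0.
have := sqr_ge0 (`|(`|v| ^+ 2) *: u - (inner u v) *: v|).
rewrite normr_sqB !normrZ !innerZl !innerZr !exprMn real_normK ?num_real // real_normK ?num_real //.
move=> h.
have {}h : 0 <= `|v| ^+ 2 * (`|u| ^+ 2 * `|v| ^+ 2 - inner u v ^+ 2) by lra.
by move: h; rewrite pmulr_rge0 // subr_ge0.
Qed.

Lemma cauchy_schwarz u v : `|inner u v| <= `|u| * `|v|.
Proof.
rewrite -(@ler_pXn2r _ 2) ?nnegrE ?mulr_ge0 //.
by rewrite exprMn real_normK ?num_real // cauchy_schwarz_sqr.
Qed.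

Lemma inner_continuous v : continuous (fun u => inner u v).
Proof.
move=> u; apply/cvgrPdist_lt => /= e e0.
near=> w; rewrite -innerBl (le_lt_trans (cauchy_schwarz _ _)) //.
have v0 : 0 < `|v| + 1 by rewrite ltr_wpDl.
apply: (@le_lt_trans _ _ (`|u - w| * (`|v| + 1))).
  by rewrite ler_wpM2l // lerDl.
rewrite -ltr_pdivlMr //; near: w.
apply: (@cvgr_dist_lt _ _ _ (nbhs u) _ id u); last by rewrite divr_gt0.
exact: cvg_id.
Unshelve. all: by end_near. Qed.

(* Lists rather than indexed families: inductions on an orthonormal family
   then need no reindexing. *)
Fixpoint onb e : Prop :=
  if e is c :: e' then
    [/\ inner c c = 1, (forall v, v \in e' -> inner c v = 0) & onb e']
  else True.

Definition proj e u : H := \sum_(c <- e) inner u c *: c.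

Lemma proj_cons c e u : proj (c :: e) u = inner u c *: c + proj e u.
Proof. by rewrite /proj big_cons. Qed.

Lemma projD e u v : proj e (u + v) = proj e u + proj e v.
Proof. by rewrite /proj -big_split; apply: eq_bigr => c _; rewrite innerDl scalerDl. Qed.

Lemma projZ e a u : proj e (a *: u) = a *: proj e u.
Proof. by rewrite /proj scaler_sumr; apply: eq_bigr => c _; rewrite innerZl scalerA. Qed.

Lemma projB e u v : proj e (u - v) = proj e u - proj e v.
Proof. by rewrite projD -scaleN1r projZ scaleN1r. Qed.

Lemma onb_inner e u v : onb e -> u \in e -> v \in e -> inner u v = (u == v)%:R.
Proof.
elim: e => [|c e IH] //= [c1 ce oe]; rewrite !inE.
case/orP => [/eqP ->|ue]; case/orP => [/eqP ->|ve].
- by rewrite eqxx c1.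
- rewrite ce //; case: eqP => // cv; move: ve; rewrite -cv => /ce; rewrite c1.
  by move/eqP; rewrite oner_eq0.
- rewrite innerC ce //; case: eqP => // cv; move: ue; rewrite cv => /ce.
  by rewrite c1 => /eqP; rewrite oner_eq0.
- exact: IH.
Qed.

Lemma inner_proj_out e u v : (forall c, c \in e -> inner c v = 0) ->
  inner (proj e u) v = 0.
Proof.
move=> ev; rewrite /proj inner_suml big1_seq // => c /= ce.
by rewrite innerZl ev // mulr0.
Qed.

Lemma inner_proj e u v : onb e -> v \in e -> inner (proj e u) v = inner u v.
Proof.
elim: e => [|c e IH] //= [c1 ce oe]; rewrite inE proj_cons innerDl innerZl.
case/orP => [/eqP ->|ve].
  by rewrite c1 mulr1 inner_proj_out ?addr0 // => w we; rewrite innerC ce.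
by rewrite ce // mulr0 add0r IH.
Qed.

Lemma inner_projA e u v : inner (proj e u) v = inner u (proj e v).
Proof.
rewrite /proj inner_suml inner_sumr; apply: eq_bigr => c _.
by rewrite innerZl innerZr (innerC v) mulrC.
Qed.

Lemma proj_idem e u : onb e -> proj e (proj e u) = proj e u.
Proof.
move=> oe; rewrite {1 3}/proj; apply: eq_big_seq => c ce.
by rewrite inner_proj.
Qed.

Lemma normr_proj e u : onb e -> `|proj e u| ^+ 2 = \sum_(c <- e) inner u c ^+ 2.
Proof.
move=> oe; rewrite normr_inner inner_projA proj_idem // /proj inner_sumr.
by apply: eq_bigr => c _; rewrite innerZr expr2.
Qed.

Lemma normr_projB e u : onb e -> `|u - proj e u| ^+ 2 = `|u| ^+ 2 - `|proj e u| ^+ 2.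
Proof.
move=> oe; rewrite normr_sqB !normr_inner inner_projA proj_idem //; ring.
Qed.

Lemma bessel e u : onb e -> \sum_(c <- e) inner u c ^+ 2 <= `|u| ^+ 2.
Proof.
by move=> oe; rewrite -normr_proj // -subr_ge0 -normr_projB // sqr_ge0.
Qed.

Lemma proj_le e u : onb e -> `|proj e u| <= `|u|.
Proof.
move=> oe; rewrite -(@ler_pXn2r _ 2) ?nnegrE // normr_proj //; exact: bessel.
Qed.

Lemma proj_self e c : onb e -> c \in e -> proj e c = c.
Proof.
elim: e => [|d e IH] //= [d1 de oe]; rewrite inE proj_cons.
case/orP => [/eqP ->|ce].
  rewrite d1 scale1r /proj big1_seq ?addr0 // => v /= ve.
  by rewrite de // scale0r.
by rewrite innerC de // scale0r add0r IH.
Qed.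

Lemma proj_orth e u v : onb e -> inner (u - proj e u) (proj e v) = 0.
Proof. by move=> oe; rewrite innerBl inner_projA proj_idem // subrr. Qed.

Lemma proj_best e u v : onb e -> proj e v = v -> `|u - proj e u| <= `|u - v|.
Proof.
move=> oe pv; rewrite -(@ler_pXn2r _ 2) ?nnegrE //.
have -> : u - v = (u - proj e u) + proj e (u - v).
  by rewrite projB pv addrA subrK.
by rewrite [leRHS]normr_sqD proj_orth // mulr0 addr0 lerDl sqr_ge0.
Qed.

Definition linear_subset (V : set H) :=
  V 0 /\ forall a u v, V u -> V v -> V (a *: u + v).

Lemma linear_subsetD V u v : linear_subset V -> V u -> V v -> V (u + v).
Proof. by move=> [_ h] Vu Vv; rewrite -[u]scale1r; apply: h. Qed.

Lemma linear_subsetZ V a u : linear_subset V -> V u -> V (a *: u).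
Proof. by move=> [V0 h] Vu; rewrite -[_ *: _]addr0; apply: h. Qed.

Lemma linear_subsetB V u v : linear_subset V -> V u -> V v -> V (u - v).
Proof.
by move=> lV Vu Vv; apply: linear_subsetD => //; rewrite -scaleN1r; apply: linear_subsetZ.
Qed.

Lemma linear_subset_sum V I (r : seq I) (P : pred I) (F : I -> H) : linear_subset V ->
  (forall i, P i -> V (F i)) -> V (\sum_(i <- r | P i) F i).
Proof.
move=> lV VF; elim/big_ind: _ => //; first by case: lV.
by move=> u v; apply: linear_subsetD.
Qed.

Lemma linear_span_incl S : S `<=` @linear_span R H S.
Proof.
move=> u Su; exists 1%N, (fun _ => 1), (fun _ => u); split=> //.
by rewrite big_ord1 scale1r.
Qed.

Lemma linear_span_linear S : linear_subset (@linear_span R H S).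
Proof.
split; first by exists 0%N, (fun _ => 0), (fun _ => 0); split; [case|rewrite big_ord0].
move=> a u v [n [c [x [Sx ->]]]] [m [d [y [Sy ->]]]].
exists (n + m)%N,
  (fun i : 'I_(n + m) => match fintype.split i with inl j => a * c j | inr j => d j end),
  (fun i : 'I_(n + m) => match fintype.split i with inl j => x j | inr j => y j end); split.
  by move=> i; case: (fintype.split i).
rewrite big_split_ord /= scaler_sumr; congr (_ + _); apply: eq_bigr => i _.
  by rewrite (unsplitK (inl i)) scalerA.
by rewrite (unsplitK (inr i)).
Qed.

Lemma linear_span_min S V : linear_subset V -> S `<=` V -> @linear_span R H S `<=` V.
Proof.
move=> lV SV u [n [a [v [Sv ->]]]]; apply: linear_subset_sum => // i _.
by apply: linear_subsetZ => //; apply: SV.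
Qed.

Lemma linear_fixed_proj e : linear_subset [set u | proj e u = u].
Proof.
split=> [|a u v /= pu pv]; last by rewrite projD projZ pu pv.
by rewrite /= -(scale0r (0 : H)) projZ !scale0r.
Qed.

Lemma linear_span_onb e : onb e -> linear_span [set` e] = [set u | proj e u = u].
Proof.
move=> oe; apply/seteqP; split.
  apply: linear_span_min; first exact: linear_fixed_proj.
  by move=> c /= ce; exact: proj_self.
move=> u /= <-; rewrite /proj big_seq_cond.
apply: linear_subset_sum; first exact: linear_span_linear.
move=> c; rewrite andbT => ce; apply: linear_subsetZ; first exact: linear_span_linear.
exact: linear_span_incl.
Qed.

Lemma onb_extend e u : onb e -> proj e u <> u ->
  let c := `|u - proj e u|^-1 *: (u - proj e u) in
  onb (c :: e) /\ u = `|u - proj e u| *: c + proj e u.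
Proof.
move=> oe pu c.
have n0 : `|u - proj e u| != 0.
  by rewrite normr_eq0 subr_eq0; apply/eqP => h; apply: pu.
split; last by rewrite scalerA divff // scale1r subrK.
split=> //; first by rewrite innerZl innerZr -normr_inner; field.
move=> v ve; rewrite innerZl innerBl inner_proj // subrr mulr0 //.
Qed.

Lemma gram_schmidt s : exists2 e, onb e & linear_span [set` e] = linear_span [set` s].
Proof.
elim: s => [|a s [e oe es]]; first by exists [::].
have sub_cons (t : seq H) c : linear_span [set` t] `<=` @linear_span R H [set` c :: t].
  apply: linear_span_min; first exact: linear_span_linear.
  by move=> v vt; apply: linear_span_incl; rewrite /= inE vt orbT.
have hd_cons (t : seq H) c : @linear_span R H [set` c :: t] c.
  by apply: linear_span_incl; rewrite /= inE eqxx.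
have cons_min (t : seq H) c V : linear_subset V -> V c -> [set` t] `<=` V ->
    @linear_span R H [set` c :: t] `<=` V.
  move=> lV Vc tV; apply: linear_span_min => // v /=; rewrite inE.
  by case/orP => [/eqP ->|/tV].
have lsp := @linear_span_linear.
have [pa|pa] := pselect (proj e a = a).
  exists e => //; apply/seteqP; split; first by rewrite es; apply: sub_cons.
  apply: cons_min => //; first by rewrite linear_span_onb.
  by rewrite es; apply: linear_span_incl.
have [oce aE] := onb_extend oe pa.
exists (`|a - proj e a|^-1 *: (a - proj e a) :: e) => //.
have spa : linear_span [set` e] (proj e a) by rewrite linear_span_onb //=; apply: proj_idem.
apply/seteqP; split.
  apply: cons_min => //.
    apply: linear_subsetZ => //; apply: linear_subsetB => //.
    by apply: sub_cons; rewrite -es.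
  by move=> v ve; apply: sub_cons; rewrite -es; apply: linear_span_incl.
apply: cons_min => //.
  rewrite [X in linear_span _ X]aE; apply: linear_subsetD => //.
    exact: linear_subsetZ (lsp _) (hd_cons _ _).
  exact: sub_cons.
by move=> v vs; apply: sub_cons; rewrite es; apply: linear_span_incl.
Qed.

(** Double counting of the squared inner products between the two families: a member of [f] equals
    its projection to the span of [e] and gives 1, while by Bessel's inequality a member of [e]
    gives at most 1. *)
Lemma onb_size_le e f : onb e -> onb f -> [set` f] `<=` linear_span [set` e] ->
  (size f <= size e)%N.
Proof.
move=> oe of_; rewrite linear_span_onb // => fe; rewrite -(ler_nat R).
have -> : (size f)%:R = \sum_(b <- f) \sum_(c <- e) inner b c ^+ 2 :> R.
  rewrite (eq_big_seq (fun=> 1)) => [|b bf].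
    by rewrite big_const_seq count_predT iter_addr_0.
  by rewrite -normr_proj // fe // normr_inner (onb_inner of_ bf bf) eqxx.
have -> : (size e)%:R = \sum_(c <- e) 1 :> R.
  by rewrite big_const_seq count_predT iter_addr_0.
rewrite exchange_big /= big_seq [leRHS]big_seq; apply: ler_sum => c ce.
have -> : 1 = `|c| ^+ 2 :> R by rewrite normr_inner (onb_inner oe ce ce) eqxx.
rewrite (eq_bigr (fun b => inner c b ^+ 2)) ?bessel // => b _.
by rewrite innerC.
Qed.

(** An orthonormal family of maximal size in [V] spans it, since [onb_extend] would lengthen it
    otherwise. The bound [N] plays the part of the dimension. *)
Lemma onb_spans V N : linear_subset V ->
  (forall e, onb e -> [set` e] `<=` V -> (size e <= N)%N) ->
  exists e, [/\ onb e, [set` e] `<=` V & V = linear_span [set` e]].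
Proof.
move=> lV VN.
pose P n := `[< exists e, [/\ onb e, [set` e] `<=` V & size e = n] >].
have exP : exists n, P n by exists 0%N; apply/asboolP; exists [::].
have ubP n : P n -> (n <= N)%N by move=> /asboolP[e [oe eV <-]]; apply: VN.
case: (ex_maxnP exP ubP) => n /asboolP[e [oe eV en]] nmax.
have seV : linear_span [set` e] `<=` V by exact: linear_span_min.
exists e; split=> //; apply/seteqP; split=> // u Vu.
rewrite linear_span_onb //=; apply: contrapT => pu.
have [oce _] := onb_extend oe pu.
have : P n.+1.
  apply/asboolP; eexists; split; [exact: oce| |by rewrite /= en].
  move=> v /=; rewrite inE => /orP[/eqP ->|/eV //].
  apply: linear_subsetZ => //; apply: linear_subsetB => //; apply: seV.
  by rewrite linear_span_onb //=; apply: proj_idem.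
by move=> /nmax; rewrite ltnn.
Qed.

Lemma finite_dimensional_sub V W : linear_subset V -> finite_dimensional W ->
  V `<=` W -> finite_dimensional V.
Proof.
move=> lV [s ->] VW; have [f of_ fs] := gram_schmidt s.
have [|e [_ _ ->]] := @onb_spans V (size f) lV; last by exists e.
by move=> e oe eV; apply: onb_size_le => //; rewrite fs; apply: subset_trans VW.
Qed.

Lemma real_net (M r : R) : 0 < r -> exists s : seq R, forall t : R, `|t| <= M ->
  exists2 c, c \in s & `|t - c| < r.
Proof.
move=> r0; pose K := (Num.truncn (2 * M / r)).+1.
exists [seq - M + i%:R * r | i <- iota 0 K] => t.
rewrite ler_norml => /andP[tl tu].
have q0 : 0 <= (t + M) / r by apply: divr_ge0; [lra|exact: ltW].
have /andP[il iu] := truncn_itv q0.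
exists (- M + (Num.truncn ((t + M) / r))%:R * r).
  apply/mapP; eexists; last by [].
  rewrite mem_iota /= add0n ltnS; apply: le_truncn.
  by rewrite ler_pM2r ?invr_gt0 //; lra.
move: il iu; rewrite ler_pdivlMr // ltr_pdivrMr // -natr1 => il iu.
by rewrite ltr_norml; apply/andP; split; lra.
Qed.

(** Total boundedness in the span of [e]: after rescaling, one finite net serves the walk at all
    times. Each coordinate is granted half of the remaining radius. *)
Lemma proj_net e (M r : R) : 0 < r -> onb e -> exists s : seq H, forall u, `|u| <= M ->
  exists2 c, c \in s & `|proj e u - c| < r.
Proof.
move=> r0; elim: e r r0 => [|c e IH] r r0.
  by exists [:: 0] => u _; exists 0; rewrite ?inE // /proj big_nil subrr normr0.
case=> c1 ce oe; have r2 : 0 < r / 2 by rewrite divr_gt0.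
have [s sP] := IH _ r2 oe; have [t tP] := real_net M r2.
exists [seq x *: c + y | x <- t, y <- s] => u uM.
have [y ys uy] := sP _ uM.
have c1' : `|c| = 1 by apply/eqP; rewrite -(@eqrXn2 _ 2) // normr_inner c1 expr1n.
have [|x xt ux] := tP (inner u c).
  by apply: le_trans uM; rewrite (le_trans (cauchy_schwarz _ _)) // c1' mulr1.
exists (x *: c + y); first by apply/allpairsP; exists (x, y).
rewrite proj_cons opprD addrACA -scalerBl.
rewrite (le_lt_trans (ler_normD _ _)) // normrZ c1' mulr1; lra.
Qed.

Lemma closed_subspace_linear V : closed_subspace V -> linear_subset V.
Proof. by case. Qed.

Lemma orthogonal_projection_eq (V : set H) x y : closed_subspace V -> V y ->
  (forall z, V z -> inner (x - y) z = 0) -> orthogonal_projection V x = y.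
Proof.
move=> /closed_subspace_linear lV Vy xy; apply: xget_unique => // z [Vz xz].
have Vzy : V (z - y) by apply: linear_subsetB.
apply/eqP; rewrite -subr_eq0; apply/eqP; apply: inner_eq0.
rewrite -[X in inner X _](_ : (x - y) - (x - z) = z - y).
  by rewrite innerBl xy // xz // subrr.
by rewrite opprB [LHS]addrC addrA subrK.
Qed.

End InnerProduct.

(** The limit is the supremum of the levels that [f] reaches on a set of [U]: an ultrafilter that
    does not contain a superlevel set contains its complement. *)
Lemma ultra_cvg (R : realType) (T : Type) (U : set_system T) (f : T -> R) (M : R) :
  UltraFilter U -> (forall t, `|f t| <= M) -> exists l : R, f @ U --> l.
Proof.
move=> UU fM; pose S := [set x : R | U [set t | x <= f t]].
have PU : ProperFilter U by exact: ultra_proper.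
have S0 : S (- M).
  apply: filterS (@filterT _ U _) => t _ /=.
  by have := fM t; rewrite ler_norml => /andP[].
have ubS : ubound S M.
  move=> x Sx; have [t /= xt] := filter_ex Sx.
  by apply: le_trans xt _; apply: le_trans (fM t); exact: ler_norm.
have hS : has_sup S by split; [exists (- M)|exists M].
exists (sup S); apply/cvgrPdist_le => /= e e0.
have e2 : 0 < e / 2 by rewrite divr_gt0.
have [x Sx xe] := sup_adherent e0 hS.
have U1 : U [set t | ~ (sup S + e / 2 <= f t)].
  have [Sh|//] := in_ultra_setVsetC [set t | sup S + e / 2 <= f t] UU.
  by have := ub_le_sup hS.2 Sh; lra.
apply: filterS2 Sx U1 => t /= xt /negP; rewrite -ltNge => ft.
rewrite ler_norml; apply/andP; split; lra.
Qed.

Section Completeness.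
Context {R : realType} {H : hilbertType R}.
Implicit Types (u v w : H).

Lemma cauchy_map_cvg T (F : set_system T) (f : T -> H) : ProperFilter F ->
  (forall e : R, 0 < e ->
    exists2 A, F A & forall s t, A s -> A t -> `|f s - f t| < e) ->
  exists l : H, f @ F --> l.
Proof.
move=> PF Cf; apply/cvg_ex; apply/cauchy_cvgP; apply: cauchy_exP => e e0.
have [A FA fA] := Cf _ e0; have [s As] := filter_ex FA.
exists (f s); rewrite /fmap /=; apply: filterS FA => t At.
by rewrite -ball_normE /=; apply: fA.
Qed.

Lemma orthogonal_min (V : set H) x y : linear_subset V -> V y ->
  (forall z, V z -> `|x - y| ^+ 2 <= `|x - z| ^+ 2) ->
  forall z, V z -> inner (x - y) z = 0.
Proof.
move=> lV Vy ymin z Vz; have [->|z0] := eqVneq z 0; first exact: inner0r.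
have zp : 0 < `|z| ^+ 2 by rewrite exprn_gt0 // normr_gt0.
(* The distance from [x] to the points y + t z is least at this value. *)
pose t := inner (x - y) z / `|z| ^+ 2.
have := ymin (y + t *: z) (linear_subsetD lV Vy (linear_subsetZ t lV Vz)).
rewrite opprD addrA [leRHS]normr_sqB normrZ exprMn real_normK ?num_real // innerZr.
have tE : t * `|z| ^+ 2 = inner (x - y) z by rewrite /t divfK // gt_eqF.
rewrite (_ : t ^+ 2 * `|z| ^+ 2 = t * inner (x - y) z); last by rewrite -tE; ring.
move=> h; have {}h : t * inner (x - y) z <= 0 by lra.
apply/eqP; rewrite -sqrf_eq0 eq_le sqr_ge0 andbT expr2 -{1}tE mulrAC.
by rewrite pmulr_lle0.
Qed.

Lemma projection_exists (V : set H) x : closed_subspace V ->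
  exists2 y, V y & forall z, V z -> inner (x - y) z = 0.
Proof.
move=> cV; have lV := closed_subspace_linear cV.
pose D : set R := [set `|x - z| ^+ 2 | z in V].
have hD : has_inf D.
  split; first by exists (`|x - 0| ^+ 2), 0 => //; case: lV.
  by exists 0 => _ [z _ <-]; rewrite sqr_ge0.
have lbD z : V z -> inf D <= `|x - z| ^+ 2.
  by move=> Vz; apply: ge_inf; [case: hD|exists z].
have near_inf n : {y | V y & `|x - y| ^+ 2 < inf D + n.+1%:R^-1}.
  apply: cid2; have n0 : (0 : R) < n.+1%:R^-1 by rewrite invr_gt0 ltr0n.
  by have [_ [y Vy <-] yn] := inf_adherent n0 hD; exists y.
pose y n := s2val (near_inf n).
have Vy n : V (y n) := s2valP (near_inf n).
have yn n : `|x - y n| ^+ 2 < inf D + n.+1%:R^-1 := s2valP' (near_inf n).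
(* Parallelogram law: the midpoint of two near-minimisers is no closer to [x] than the infimum,
   which forces them together. *)
have ycauchy n m : `|y n - y m| ^+ 2 <= 2 * n.+1%:R^-1 + 2 * m.+1%:R^-1.
  have Vh : V (2^-1 *: (y n + y m)).
    by apply: linear_subsetZ => //; apply: linear_subsetD.
  have := lbD _ Vh; have := yn n; have := yn m.
  have -> : `|x - 2^-1 *: (y n + y m)| ^+ 2 =
      2^-1 * `|x - y n| ^+ 2 + 2^-1 * `|x - y m| ^+ 2 - 4^-1 * `|y n - y m| ^+ 2.
    rewrite !normr_sqB normrZ exprMn innerZr innerDr normr_sqD.
    by rewrite real_normK ?num_real //; field.
  move: (n.+1%:R^-1) (m.+1%:R^-1) (`|y n - y m| ^+ 2) (`|x - y m| ^+ 2)
    (`|x - y n| ^+ 2) (inf D) => a c Y X1 X2 d h1 h2 h3; lra.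
have [l yl] : exists l : H, y @ \oo --> l.
  apply: cauchy_map_cvg => e e0.
  have e4 : 0 < e ^+ 2 / 4 by rewrite divr_gt0 // exprn_gt0.
  exists [set n | n.+1%:R^-1 < e ^+ 2 / 4 :> R].
    exact: (near_infty_natSinv_lt (PosNum e4)).
  move=> n m /= hn hm; rewrite -(@ltr_pXn2r _ 2) ?nnegrE ?(ltW e0) //.
  apply: le_lt_trans (ycauchy n m) _; move: hn hm.
  move: (n.+1%:R^-1) (m.+1%:R^-1) (e ^+ 2) => a c q hn hm; lra.
have Vl : V l by case: cV => clV _ _; apply: (closed_cvg V clV _ l yl); exact: nearW.
exists l => //; apply: orthogonal_min => // z Vz.
suff : `|x - l| ^+ 2 <= inf D by move=> h; apply: le_trans h (lbD _ Vz).
have cv : (fun n => `|x - y n| ^+ 2) @ \oo --> `|x - l| ^+ 2.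
  rewrite expr2; under eq_fun do rewrite expr2.
  have h : (fun n => `|x - y n|) @ \oo --> `|x - l|.
    by apply: cvg_norm; apply: cvgB => //; exact: cvg_cst.
  exact: cvgM.
have cv2 : (fun n => inf D + n.+1%:R^-1) @ \oo --> inf D + 0.
  by apply: cvgD; [exact: cvg_cst|exact: cvg_harmonic].
rewrite -[leRHS]addr0; apply: (ler_cvg_to cv cv2).
by apply: nearW => n; apply: ltW.
Qed.

Section ClosedProjection.
Variables (V : set H) (cV : closed_subspace V).
Local Notation P := (orthogonal_projection V).

Lemma orthogonal_projectionP x : V (P x) /\ forall z, V z -> inner (x - P x) z = 0.
Proof.
have [y Vy xy] := projection_exists x cV.
by rewrite (orthogonal_projection_eq cV Vy xy).
Qed.

Lemma orthogonal_projection_in x : V (P x).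
Proof. by case: (orthogonal_projectionP x). Qed.

Lemma orthogonal_projection_orth x z : V z -> inner (x - P x) z = 0.
Proof. by case: (orthogonal_projectionP x) => _; apply. Qed.

Lemma orthogonal_projection_inner x z : V z -> inner (P x) z = inner x z.
Proof.
by move=> /(orthogonal_projection_orth x); rewrite innerBl => /subr0_eq ->.
Qed.

Lemma orthogonal_projection_linear a x y : P (a *: x + y) = a *: P x + P y.
Proof.
apply: orthogonal_projection_eq => //.
  by case: cV => _ _; apply; exact: orthogonal_projection_in.
move=> z Vz; rewrite innerBl !innerDl !innerZl !orthogonal_projection_inner //.
by rewrite subrr.
Qed.

Lemma orthogonal_projection_id x : V x -> P x = x.
Proof.
by move=> Vx; apply: orthogonal_projection_eq => // z Vz; rewrite subrr inner0l.
Qed.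

Lemma orthogonal_projection_norm x : `|P x| ^+ 2 + `|x - P x| ^+ 2 = `|x| ^+ 2.
Proof.
have h := orthogonal_projection_inner x (orthogonal_projection_in x).
by rewrite normr_sqB !normr_inner -h; ring.
Qed.

Lemma orthogonal_projection_le x : `|P x| <= `|x|.
Proof.
rewrite -(@ler_pXn2r _ 2) ?nnegrE //.
rewrite -(orthogonal_projection_norm x) lerDl.
exact: sqr_ge0.
Qed.

Lemma orthogonal_projection_eq0 x : (forall z, V z -> inner x z = 0) -> P x = 0.
Proof.
move=> xV; apply: orthogonal_projection_eq => //; first by case: cV.
by move=> z /xV; rewrite subr0.
Qed.

End ClosedProjection.

(** Forms replace the self-adjoint operators that they represent, so that averages and ultralimits
    can be taken value by value. Positivity is stated apart. *)
Record bounded_form (C : R) (B : H -> H -> R) : Prop := {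
  formC : forall u v, B u v = B v u ;
  formP : forall a u v w, B (a *: u + v) w = a * B u w + B v w ;
  form_le : forall u v, `|B u v| <= C * (`|u| * `|v|)
}.

Section Forms.
Variables (C : R) (B : H -> H -> R) (fB : bounded_form C B).

Lemma formDl u v w : B (u + v) w = B u w + B v w.
Proof. by rewrite -[u in LHS]scale1r (formP fB) mul1r. Qed.

Lemma form0l w : B 0 w = 0.
Proof. by have := formDl 0 0 w; rewrite addr0; lra. Qed.

Lemma formZl a u w : B (a *: u) w = a * B u w.
Proof. by rewrite -[_ *: _]addr0 (formP fB) form0l addr0. Qed.

Lemma formDr u v w : B w (u + v) = B w u + B w v.
Proof. by rewrite (formC fB) formDl !(formC fB _ w). Qed.

Lemma formZr a u w : B w (a *: u) = a * B w u.
Proof. by rewrite (formC fB) formZl (formC fB). Qed.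

Lemma formNl u w : B (- u) w = - B u w.
Proof. by rewrite -scaleN1r formZl mulN1r. Qed.

Lemma formNr u w : B w (- u) = - B w u.
Proof. by rewrite -scaleN1r formZr mulN1r. Qed.

Lemma form_sqD u v : B (u + v) (u + v) = B u u + 2 * B u v + B v v.
Proof. rewrite formDl !formDr (formC fB v u); ring. Qed.

Lemma form_sqB u v : B (u - v) (u - v) = B u u - 2 * B u v + B v v.
Proof. rewrite form_sqD !formNl !formNr; ring. Qed.

Lemma form_sq_le u : B u u <= C * `|u| ^+ 2.
Proof. by apply: le_trans (ler_norm _) _; rewrite expr2; exact: form_le. Qed.

Lemma form_dist u v : `|B u u - B v v| <= C * (`|u - v| * (`|u| + `|v|)).
Proof.
have -> : B u u - B v v = B (u - v) u + B (u - v) v.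
  by rewrite !formDl !formNl (formC fB u v); ring.
apply: le_trans (ler_normD _ _) _; rewrite mulrDr mulrDr.
by apply: lerD; exact: form_le.
Qed.

End Forms.

End Completeness.

(** * Top eigenspace of a nonnegative form of finite trace *)

Section TopEigenspace.
Context {R : realType} {H : hilbertType R}.
Implicit Types (u v w : H).

Lemma local_lipschitz_continuous (W : normedModType R) (f : H -> W) (K : H -> R) :
  (forall u v, `|u - v| <= 1 -> `|f u - f v| <= K u * `|u - v|) -> continuous f.
Proof.
move=> fK u; apply/cvgrPdist_lt => /= e e0.
have K0 : 0 < `|K u| + 1 by rewrite ltr_wpDl.
near=> w.
have uw1 : `|u - w| <= 1.
  by near: w; apply: (@cvgr_dist_le _ _ _ (nbhs u) _ id u) => //; exact: cvg_id.
apply: le_lt_trans (fK _ _ uw1) _.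
apply: (@le_lt_trans _ _ ((`|K u| + 1) * `|u - w|)).
  by rewrite ler_wpM2r // (le_trans (ler_norm _)) // lerDl.
rewrite mulrC -ltr_pdivlMr //; near: w.
apply: (@cvgr_dist_lt _ _ _ (nbhs u) _ id u); last by rewrite divr_gt0.
exact: cvg_id.
Unshelve. all: by end_near. Qed.

Lemma form_sq_continuous C (B : H -> H -> R) : bounded_form C B ->
  continuous (fun u => B u u).
Proof.
move=> fB; have C0 : forall u v, 0 <= C * (`|u| * `|v|).
  by move=> u v; apply: le_trans (form_le fB u v).
apply: (@local_lipschitz_continuous _ _ (fun u => `|C| * (2 * `|u| + 1))) => u v uv.
apply: le_trans (form_dist fB u v) _; rewrite mulrA.
rewrite -mulrA [leRHS]mulrAC -mulrA.
have h : `|v| <= `|u| + 1.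
  rewrite -[v](subKr u) (le_trans (ler_normB _ _)) // lerD2l //.
apply: (@le_trans _ _ (`|C| * (`|u - v| * (`|u| + `|v|)))).
  by rewrite ler_wpM2r ?ler_norm // mulr_ge0 // addr_ge0.
by rewrite !ler_wpM2l //; lra.
Qed.

Lemma proj_continuous (e : seq H) : onb e -> continuous (proj e).
Proof.
move=> oe; apply: (@local_lipschitz_continuous _ _ (fun=> 1)) => u v _.
by rewrite mul1r -projB proj_le.
Qed.

Lemma closed_span_onb (e : seq H) : onb e -> closed_subspace (linear_span [set` e]).
Proof.
move=> oe; have [V0 VP] := @linear_span_linear R H [set` e]; split=> //.
rewrite linear_span_onb //.
have -> : [set u | proj e u = u] = (fun u => proj e u - u) @^-1` [set 0].
  by apply/seteqP; split=> u /=; [move=> ->; rewrite subrr|move/subr0_eq].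
apply: preimage_closed; last first.
  exact: accessible_closed_set1 (hausdorff_accessible (@norm_hausdorff _ _)) _.
by move=> u _; apply: cvgB; [exact: proj_continuous|exact: cvg_id].
Qed.

(** Markov's inequality for the trace: [t] times the size of the family is at most [S]. *)
Lemma orthonormal_coercive (e : seq H) (B : H -> H -> R) (t S : R) : 0 < t ->
  (forall e, onb e -> \sum_(c <- e) B c c <= S) -> onb e ->
  (forall c, c \in e -> t <= B c c) -> (size e <= Num.truncn (S / t))%N.
Proof.
move=> t0 BS oe te; have S0 : 0 <= S by have := BS [::] I; rewrite big_nil.
rewrite truncn_ge_nat; last by rewrite divr_ge0 // ltW.
rewrite ler_pdivlMr //.
apply: le_trans (BS _ oe); rewrite big_seq.
apply: (@le_trans _ _ (\sum_(c <- e | c \in e) t)); last exact: ler_sum.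
by rewrite -big_seq big_const_seq count_predT iter_addr_0 mulrC mulr_natr.
Qed.

Variables (C S : R) (B : H -> H -> R).
Hypotheses (fB : bounded_form C B) (B_ge0 : forall u, 0 <= B u u).
Hypothesis BS : forall e, onb e -> \sum_(c <- e) B c c <= S.

(* A maximal orthonormal family on which B is at least t exists by the trace
   bound; on its orthogonal complement B < t, which stands in for the
   compactness of the operator of B. *)
Lemma form_small_outside t : 0 < t ->
  exists2 e, onb e & forall u, (forall c, c \in e -> inner u c = 0) ->
    B u u <= t * `|u| ^+ 2.
Proof.
move=> t0.
pose P n := `[< exists e : seq H, [/\ onb e, (forall c, c \in e -> t <= B c c) & size e = n] >].
have exP : exists n, P n by exists 0%N; apply/asboolP; exists [::].
have ubP n : P n -> (n <= Num.truncn (S / t))%N.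
  by move=> /asboolP[e [oe te <-]]; apply: orthonormal_coercive te.
case: (ex_maxnP exP ubP) => n /asboolP[e [oe te en]] nmax.
exists e => // u ue; apply: contrapT => /negP; rewrite -ltNge => Bu.
have u0 : `|u| != 0.
  by apply/eqP => u0; move: Bu; rewrite u0 expr0n mulr0 (normr0_eq0 u0) (form0l fB) ltxx.
suff /nmax : P n.+1 by rewrite ltnn.
apply/asboolP; exists (`|u|^-1 *: u :: e); split=> /=; last by rewrite en.
  split=> //; first by rewrite innerZl innerZr -normr_inner; field.
  by move=> v ve; rewrite innerZl ue // mulr0.
move=> c; rewrite inE => /orP[/eqP ->|/te //].
rewrite (formZl fB) (formZr fB) mulrA -invfM -expr2 mulrC ler_pdivlMr ?ltW //.
by rewrite exprn_gt0 // lt_neqAle eq_sym u0 normr_ge0.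
Qed.

Hypothesis B_neq0 : exists u, 0 < B u u.

(** The supremum [lam] of the form on the unit sphere is attained: along an ultrafilter a maximising
    sequence converges on the finite-dimensional part given by [form_small_outside], and off this
    part the defect lam |u|^2 - B u u controls the norm. *)
Lemma top_eigenvector : exists lam : R, [/\ 0 < lam, forall u, B u u <= lam * `|u| ^+ 2
  & exists2 v, v <> 0 & B v v = lam * `|v| ^+ 2].
Proof.
pose D : set R := [set B u u | u in [set u | `|u| = 1]].
have [u0 Bu0] := B_neq0.
have nu0 : 0 < `|u0|.
  rewrite normr_gt0; apply/eqP => u00; move: Bu0; rewrite u00 (form0l fB) ltxx //.
have Dnrm u : `|u| != 0 -> D (B u u / `|u| ^+ 2).
  move=> nu; exists (`|u|^-1 *: u).
    by rewrite /= normrZ normfV normr_id mulVf.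
  by rewrite (formZl fB) (formZr fB) mulrA -invfM -expr2 mulrC.
have hD : has_sup D.
  split; first by exists (B u0 u0 / `|u0| ^+ 2); apply: Dnrm; rewrite gt_eqF.
  by exists C => _ [u u1 <-]; apply: le_trans (form_sq_le fB u) _; rewrite u1 expr1n mulr1.
pose lam := sup D.
have lamP u : B u u <= lam * `|u| ^+ 2.
  have [u00|nu] := eqVneq `|u| 0.
    by rewrite u00 expr0n mulr0 (normr0_eq0 u00) (form0l fB).
  rewrite -ler_pdivrMr; first by apply: ub_le_sup; [case: hD|exact: Dnrm].
  by rewrite exprn_gt0 // lt_neqAle eq_sym nu normr_ge0.
have lam0 : 0 < lam.
  have h : 0 < lam * `|u0| ^+ 2 by apply: lt_le_trans (lamP u0).
  by rewrite -(pmulr_lgt0 _ (exprn_gt0 2 nu0)).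
exists lam; split=> //.
(* Any level below [lam] would do: on the complement of [e] the defect then dominates a positive
   multiple of the squared norm. *)
have [e oe eP] := form_small_outside (divr_gt0 lam0 (@ltr0n R 2)).
have near_sup n : {v | `|v| = 1 & lam - n.+1%:R^-1 < B v v}.
  apply: cid2; have n0 : (0 : R) < n.+1%:R^-1 by rewrite invr_gt0 ltr0n.
  by have [_ [v v1 <-] vn] := sup_adherent n0 hD; exists v.
pose v n := s2val (near_sup n).
have v1 n : `|v n| = 1 := s2valP (near_sup n).
have vn n : lam - n.+1%:R^-1 < B (v n) (v n) := s2valP' (near_sup n).
have [U [UU sU]] := ultraFilterLemma (@eventually_filter).
have PU : ProperFilter U by exact: ultra_proper.
have [f fU] : exists f : H, (proj e \o v) @ U --> f.
  rewrite /proj; elim: (e) => [|c e' [f IH]].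
    by exists 0; apply/cvgrPdist_lt => x x0; apply: nearW => n /=; rewrite big_nil subrr normr0.
  have vc n : `|inner (v n) c| <= `|c| by have := cauchy_schwarz (v n) c; rewrite v1 mul1r.
  have [l lU] := ultra_cvg UU vc.
  exists (l *: c + f); rewrite /comp; under eq_fun do rewrite big_cons.
  by apply: cvgD; [apply: cvgZr_tmp|exact: IH].
pose r u := lam * `|u| ^+ 2 - B u u.
have r_ge0 u : 0 <= r u by rewrite subr_ge0.
have rB u w : r (u - w) <= 2 * r u + 2 * r w.
  have := r_ge0 (u + w); rewrite /r (form_sqB fB) (form_sqD fB) normr_sqB normr_sqD; lra.
have rv n : r (v n) < n.+1%:R^-1.
  by rewrite /r v1 expr1n mulr1; rewrite ltrBlDr addrC -ltrBlDr; exact: vn.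
(* With g the projection of d to the span of [e], lam/2 |d - g|^2 <= r (d - g) <= 2 r d + 2 r g <= 8
   eta + 8 lam eta^2. Hence |d - g|^2 <= (16 / lam) eta + 16 eta^2, to which |g|^2 <= 4 eta^2 is
   added. *)
have vdist eta n m : 0 < eta -> r (v n) < eta -> r (v m) < eta ->
    `|proj e (v n) - f| < eta -> `|proj e (v m) - f| < eta ->
    `|v n - v m| ^+ 2 <= (16 / lam) * eta + 20 * eta ^+ 2.
  move=> eta0 rn rm fn fm; set d := v n - v m; set g := proj e d.
  have g2 : `|g| ^+ 2 <= 4 * eta ^+ 2.
    rewrite (_ : 4 * _ = (2 * eta) ^+ 2); last by ring.
    rewrite ler_pXn2r ?nnegrE ?mulr_ge0 ?(ltW eta0) //.
    have -> : g = (proj e (v n) - f) - (proj e (v m) - f).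
      by rewrite /g projB opprB addrA subrK.
    by apply: ltW; apply: le_lt_trans (ler_normB _ _) _; lra.
  have dE : `|d| ^+ 2 = `|d - g| ^+ 2 + `|g| ^+ 2 by rewrite normr_projB // subrK.
  have we : B (d - g) (d - g) <= lam / 2 * `|d - g| ^+ 2.
    by apply: eP => c ce; rewrite innerBl inner_proj // subrr.
  have h1 : lam / 2 * `|d - g| ^+ 2 <= r (d - g) by rewrite /r; lra.
  have h2 := rB d g; have h3 : r d <= 2 * r (v n) + 2 * r (v m) := rB _ _.
  have h4 : r g <= lam * `|g| ^+ 2 by rewrite /r; have := B_ge0 g; lra.
  have h5 : lam * `|d - g| ^+ 2 <= lam * (16 / lam * eta + 16 * eta ^+ 2).
    have -> : lam * (16 / lam * eta + 16 * eta ^+ 2) = 16 * eta + 16 * (lam * eta ^+ 2).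
      by field; rewrite gt_eqF.
    have h6 : lam * `|g| ^+ 2 <= lam * (4 * eta ^+ 2) by rewrite ler_pM2l.
    lra.
  move: h5; rewrite ler_pM2l // => h5; rewrite dE; lra.
have [w vw] : exists w : H, v @ U --> w.
  apply: cauchy_map_cvg => x x0.
  pose K := 16 / lam + 20.
  have K0 : 0 < K by rewrite addr_gt0 // divr_gt0.
  (* As [eta] is at most 1, so that eta^2 <= eta, the bound of [vdist] is at most K eta <= x^2 /
     2. *)
  pose eta := Num.min 1 (x ^+ 2 / (2 * K)).
  have eta0 : 0 < eta.
    by rewrite lt_min ltr01 /= divr_gt0 ?exprn_gt0 ?mulr_gt0.
  exists ([set n | n.+1%:R^-1 < eta :> R] `&` [set n | `|proj e (v n) - f| < eta]).
    apply: filterI; first by apply: sU; exact: (near_infty_natSinv_lt (PosNum eta0)).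
    by move/cvgrPdist_lt : fU => /(_ _ eta0); apply: filterS => n /=; rewrite distrC.
  move=> n m [/= nn fn] [/= nm fm].
  rewrite -(@ltr_pXn2r _ 2) ?nnegrE ?(ltW x0) //.
  apply: le_lt_trans (vdist eta n m eta0 _ _ fn fm) _.
  - exact: lt_trans (rv n) nn.
  - exact: lt_trans (rv m) nm.
  have eta1 : eta <= 1 by rewrite ge_min lexx.
  have etaK : eta * (2 * K) <= x ^+ 2.
    by rewrite -ler_pdivlMr ?mulr_gt0 // ge_min lexx orbT.
  have e2 : eta ^+ 2 <= eta by rewrite expr2 ler_piMl // ltW.
  have x2 : 0 < x ^+ 2 by rewrite exprn_gt0.
  have KE : K = 16 / lam + 20 by [].
  have : 16 / lam * eta + 20 * eta ^+ 2 <= K * eta by rewrite KE mulrDl; lra.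
  move=> h; apply: le_lt_trans h _; lra.
have w1 : `|w| = 1.
  have h : (fun n => `|v n|) @ U --> `|w| by apply: cvg_norm.
  have h2 : (fun n => `|v n|) @ U --> (1 : R).
    by under eq_fun do rewrite v1; exact: cvg_cst.
  exact: (cvg_unique _ h h2).
exists w; first by move=> w0; move: w1; rewrite w0 normr0 => /eqP; rewrite eq_sym oner_eq0.
apply/eqP; rewrite eq_le lamP w1 expr1n mulr1 /=.
have cB : (fun n => B (v n) (v n)) @ U --> B w w.
  by have := cvg_comp v (fun u => B u u) vw (form_sq_continuous fB (x := w)).
have cl : (fun n => lam - n.+1%:R^-1) @ U --> lam - 0.
  apply: cvgB; first exact: cvg_cst.
  apply: cvg_trans (@cvg_harmonic R).
  by move=> A hA; apply: sU.
rewrite -[leLHS]subr0; apply: (ler_cvg_to cl cB).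
by apply: nearW => n; apply: ltW.
Qed.

(** [E] is the zero set of the nonnegative quadratic form lam |u|^2 - B u u, hence linear by the
    parallelogram law; the trace bounds the size of its orthonormal families. *)
Lemma top_eigenspace (lam : R) : 0 < lam -> (forall u, B u u <= lam * `|u| ^+ 2) ->
  let E := [set u | B u u = lam * `|u| ^+ 2] in
  linear_subset E /\ exists2 e, onb e & E = linear_span [set` e].
Proof.
move=> lam0 lamP E.
have lE : linear_subset E.
  split; first by rewrite /E /= (form0l fB) normr0 expr0n mulr0.
  move=> a u v Eu Ev; rewrite /E /=; apply/eqP; rewrite eq_le lamP /=.
  have := lamP (a *: u - v); move: Eu Ev; rewrite /E /=.
  rewrite (form_sqB fB) (form_sqD fB) normr_sqB normr_sqD.
  rewrite !(formZl fB) !(formZr fB) normrZ exprMn real_normK ?num_real //.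
  move=> Eu Ev h.
  have : a * (a * B u u) = lam * (a ^+ 2 * `|u| ^+ 2) by rewrite Eu; ring.
  lra.
split=> //; have [|e [oe _ eE]] := @onb_spans R H E (Num.truncn (S / lam)) lE; last by exists e.
move=> e oe eE; apply: (orthonormal_coercive lam0 BS oe) => c ce.
have -> : B c c = lam * `|c| ^+ 2 by apply: eE.
by rewrite normr_inner (onb_inner oe ce ce) eqxx mulr1.
Qed.

End TopEigenspace.

(** * The affine action and its Markov operator *)

Section BorelGroup.
Context {R : realType} {G : topologicalGroupType}.

Lemma borel_open (U : set G) : open U -> measurable (U : set (borel G)).
Proof. by move=> oU; apply: sub_sigma_algebra. Qed.

Lemma borel_closed (U : set G) : closed U -> measurable (U : set (borel G)).
Proof.
by move=> cU; rewrite -[U]setCK; apply: measurableC; apply: borel_open; rewrite openC.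
Qed.

Lemma continuous_borel_fun (f : G -> R) : continuous f ->
  measurable_fun setT (f : borel G -> R).
Proof.
move=> /continuousP cf; apply: (measurability _ (RGenOpens.measurableE R)).
move=> _ [_ [a [b ->] <-]]; rewrite setTI; apply: borel_open.
exact/cf/interval_open.
Qed.

Lemma continuous_borel_map (f : G -> G) : continuous f ->
  measurable_fun setT (f : borel G -> borel G).
Proof.
move=> /continuousP cf; apply: (@measurability _ _ (borel G) (borel G) setT f (@open G) erefl).
by move=> _ [U oU <-]; rewrite setTI; apply: borel_open; apply: cf.
Qed.

Lemma mulgr_continuous (g : G) : continuous (fun x : G => (x * g)%g).
Proof.
move=> x.
apply: (@cvg_comp _ _ _ (fun x => (x, g)) (fun xy : G * G => (xy.1 * xy.2)%g) _ (nbhs (x, g))).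
  by apply: cvg_pair => /=; [exact: cvg_id|exact: cvg_cst].
exact: (@mulg_continuous G (x, g)).
Qed.

Lemma mulgl_continuous (g : G) : continuous (fun x : G => (g * x)%g).
Proof.
move=> x.
apply: (@cvg_comp _ _ _ (fun x => (g, x)) (fun xy : G * G => (xy.1 * xy.2)%g) _ (nbhs (g, x))).
  by apply: cvg_pair => /=; [exact: cvg_cst|exact: cvg_id].
exact: (@mulg_continuous G (g, x)).
Qed.

End BorelGroup.

(** * Powers of the generating set and countable nets *)

Section Words.
Context {R : realType} {G : topologicalGroupType}.
Variables (Q : set G) (hQ : generating_neighborhood Q).

Lemma setpowD n m x y : setpow Q n x -> setpow Q m y -> setpow Q (n + m) (x * y)%g.
Proof.
elim: m y => [|m IH] y nx /=; first by move=> ->; rewrite addn0 mulg1.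
move=> [z zm [q Qq <-]]; rewrite addnS; exists (x * z)%g; first exact: IH.
by exists q => //; rewrite mulgA.
Qed.

Lemma setpowV n x : setpow Q n x -> setpow Q n (x^-1)%g.
Proof.
elim: n x => [|n IH] x /=; first by move=> ->; rewrite invg1.
move=> [z zn [q Qq <-]]; rewrite invgM.
change (setpow Q (1 + n) (q^-1 * z^-1)%g); apply: setpowD; last exact: IH.
exists 1%g => //; exists (q^-1)%g; last by rewrite mul1g.
exact: gn_symmetric.
Qed.

Lemma setpow_exhaust x : exists n, setpow Q n x.
Proof.
have [U [_ _ UQ gU]] := gn_open hQ.
pose K := [set x | exists n, setpow Q n x].
suff : K = setT by move=> /seteqP[_]; apply.
apply: gU.
- by exists 0%N.
- move=> y z [n yn] [m zm]; exists (n + m)%N; apply: setpowD => //.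
  exact: setpowV.
- by move=> y /UQ Qy; exists 1%N; exists 1%g => //; exists y => //; rewrite mul1g.
Qed.

Lemma setpow_word_length x : x <> 1%g -> setpow Q (word_length Q x) x.
Proof.
move=> /eqP x1; rewrite /word_length (negbTE x1).
case: xgetP => [n _ [] //|] /(_ _)/asboolP none.
have [n0 xn0] := setpow_exhaust x.
have exn : exists n, `[< setpow Q n x >] by exists n0; apply/asboolP.
case: (ex_minnP exn) => n /asboolP xn nmin.
exfalso; have := none n; move=> /asboolP; apply; split=> // k xk.
by apply: nmin; apply/asboolP.
Qed.

(** The powers of [closure Q] are compact because [Q] is precompact, and exhaust the group because
    [Q] generates it. *)
Lemma group_sigma_compact : exists K : nat -> set G,
  (forall n, compact (K n)) /\ forall x, exists n, K n x.
Proof.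
have cQ : compact (closure Q) by rewrite -precompactE; exact: gn_precompact.
pose K := fix K n := if n is n'.+1 then
  (fun xy : G * G => (xy.1 * xy.2)%g) @` (K n' `*` closure Q) else [set 1%g].
exists K; split.
  elim=> [|n IH] /=; first exact: compact_set1.
  apply: continuous_compact; last exact: compact_setX.
  by apply: continuous_subspaceT; exact: mulg_continuous.
move=> x; have [n xn] := setpow_exhaust x; exists n.
elim: n x xn => [|n IH] x //= [y yn [q Qq <-]].
exists (y, q) => //; split; first exact: IH.
exact: subset_closure.
Qed.

(* A continuous image of G is separable; the nets below replace the second
   countability that G may lack. *)
Lemma countable_net (V : normedModType R) (f : G -> V) (e : R) : continuous f -> 0 < e ->
  exists x : nat -> G, forall y, exists k, `|f y - f (x k)| < e.
Proof.
move=> cf e0; have [K [cK KT]] := group_sigma_compact.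
have fin n : exists s : seq G, forall y, K n y -> exists2 x, x \in s & `|f y - f x| < e.
  have := cK n; rewrite compact_cover => /(_ G setT (fun x => [set y | `|f y - f x| < e])).
  case.
  - move=> x _; rewrite openE => y /= yx.
    have := cf y; move/cvgrPdist_lt => /(_ (e - `|f y - f x|)).
    rewrite subr_gt0 => /(_ yx); apply: filterS => z.
    rewrite distrC => yz; rewrite /= -(subrK (f y) (f z)) -addrA.
    by apply: le_lt_trans (ler_normD _ _) _; lra.
  - by move=> x _; exists x => //=; rewrite subrr normr0.
  move=> D _ KD; exists (enum_fset D) => y /KD [x /= xD yx]; by exists x.
pose s n := projT1 (cid (fin n)).
have sP n y : K n y -> exists2 x, x \in s n & `|f y - f x| < e := projT2 (cid (fin n)) y.
(* All the finite nets are listed through a coding of pairs; [1%g] is the value at the numbers that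
   code no entry. *)
exists (fun k : nat =>
  if (choice.unpickle k : option (nat * nat)) is Some (n, i) then nth 1%g (s n) i else 1%g).
move=> y; have [n Kn] := KT y; have [x xs yx] := sP _ _ Kn.
exists (choice.pickle (n, index x (s n))); rewrite choice.pickleK nth_index //.
Qed.

End Words.

Section AffineAction.
Context {R : realType} {G : topologicalGroupType} {H : hilbertType R}.
Variables (pi : G -> {linear H -> H}) (b : G -> H).
Hypotheses (hpi : orthogonal_representation pi) (hb : cocycle pi b).

Definition affine_act (x : G) (u : H) : H := b x + pi x u.
Local Notation act := affine_act.

Lemma rep_norm x u : `|pi x u| = `|u|.
Proof.
by apply/eqP; rewrite -(@eqrXn2 _ 2) // !normr_inner (rep_inner hpi).
Qed.

Lemma rep_invK x u : pi x (pi (x^-1)%g u) = u.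
Proof. by rewrite -(repM hpi) mulgV (rep1 hpi). Qed.

Lemma rep_invVK x u : pi (x^-1)%g (pi x u) = u.
Proof. by rewrite -(repM hpi) mulVg (rep1 hpi). Qed.

Lemma rep_adjoint x u v : inner (pi x u) v = inner u (pi (x^-1)%g v).
Proof. by rewrite -[in RHS](rep_inner hpi x) rep_invK. Qed.

Lemma cocycleM x y : b (x * y)%g = b x + pi x (b y).
Proof. by case: hb. Qed.

Lemma cocycle1 : b 1%g = 0.
Proof.
by have := cocycleM 1%g 1%g; rewrite mulg1 (rep1 hpi) -{1}[b _]addr0 => /addrI.
Qed.

Lemma cocycleV x : b (x^-1)%g = - pi (x^-1)%g (b x).
Proof.
by apply/eqP; rewrite -subr_eq0 opprK -cocycleM mulVg cocycle1.
Qed.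

Lemma actM x y u : act (x * y)%g u = act x (act y u).
Proof. by rewrite /act cocycleM (repM hpi) linearD addrA. Qed.

Lemma act_cocycle x y : act x (b y) = b (x * y)%g.
Proof. by rewrite cocycleM. Qed.

Lemma act0 x : act x 0 = b x.
Proof. by rewrite /act linear0 addr0. Qed.

Lemma act_dist x u v : `|act x u - act x v| = `|u - v|.
Proof. by rewrite /act opprD addrACA subrr add0r -linearB rep_norm. Qed.

Lemma actVK x u : act (x^-1)%g (act x u) = u.
Proof. by rewrite -actM mulVg /act cocycle1 add0r (rep1 hpi). Qed.

Lemma act_distV x u v : `|act x u - v| = `|u - act (x^-1)%g v|.
Proof. by rewrite -(act_dist (x^-1)%g) actVK. Qed.

Lemma act_normV x u : `|act x u| = `|u - b (x^-1)%g|.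
Proof. by rewrite -[in LHS](subr0 (act x u)) act_distV act0. Qed.

Lemma act_continuous u : continuous (act^~ u).
Proof.
move=> x; apply: cvgD; first by case: hb => cb _; exact: cb.
exact: (rep_continuous hpi).
Qed.

Lemma cocycle_continuous : continuous b.
Proof. by case: hb. Qed.

(** The zero set of a cocycle is a subgroup. *)
Lemma cocycle_invariant (S : set G) : generates S -> (forall x, S x -> b x = 0) ->
  forall x, b x = 0.
Proof.
move=> gS S0 x; pose K := [set x | b x = 0].
suff : K = setT by move=> /seteqP[_ /(_ x I)].
apply: gS => //; first exact: cocycle1.
move=> y z /= y0 z0; rewrite /K /= cocycleM y0 add0r cocycleV z0.
by rewrite linear0 oppr0 linear0.
Qed.

(** Adding 1 makes the norm submultiplicative along the action ([weight_act]), so that the growth in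
    [u] separates from the moments of b. *)
Definition weight (u : H) : R := 1 + `|u|.

Lemma weight_ge1 u : 1 <= weight u.
Proof. by rewrite /weight lerDl. Qed.

Lemma weight_gt0 u : 0 < weight u.
Proof. exact: lt_le_trans ltr01 (weight_ge1 u). Qed.

Lemma weight_ge0 u : 0 <= weight u.
Proof. exact: ltW (weight_gt0 u). Qed.

Lemma weight_act x u : weight (act x u) <= weight (b x) * weight u.
Proof.
rewrite /weight /act; apply: (@le_trans _ _ (1 + (`|b x| + `|u|))).
  by rewrite lerD2l -(rep_norm x u) ler_normD.
have : 0 <= `|b x| * `|u| by rewrite mulr_ge0. lra.
Qed.

(** The class of test functions. It contains the norm and the quadratic forms, is stable under
    products and, when all moments are finite, under the Markov operator; its members are continuous
    and integrable along the action. *)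
Definition polylip (f : H -> R) := exists (C : R) (k : nat), 0 <= C /\
  forall u v, `|f u - f v| <= C * (weight u * weight v) ^+ k * `|u - v|.

Lemma weight_leX u v k l : (k <= l)%N ->
  (weight u * weight v) ^+ k <= (weight u * weight v) ^+ l.
Proof.
by move=> kl; apply: ler_weXn2l => //; rewrite -[1]mulr1 ler_pM ?weight_ge1.
Qed.

Lemma polylip_le (f : H -> R) C k l : 0 <= C -> (k <= l)%N ->
  (forall u v, `|f u - f v| <= C * (weight u * weight v) ^+ k * `|u - v|) ->
  forall u v, `|f u - f v| <= C * (weight u * weight v) ^+ l * `|u - v|.
Proof.
move=> C0 kl fk u v; apply: le_trans (fk u v) _.
by rewrite ler_wpM2r // ler_wpM2l // weight_leX.
Qed.

Lemma polylip_cst c : polylip (fun=> c).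
Proof. by exists 0, 0%N; split=> // u v; rewrite subrr normr0 !mul0r. Qed.

Lemma lipschitz_polylip (f : H -> R) C : (forall u v, `|f u - f v| <= C * `|u - v|) ->
  polylip f.
Proof.
move=> fC; exists `|C|, 0%N; split=> // u v; rewrite expr0 mulr1.
by apply: le_trans (fC u v) _; rewrite ler_wpM2r // ler_norm.
Qed.

Lemma polylipD f g : polylip f -> polylip g -> polylip (fun u => f u + g u).
Proof.
move=> [C [k [C0 fC]]] [D [l [D0 gD]]]; exists (C + D), (maxn k l).
split=> [|u v]; first exact: addr_ge0.
rewrite opprD addrACA (le_trans (ler_normD _ _)) // (mulrDl C D) (mulrDl (C * _)) lerD //.
  by apply: (polylip_le C0 _ fC); exact: leq_maxl.
by apply: (polylip_le D0 _ gD); exact: leq_maxr.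
Qed.

Lemma polylipZ c f : polylip f -> polylip (fun u => c * f u).
Proof.
move=> [C [k [C0 fC]]]; exists (`|c| * C), k; split=> [|u v]; first exact: mulr_ge0.
by rewrite -mulrBr normrM -!mulrA ler_wpM2l // mulrA.
Qed.

Lemma polylipB f g : polylip f -> polylip g -> polylip (fun u => f u - g u).
Proof.
move=> pf pg; have := polylipD pf (polylipZ (-1) pg).
by under [in X in X -> _]eq_fun do rewrite mulN1r.
Qed.

Lemma polylip_growth f : polylip f -> exists (C : R) (k : nat), 0 <= C /\
  forall u, `|f u| <= C * weight u ^+ k.
Proof.
move=> [C [k [C0 fC]]]; exists (C + `|f 0|), k.+1; split=> [|u]; first exact: addr_ge0.
rewrite -[f u](subrK (f 0)) (le_trans (ler_normD _ _)) // (mulrDl C) lerD //.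
  apply: le_trans (fC _ _) _; rewrite subr0 {2}/weight normr0 addr0 mulr1 -mulrA.
  by rewrite ler_wpM2l // exprSr ler_wpM2l ?exprn_ge0 ?weight_ge0 // /weight lerDr.
by rewrite ler_peMr // exprn_ege1 // weight_ge1.
Qed.

Lemma polylipM f g : polylip f -> polylip g -> polylip (fun u => f u * g u).
Proof.
move=> pf pg; have [C' [k' [C'0 fC']]] := polylip_growth pf.
have [D' [l' [D'0 gD']]] := polylip_growth pg.
move: pf pg => [C [k [C0 fC]]] [D [l [D0 gD]]].
exists (C' * D + D' * C), (k' + l + (l' + k))%N.
split=> [|u v]; first by rewrite addr_ge0 ?mulr_ge0.
have -> : f u * g u - f v * g v = f u * (g u - g v) + g v * (f u - f v) by ring.
rewrite (le_trans (ler_normD _ _)) // (mulrDl (C' * D)) (mulrDl (C' * D * _)) !normrM.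
have Wu n : weight u ^+ n <= (weight u * weight v) ^+ n.
  by rewrite exprMn ler_peMr ?exprn_ge0 ?weight_ge0 // exprn_ege1 // weight_ge1.
have Wv n : weight v ^+ n <= (weight u * weight v) ^+ n.
  by rewrite exprMn ler_peMl ?exprn_ge0 ?weight_ge0 // exprn_ege1 // weight_ge1.
have WW n : 0 <= (weight u * weight v) ^+ n by rewrite exprn_ge0 // mulr_ge0 ?weight_ge0.
apply: lerD.
  apply: (@le_trans _ _ (C' * (weight u * weight v) ^+ k' * (D * (weight u * weight v) ^+ l * `|u - v|))).
    apply: ler_pM => //; apply: le_trans (fC' u) _; exact: ler_wpM2l.
  rewrite (_ : _ * _ = C' * D * (weight u * weight v) ^+ (k' + l) * `|u - v|); last first.
    by rewrite exprD; ring.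
  by rewrite ler_wpM2r // ler_wpM2l ?mulr_ge0 // weight_leX // leq_addr.
apply: (@le_trans _ _ (D' * (weight u * weight v) ^+ l' * (C * (weight u * weight v) ^+ k * `|u - v|))).
  apply: ler_pM => //; apply: le_trans (gD' v) _; exact: ler_wpM2l.
rewrite (_ : _ * _ = D' * C * (weight u * weight v) ^+ (l' + k) * `|u - v|); last first.
  by rewrite exprD; ring.
by rewrite ler_wpM2r // ler_wpM2l ?mulr_ge0 // weight_leX // leq_addl.
Qed.

Lemma polylip_sum (I : Type) (r : seq I) (F : I -> H -> R) :
  (forall i, polylip (F i)) -> polylip (fun u => \sum_(i <- r) F i u).
Proof.
move=> pF; elim: r => [|i r IH].
  by under eq_fun do rewrite big_nil; exact: polylip_cst.
by under eq_fun do rewrite big_cons; exact: polylipD.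
Qed.

Lemma polylip_norm : polylip (fun u => `|u|).
Proof.
by apply: (@lipschitz_polylip _ 1) => u v; rewrite mul1r ler_dist_dist.
Qed.

Lemma polylip_form C B : bounded_form C B -> polylip (fun u => B u u).
Proof.
move=> fB; exists `|2 * C|, 1%N; split=> // u v; rewrite expr1.
apply: le_trans (form_dist fB u v) _; rewrite [leRHS]mulrAC normrM -mulrA [leRHS]mulrAC.
have h0 : 0 <= `|u - v| * (`|u| + `|v|) by rewrite mulr_ge0 // addr_ge0.
apply: (@le_trans _ _ (`|C| * (`|u - v| * (`|u| + `|v|)))); first by rewrite ler_wpM2r // ler_norm.
rewrite (ger0_norm (ltW (@ltr0n R 2))).
rewrite (_ : 2 * _ * _ = `|C| * (`|u - v| * (2 * (weight u * weight v)))); last ring.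
rewrite ler_wpM2l // ler_wpM2l // /weight.
have h1 : 0 <= `|u| * `|v| by rewrite mulr_ge0.
by have := normr_ge0 u; have := normr_ge0 v; lra.
Qed.

Lemma polylip_continuous f : polylip f -> continuous f.
Proof.
move=> [C [k [C0 fC]]].
pose K u := C * (weight u * (weight u + 1)) ^+ k.
apply: (@local_lipschitz_continuous _ _ _ f K); rewrite /K => u v uv.
apply: le_trans (fC u v) _; rewrite ler_wpM2r // ler_wpM2l //.
rewrite lerXn2r ?nnegrE ?mulr_ge0 ?addr_ge0 ?weight_ge0 //.
rewrite ler_wpM2l ?weight_ge0 //.
rewrite /weight -addrA lerD2l -[v](subKr u) (le_trans (ler_normB _ _)) // lerD2l //.
Qed.

End AffineAction.

Section MarkovOperator.
Context {R : realType} {G : topologicalGroupType} {H : hilbertType R}.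
Variables (pi : G -> {linear H -> H}) (b : G -> H).
Hypotheses (hpi : orthogonal_representation pi) (hb : cocycle pi b).
Variable mu : probability (borel G) R.

Definition has_moments := forall k : nat,
  mu.-integrable setT (EFin \o (fun x : borel G => weight (b x) ^+ k)).
Hypothesis mom : has_moments.

Local Notation act := (affine_act pi b).

Definition markov (f : H -> R) (u : H) : R := \int[mu]_x f (act x u).

Lemma integrable_dominated (F : G -> R) (C : R) k : continuous F ->
  (forall x, `|F x| <= C * weight (b x) ^+ k) ->
  mu.-integrable setT (EFin \o (F : borel G -> R)).
Proof.
move=> cF FC; apply: (le_integrable _ _ _ (integrableZl measurableT C (mom k))) => //.
  by apply/measurable_EFinP; apply: continuous_borel_fun.
by move=> x _ /=; rewrite lee_fin (le_trans (FC x)) // ler_norm.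
Qed.

Lemma polylip_act_continuous f u : polylip f -> continuous (fun x => f (act x u)).
Proof.
move=> pf x; apply: (cvg_comp (act^~ u) f); first exact: act_continuous.
exact: polylip_continuous.
Qed.

Lemma polylip_integrable f u : polylip f ->
  mu.-integrable setT (EFin \o (fun x : borel G => f (act x u))).
Proof.
move=> pf; have [C [k [C0 fC]]] := polylip_growth pf.
apply: (@integrable_dominated _ (C * weight u ^+ k) k).
  exact: polylip_act_continuous.
move=> x; apply: le_trans (fC _) _; rewrite -mulrA ler_wpM2l //.
rewrite mulrC -exprMn lerXn2r ?nnegrE ?mulr_ge0 ?weight_ge0 //.
exact: weight_act.
Qed.

Lemma markovD f g u : polylip f -> polylip g ->
  markov (fun v => f v + g v) u = markov f u + markov g u.
Proof. by move=> pf pg; rewrite /markov RintegralD //; exact: polylip_integrable. Qed.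

Lemma markovZ c f u : polylip f -> markov (fun v => c * f v) u = c * markov f u.
Proof. by move=> pf; rewrite /markov RintegralZl //; exact: polylip_integrable. Qed.

Lemma markov_cst c u : markov (fun=> c) u = c.
Proof.
rewrite /markov Rintegral_cst //; transitivity (c * fine (1 : \bar R)); last exact: mulr1.
by congr (c * fine _); exact: probability_setT.
Qed.

Lemma markov_le f g u : polylip f -> polylip g -> (forall v, f v <= g v) ->
  markov f u <= markov g u.
Proof. by move=> pf pg fg; apply: le_Rintegral => //; exact: polylip_integrable. Qed.

(** The action is isometric, so only the weights change: each of the two gives a factor weight (b
    x)^k. The exponent [k] is kept and the constant is multiplied by the moment of order 2k. *)
Lemma polylip_markov f : polylip f -> polylip (markov f).
Proof.
move=> pf; move: (pf) => [C [k [C0 fC]]].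
exists (C * \int[mu]_x (weight (b x) ^+ (2 * k))), k.
have W0 x : 0 <= weight (b x) by exact: weight_ge0.
split=> [|u v].
  by rewrite mulr_ge0 //; apply: Rintegral_ge0 => x _; rewrite exprn_ge0.
have If u' := polylip_integrable u' pf.
rewrite /markov -RintegralB // (le_trans (le_normr_Rintegral _ _)) //.
  exact: (integrableB measurableT (If u) (If v)).
have cf u' := @polylip_act_continuous f u' pf.
pose K := C * (weight u * weight v) ^+ k * `|u - v|.
have fK x : `|f (act x u) - f (act x v)| <= K * weight (b x) ^+ (2 * k).
  apply: le_trans (fC _ _) _; rewrite (act_dist b hpi).
  rewrite [leRHS](_ : _ = C * ((weight u * weight v) ^+ k * weight (b x) ^+ (2 * k)) * `|u - v|);
    last by rewrite /K; ring.
  rewrite ler_wpM2r // ler_wpM2l // exprM -exprMn.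
  rewrite lerXn2r ?nnegrE ?mulr_ge0 ?exprn_ge0 ?weight_ge0 //.
  rewrite [leRHS](_ : _ = (weight (b x) * weight u) * (weight (b x) * weight v)); last ring.
  by rewrite ler_pM ?weight_ge0 ?weight_act.
apply: (@le_trans _ _ (\int[mu]_x (K * weight (b x) ^+ (2 * k)))); last first.
  rewrite RintegralZl //.
  by rewrite /K le_eqVlt; apply/orP; left; apply/eqP; ring.
apply: le_Rintegral => //.
- apply: (@integrable_dominated _ K (2 * k)).
    by move=> x; apply: cvg_norm; apply: cvgB; exact: cf.
  by move=> x; rewrite normr_id.
- exact: (integrableZl measurableT _ (mom (2 * k))).
Qed.

Lemma polylip_iter n f : polylip f -> polylip (iter n markov f).
Proof. by move=> pf; elim: n => // n; exact: polylip_markov. Qed.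

Lemma iter_markovD n f g : polylip f -> polylip g ->
  iter n markov (fun v => f v + g v) = (fun u => iter n markov f u + iter n markov g u).
Proof.
move=> pf pg; elim: n => // n /= ->; apply/funext => u.
by rewrite markovD //; exact: polylip_iter.
Qed.

Lemma iter_markovZ n c f : polylip f ->
  iter n markov (fun v => c * f v) = (fun u => c * iter n markov f u).
Proof.
move=> pf; elim: n => // n /= ->; apply/funext => u.
by rewrite markovZ //; exact: polylip_iter.
Qed.

Lemma iter_markov_cst n c : iter n markov (fun=> c) = fun=> c.
Proof. by elim: n => // n /= ->; apply/funext => u; rewrite markov_cst. Qed.

Lemma iter_markov_sum n (I : Type) (r : seq I) (F : I -> H -> R) :
  (forall i, polylip (F i)) ->
  iter n markov (fun u => \sum_(i <- r) F i u) = fun u => \sum_(i <- r) iter n markov (F i) u.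
Proof.
move=> pF; elim: r => [|i r IH].
  under eq_fun do rewrite big_nil.
  by rewrite iter_markov_cst; apply/funext => u; rewrite big_nil.
under eq_fun do rewrite big_cons.
rewrite iter_markovD //; last exact: polylip_sum.
by rewrite IH; apply/funext => u; rewrite big_cons.
Qed.

Lemma iter_markov_le n f g u : polylip f -> polylip g -> (forall v, f v <= g v) ->
  iter n markov f u <= iter n markov g u.
Proof.
move=> pf pg fg; elim: n u => //= n IH u.
by apply: markov_le => //; exact: polylip_iter.
Qed.

Lemma iter_markov_ge0 n f u : polylip f -> (forall v, 0 <= f v) -> 0 <= iter n markov f u.
Proof.
move=> pf f0; have := @iter_markov_le n (fun=> 0) f u (polylip_cst 0) pf f0.
by rewrite iter_markov_cst.
Qed.

End MarkovOperator.

Section Integration.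
Context d (T : measurableType d) (R : realType).

(* The larger function need not be measurable: for such functions the library's
   integral is the lower integral. *)
Lemma le_lower_integral (m : {measure set T -> \bar R}) (f g : T -> \bar R) :
  (forall x, (0 <= f x)%E) -> (forall x, (f x <= g x)%E) ->
  (\int[m]_x f x <= \int[m]_x g x)%E.
Proof.
move=> f0 fg; rewrite !ge0_integralTE //; last by move=> x; exact: le_trans (fg x).
apply: le_ereal_sup => _ [h hf <-]; exists h => // x.
exact: le_trans (hf x) (fg x).
Qed.

Lemma Rintegral_sum_seq (m : {measure set T -> \bar R}) (I : Type) (r : seq I) (F : I -> T -> R) :
  (forall i, m.-integrable setT (EFin \o F i)) ->
  m.-integrable setT (EFin \o (fun x => \sum_(i <- r) F i x)) /\
  \int[m]_x (\sum_(i <- r) F i x) = \sum_(i <- r) \int[m]_x F i x.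
Proof.
move=> iF; elim: r => [|i r [IHi IH]].
  under [X in EFin \o X]eq_fun do rewrite big_nil.
  split; first exact: integrable0.
  rewrite big_nil; under [X in Rintegral _ _ X]eq_fun do rewrite big_nil.
  by rewrite Rintegral_cst // mul0r.
under [X in EFin \o X]eq_fun do rewrite big_cons.
split; first exact: (integrableD measurableT (iF i) IHi).
rewrite big_cons -IH; under [X in Rintegral _ _ X]eq_fun do rewrite big_cons.
by rewrite RintegralD.
Qed.

End Integration.

(** * Positivity on open sets, moments and harmonicity *)

Section DrivingMeasure.
Context {R : realType} {G : topologicalGroupType}.
Hypothesis hausG : hausdorff_space G.
Variables (m : {measure set (borel G) -> \bar R}) (haar_m : haar_measure m).
Variables (Q : set G) (hQ : generating_neighborhood Q).
Variables (mu : probability (borel G) R) (hmu : driving_measure m Q mu).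

Lemma Rintegral_inv (F : G -> R) : continuous F ->
  mu.-integrable setT (EFin \o (fun x : borel G => F (x^-1)%g)) ->
  \int[mu]_x F (x^-1)%g = \int[mu]_x F x.
Proof.
move=> cF iF; pose phi := (fun x : G => (x^-1)%g) : borel G -> borel G.
have mphi : measurable_fun setT phi by apply: continuous_borel_map; exact: invg_continuous.
have mF : measurable_fun setT (fun x : borel G => (F x)%:E).
  by apply/measurable_EFinP; exact: continuous_borel_fun.
have := integral_pushforward mphi mF (D := setT) iF measurableT.
rewrite preimage_setT /Rintegral => h; congr fine; rewrite -[LHS]h.
apply: eq_measure_integral => A mA _.
rewrite -[RHS](dm_symmetric hmu mA); congr (mu _).
apply/seteqP; split=> [x /= Ax|_ [x Ax <-]]; last by rewrite /phi /= invgK.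
by exists (x^-1)%g; rewrite ?invgK.
Qed.

(** Finitely many translates of [O] cover any given compact set. If [O] were null, all compact sets
    would be null, and by inner regularity the whole group. *)
Lemma haar_open_gt0 (O : set G) : open O -> O !=set0 -> (0 < m O)%E.
Proof.
move=> oO [g Og]; rewrite lt0e measure_ge0 andbT; apply/eqP => mO0.
have mt (x : G) : m [set (x * y)%g | y in O] = 0%E.
  by rewrite (haar_invariant haar_m) //; exact: borel_open.
have ot (x : G) : open [set (x * y)%g | y in O].
  have -> : [set (x * y)%g | y in O] = (fun y => (x^-1 * y)%g) @^-1` O.
    apply/seteqP; split=> [_ [y Oy <-]|y /= Oy]; first by rewrite /= mulKg.
    by exists (x^-1 * y)%g => //; rewrite mulVKg.
  by move/continuousP: (@mulgl_continuous G (x^-1)%g); apply.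
suff : m setT = 0%E by move=> mT; have := haar_neq0 haar_m; rewrite mT eqxx.
rewrite (haar_inner haar_m openT); apply/eqP; rewrite eq_le; apply/andP; split; last first.
  by apply: ereal_sup_ubound; exists set0; [split=> //; exact: compact0|rewrite measure0].
apply: ge_ereal_sup => _ [K [cK _] <-].
have mK : measurable (K : set (borel G)) by apply: borel_closed; exact: compact_closed.
move: (cK); rewrite compact_cover => /(_ G setT (fun x => [set (x * y)%g | y in O])).
case=> [x _||D _ KD]; first exact: ot.
  by move=> x _; exists (x * g^-1)%g => //; exists g => //; rewrite mulgVK.
apply: (@le_trans _ _ (\sum_(x <- enum_fset D) m [set (x * y)%g | y in O])); last first.
  by rewrite big1.
pose O_ x : set (borel G) := [set (x * y)%g | y in O].
have mO_ x : measurable (O_ x) := borel_open (ot x).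
pose B : set (borel G) := \big[setU/set0]_(x <- enum_fset D) O_ x.
have mB s : measurable (\big[setU/set0]_(x <- s) O_ x) by apply: bigsetU_measurable.
have KB : K `<=` B.
  move=> y /KD [x /= xD Oxy]; by rewrite /B -bigcup_seq; exists x.
have h : (m K <= m B)%E := le_measure m (mem_set mK) (mem_set (mB _)) KB.
apply: le_trans h _; rewrite /B; elim: (enum_fset D) => [|x s IH].
  by rewrite !big_nil measure0.
rewrite !big_cons; apply: le_trans (measureU2 _ _ _) _ => //.
by rewrite leeD2l.
Qed.

Lemma driving_open_gt0 (O : set G) : open O -> O !=set0 -> O `<=` Q -> (0 < mu O)%E.
Proof.
move=> oO O0 OQ; have [f [mf f0 fE fQ]] := dm_density hmu.
have mO : measurable (O : set (borel G)) by exact: borel_open.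
have [e e0 eQ] : exists2 e : R, 0 < e & forall x, Q x -> (e%:E <= f x)%E.
  move: fQ; set i := ereal_inf _ => i0.
  have iQ x : Q x -> (i <= f x)%E by move=> Qx; apply: ereal_inf_lbound; exists x.
  (* The infimum of the density may be infinite, in which case the bound 1 serves. *)
  case: i i0 iQ => [r r0 iQ|_ iQ|//]; first by exists r.
  by exists 1 => // x /iQ; rewrite leye_eq => /eqP ->; rewrite leey.
rewrite fE //; apply: (@lt_le_trans _ _ (\int[m]_(x in O) e%:E)%E).
  by rewrite integral_cst // mule_gt0 ?lte_fin // haar_open_gt0.
apply: ge0_le_integral => //; first by move=> x _; rewrite lee_fin ltW.
  exact: measurable_funTS.
by move=> x /OQ; exact: eQ.
Qed.

Section CocycleMoments.
Context {H : hilbertType R}.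
Variables (pi : G -> {linear H -> H}) (b : G -> H).
Hypotheses (hpi : orthogonal_representation pi) (hb : cocycle pi b).

(** [b] is bounded on the relatively compact [Q], and each letter of a word adds at most this bound
    since the representation is isometric. *)
Lemma cocycle_word_bound : exists2 C : R, 0 <= C &
  forall x, `|b x| <= C * (word_length Q x)%:R.
Proof.
have cQ : compact (closure Q) by rewrite -precompactE; exact: gn_precompact.
have cb := cocycle_continuous hb.
have /compact_bounded [M [_ bM]] : compact (b @` closure Q).
  by apply: continuous_compact => //; exact: continuous_subspaceT.
pose C := `|M| + 1; have C0 : 0 <= C by rewrite addr_ge0.
have QC x : Q x -> `|b x| <= C.
  move=> Qx; apply: (bM C); first by rewrite /C (le_lt_trans (ler_norm M)) // ltrDl.
  by exists x => //; exact: subset_closure.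
exists C => // x; have [->|/eqP x1] := eqVneq x 1%g.
  by rewrite (cocycle1 hpi hb) normr0 mulr_ge0.
have := setpow_word_length hQ x1; move: (word_length Q x) => n.
elim: n x {x1} => [|n IH] x /=; first by move=> ->; rewrite (cocycle1 hpi hb) normr0 mulr0.
move=> [y yn [q Qq <-]]; rewrite (cocycleM hb) (le_trans (ler_normD _ _)) //.
by rewrite (rep_norm hpi) -natr1 mulrDr mulr1 lerD ?IH ?QC.
Qed.

Lemma cocycle_has_moments : has_moments b mu.
Proof.
move=> k; have [C C0 bC] := cocycle_word_bound.
pose L x := (word_length Q x)%:R : R; pose D := ((1 + C) * 2) ^+ k.
have C1 : 0 < (1 + C) * 2 by lra.
have D0 : 0 < D by rewrite exprn_gt0.
have bL x : weight (b x) ^+ k <= D * (1 + L x ^+ k).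
  have L0 : 0 <= L x by rewrite /L ler0n.
  have h1 : weight (b x) <= (1 + C) * (1 + L x).
    by rewrite /weight; have := bC x; rewrite -/(L x); have := mulr_ge0 C0 L0; lra.
  have h2 : (1 + L x) ^+ k <= 2 ^+ k * (1 + L x ^+ k).
    rewrite /L; case: (word_length Q x) => [|n].
      rewrite addr0 expr1n; have : (1 : R) <= 2 ^+ k by rewrite exprn_ege1 // ler1n.
      have : (0 : R) <= 0 ^+ k by rewrite exprn_ge0.
      by move=> a0 a1; rewrite (le_trans a1) // ler_peMr ?lerDl // (le_trans ler01).
    apply: (@le_trans _ _ ((2 * n.+1%:R) ^+ k)).
      rewrite lerXn2r ?nnegrE ?addr_ge0 ?mulr_ge0 //.
      by have : (1 : R) <= n.+1%:R by [rewrite ler1n]; move: (n.+1%:R : R) => t; lra.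
    by rewrite exprMn ler_wpM2l ?exprn_ge0 // lerDr.
  apply: (@le_trans _ _ (((1 + C) * (1 + L x)) ^+ k)).
    by rewrite lerXn2r ?nnegrE ?weight_ge0 // mulr_ge0 // addr_ge0.
  by rewrite exprMn /D exprMn -mulrA ler_wpM2l // exprn_ge0 // addr_ge0.
pose F x := weight (b x) ^+ k.
have cF : continuous F.
  move=> x; apply: (cvg_comp (fun x => weight (b x)) (fun y : R => y ^+ k)); last exact: exprn_continuous.
  apply: cvgD; first exact: cvg_cst.
  by apply: cvg_norm; apply: (cocycle_continuous hb).
(* The word length need not be measurable. The function [g] is continuous and at most [L x ^+ k], so
   its integral is bounded by a lower integral; and [F] is at most an affine function of [g]. *)
pose g x := Num.max 0 (F x / D - 1).
have cg : continuous g.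
  move=> x; apply: (@continuous_max _ _ (cst 0 : G -> R^o) (fun x => F x / D - 1 : R^o) x).
    exact: cvg_cst.
  by apply: cvgB; [apply: cvgMr_tmp; exact: cF|exact: cvg_cst].
have g0 x : 0 <= g x by rewrite /g le_max lexx.
have gL x : g x <= L x ^+ k.
  rewrite ge_max exprn_ge0 /= ?ler0n // lerBlDr ler_pdivrMr // addrC mulrC; exact: bL.
have Fg x : F x <= D * g x + D.
  have : F x / D - 1 <= g x by rewrite le_max lexx orbT.
  by rewrite lerBlDr ler_pdivrMr // mulrC mulrDr mulr1.
have ig : mu.-integrable setT (EFin \o (g : borel G -> R)).
  apply/integrableP; split; first by apply/measurable_EFinP; exact: continuous_borel_fun.
  apply: le_lt_trans (dm_moments hmu k); apply: le_lower_integral => x //=.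
  by rewrite lee_fin ger0_norm.
have igD : mu.-integrable setT (EFin \o (fun x : borel G => D * g x + D)).
  have := integrableD measurableT (integrableZl measurableT D ig)
    (finite_measure_integrable_cst mu D measurableT).
  by [].
apply: (le_integrable _ _ _ igD) => //.
  by apply/measurable_EFinP; exact: continuous_borel_fun.
move=> x _ /=; rewrite lee_fin ger0_norm ?exprn_ge0 ?weight_ge0 //.
by apply: le_trans (Fg x) _; exact: ler_norm.
Qed.

(** This consequence of harmonicity is all that the moment computations use, and it passes at once
    to the projections of [b]. *)
Definition weakly_harmonic := forall (C : R) (L : H -> R),
  (forall a u v, L (a *: u + v) = a * L u + L v) -> (forall u, `|L u| <= C * `|u|) ->
  \int[mu]_x L (b x) = 0.

End CocycleMoments.

End DrivingMeasure.

Section Bochner.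
Context d (T : measurableType d) (R : realType) (H : hilbertType R).
Variable P : probability T R.

Section LinearFunctional.
Variables (C : R) (L : H -> R).
Hypothesis LP : forall a u v, L (a *: u + v) = a * L u + L v.
Hypotheses (C0 : 0 <= C) (LC : forall u, `|L u| <= C * `|u|).

Lemma functional0 : L 0 = 0.
Proof. by have := LP 1 0 0; rewrite scale1r addr0 mul1r; lra. Qed.

Lemma functionalZ a u : L (a *: u) = a * L u.
Proof. by rewrite -[_ *: _]addr0 LP functional0 addr0. Qed.

Lemma functionalD u v : L (u + v) = L u + L v.
Proof. by rewrite -[u in LHS]scale1r LP mul1r. Qed.

Lemma functionalB u v : L (u - v) = L u - L v.
Proof. by rewrite functionalD -scaleN1r functionalZ mulN1r. Qed.

Lemma functional_sum (I : Type) (r : seq I) (F : I -> H) :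
  L (\sum_(i <- r) F i) = \sum_(i <- r) L (F i).
Proof.
elim: r => [|i r IH]; first by rewrite !big_nil functional0.
by rewrite !big_cons functionalD IH.
Qed.

Lemma functional_simple (g : T -> H) : simple_function g ->
  P.-integrable setT (EFin \o (L \o g)) /\ \int[P]_x L (g x) = L (simple_integral P g).
Proof.
move=> [fg mg]; set s := fset_set (range g) : seq H.
have gE x : L (g x) = \sum_(y <- s) L y * \1_(g @^-1` [set y]) x.
  have gs : g x \in s by rewrite in_fset_set // inE; exists x.
  rewrite (bigD1_seq (g x)) ?fset_uniq //= big1 ?addr0 => [|y ygx].
    by rewrite indicE mem_set // mulr1.
  by rewrite indicE memNset ?mulr0 //= => gy; rewrite gy eqxx in ygx.
have iF y : P.-integrable setT (EFin \o (fun x => L y * \1_(g @^-1` [set y]) x)).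
  exact: (integrableZl measurableT (L y) (integrable_indic P (mg y))).
have [i1 i2] := Rintegral_sum_seq s iF.
have -> : L \o g = (fun x => \sum_(y <- s) L y * \1_(g @^-1` [set y]) x) by apply/funext.
split=> //; rewrite (_ : Rintegral P _ _ = \int[P]_x (\sum_(y <- s) L y * \1_(g @^-1` [set y]) x)).
  rewrite i2 /simple_integral fsbig_finite // functional_sum; apply: eq_bigr => y _.
  rewrite functionalZ RintegralZl //; last exact: integrable_indic.
  by rewrite mulrC; congr (_ * _); rewrite /Rintegral integral_indic // setIT.
by apply: eq_Rintegral => x _; rewrite gE.
Qed.

Lemma bochner_functional (f : T -> H) (I : H) : is_bochner_integral P f I ->
  P.-integrable setT (EFin \o (L \o f)) -> \int[P]_x L (f x) = L I.
Proof.
move=> [g [sg mg cg cI]] iL.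
have key n : (`|\int[P]_x L (f x) - L I|%:E <=
    C%:E * \int[P]_x (`|f x - g n x|)%:E + (C * `|simple_integral P (g n) - I|)%:E)%E.
  have [ig Eg] := functional_simple (sg n).
  apply: (@le_trans _ _ (`|\int[P]_x L (f x) - \int[P]_x L (g n x)|%:E
      + `|\int[P]_x L (g n x) - L I|%:E)%E).
    by rewrite -EFinD lee_fin -[X in `|X|](subrKA (\int[P]_x L (g n x))) ler_normD.
  apply: leeD; last by rewrite lee_fin Eg -functionalB LC.
  have iB : P.-integrable setT (EFin \o (fun x => L (f x) - L (g n x))).
    exact: (integrableB measurableT iL ig).
  rewrite -RintegralB //; apply: (@le_trans _ _ (\int[P]_x (`|L (f x) - L (g n x)|)%:E)%E).
    rewrite EFin_normr_Rintegral //.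
    by apply: le_abse_integral => //; case/integrableP: iB.
  rewrite -ge0_integralZl //.
  - apply: ge0_le_integral => //.
    + by apply/measurable_EFinP; apply: measurableT_comp => //; case/integrableP: iB => /measurable_EFinP.
    + by apply/measurable_EFinP; apply: measurable_funM => //; exact: mg.
    + by move=> x _; rewrite -EFinM lee_fin -functionalB LC.
  - by apply/measurable_EFinP; exact: mg.
have cR : (fun n => (C%:E * \int[P]_x (`|f x - g n x|)%:E +
    (C * `|simple_integral P (g n) - I|)%:E)%E) @ \oo --> (C%:E * 0 + (C * `|I - I|)%:E)%E.
  apply: cvgeD => //.
    exact: cvgeZl.
  apply: cvg_EFin; first exact: nearW.
  apply: cvgMl_tmp; apply: cvg_norm; apply: cvgB => //; exact: cvg_cst.
rewrite mule0 subrr normr0 mulr0 add0e in cR.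
have : (`|\int[P]_x L (f x) - L I|%:E <= 0%:E)%E.
  apply: (lee_cvg_to (cvg_cst _) cR).
  by apply: nearW.
by rewrite lee_fin normr_le0 subr_eq0 => /eqP.
Qed.

End LinearFunctional.
End Bochner.

Lemma harmonic_weakly (R : realType) (G : topologicalGroupType) (H : hilbertType R)
  (mu : probability (borel G) R) (b : G -> H) : continuous b -> has_moments b mu ->
  harmonic_cocycle mu b -> weakly_harmonic mu b.
Proof.
move=> cb mom hb C L LP LC.
have LC' u : `|L u| <= `|C| * `|u|.
  by apply: le_trans (LC u) _; rewrite ler_wpM2r // ler_norm.
have L0 : L 0 = 0 by exact: functional0 LP.
have lip u v : `|L u - L v| <= `|C| * `|u - v| by rewrite -(functionalB LP).
rewrite -[RHS]L0; apply: (bochner_functional LP (normr_ge0 C) LC' hb).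
apply: (@integrable_dominated _ _ _ _ _ mom _ `|C| 1).
  move=> x; apply: (cvg_comp b L); first exact: cb.
  by apply: polylip_continuous; exact: lipschitz_polylip lip.
move=> x; rewrite expr1 (le_trans (LC' _)) // ler_wpM2l // /weight.
by rewrite lerDr.
Qed.

(** * The law of the walk along a cocycle *)

Section JointMeasurability.
Context {R : realType} {G : topologicalGroupType} {V : normedModType R}.
Variables (Q : set G) (hQ : generating_neighborhood Q).
Variables (b : G -> V) (cb : continuous b).

(* The Borel sigma-algebra of G x G may exceed the product one, so that joint
   continuity does not give joint measurability: b is replaced by functions
   with countably many values. *)
Lemma joint_measurable d (T : measurableType d) (Psi : T -> V -> R) (L : R) (y : G) :
  (forall z, measurable_fun setT (fun t => Psi t (b z))) ->
  (forall t u v, `|Psi t u - Psi t v| <= L * `|u - v|) ->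
  measurable_fun setT (fun tx : T * borel G => Psi tx.1 (b (tx.2 * y)%g)).
Proof.
move=> mPsi PsiL.
have e0 (k : nat) : (0 : R) < k.+1%:R^-1 by rewrite invr_gt0 ltr0n.
pose x k := projT1 (cid (countable_net hQ cb (e0 k))).
have xP k z : exists j, `|b z - b (x k j)| < k.+1%:R^-1 :=
  projT2 (cid (countable_net hQ cb (e0 k))) z.
pose U k j := [set z : G | `|b (z * y)%g - b (x k j)| < k.+1%:R^-1].
have mU k j : measurable (U k j : set (borel G)).
  apply: borel_open.
  have cbz : continuous (fun z => `|b (z * y)%g - b (x k j)|).
    move=> z; apply: cvg_norm; apply: cvgB; last exact: cvg_cst.
    by apply: (cvg_comp (fun z => (z * y)%g) b); [exact: mulgr_continuous|exact: cb].
  by move/continuousP: cbz => /(_ _ (@open_lt R k.+1%:R^-1)).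
have exU k z : exists j, `[< U k j z >].
  by have [j zj] := xP k (z * y)%g; exists j; apply/asboolP.
(* Taking the first admissible centre makes the choice measurable: its level sets are differences of
   open sets. The approximations are then constant in the second variable on countably many
   rectangles. *)
pose K k z := ex_minn (exU k z).
have KU k z : U k (K k z) z by rewrite /K; case: ex_minnP => j /asboolP.
have KE k z j : (K k z = j) <-> U k j z /\ forall i, (i < j)%N -> ~ U k i z.
  split.
    rewrite /K; case: ex_minnP => j' /asboolP Uj min <-; split=> // i ij /asboolP /min.
    by rewrite leqNgt ij.
  move=> [Uj min]; apply/eqP; rewrite eqn_leq; apply/andP; split.
    by rewrite /K; case: ex_minnP => j' _; apply; apply/asboolP.
  by rewrite leqNgt; apply/negP => /min; apply; exact: KU.
apply: (@measurable_fun_cvg _ _ R setT (fun (k : nat) (tx : T * borel G) => Psi tx.1 (b (x k (K k tx.2))))).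
  move=> k _ B mB; rewrite setTI.
  rewrite (_ : _ @^-1` B = \bigcup_j ([set t | B (Psi t (b (x k j)))] `*` [set z | K k z = j])).
    apply: bigcupT_measurable => j; apply: measurableX.
      by have := mPsi (x k j) measurableT B mB; rewrite setTI.
    rewrite (_ : [set z | K k z = j] = U k j `\` \bigcup_(i < j) U k i).
      by apply: measurableD => //; apply: bigcup_measurable.
    apply/seteqP; split=> z /=.
      by move/KE => [Uj min]; split=> // -[i /= ij]; exact: min.
    by move=> [Uj min]; apply/KE; split=> // i ij Ui; apply: min; exists i.
  apply/seteqP; split=> [[t z] /= Bt|[t z] [j _ [/= Bt Kj]]]; first by exists (K k z).
  by rewrite /= Kj.
move=> [t z] _ /=; apply/cvgrPdist_lt => e ep.
have L1 : 0 < `|L| + 1 by rewrite ltr_wpDl.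
have eL : 0 < e / (`|L| + 1) by rewrite divr_gt0.
have := near_infty_natSinv_lt (PosNum eL); apply: filterS => k /= ke.
have Uk := KU k z; rewrite /U /= in Uk.
apply: le_lt_trans (PsiL _ _ _) _.
apply: (@le_lt_trans _ _ ((`|L| + 1) * `|b (z * y)%g - b (x k (K k z))|)).
  by rewrite ler_wpM2r // (le_trans (ler_norm L)) // lerDl.
by rewrite mulrC -ltr_pdivlMr //; exact: lt_trans ke.
Qed.

End JointMeasurability.

Fixpoint initial_fset (n : nat) : {fset nat} :=
  if n is n'.+1 then (n' |` initial_fset n')%fset else fset0.

Lemma in_initial_fset n i : (i \in initial_fset n) = (i < n)%N.
Proof.
elim: n => [|n IH] /=; first by rewrite in_fset0.
by rewrite in_fset1U IH ltnS [in RHS]leq_eqVlt.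
Qed.

Arguments initial_fset : simpl never.

Section Past.
Context {R : realType} {G : topologicalGroupType}.
Context d (Omega : measurableType d) (P : probability Omega R).
Variables (mu : probability (borel G) R) (s : nat -> {RV P >-> borel G}).
Hypothesis hs : iid_increments mu s.

Definition cylinder (n : nat) : set (set Omega) :=
  [set C | exists2 B : nat -> set (borel G), (forall i, measurable (B i)) &
     C = \bigcap_(i in [set` initial_fset n]) (s i @^-1` B i)].

(* As the walk need not be a random variable, it has no law to integrate
   against: Fubini is applied to Omega itself with a smaller sigma-algebra. *)
Definition past n := g_sigma_algebraType (cylinder n).

Lemma cylinder_measurable n C : cylinder n C -> measurable C.
Proof.
move=> [B mB ->]; apply: fin_bigcap_measurable => // i _.
by rewrite -[X in measurable X]setTI; exact: measurable_funPT.
Qed.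

Lemma past_measurable n (A : set Omega) : measurable (A : set (past n)) -> measurable A.
Proof.
apply: smallest_sub; first exact: sigma_algebra_measurable.
by move=> C; exact: cylinder_measurable.
Qed.

Lemma cylinderS n : cylinder n `<=` cylinder n.+1.
Proof.
move=> _ [B mB ->]; exists (fun i => if (i < n)%N then B i else setT).
  by move=> i; case: ifP.
apply/seteqP; split=> w /= wB i /=; rewrite in_initial_fset => iS.
  by case: ifP => // lin; apply: wB; rewrite /= in_initial_fset.
by have := wB i; rewrite /= in_initial_fset iS ltnS ltnW //; apply.
Qed.

Lemma pastS_measurable n (A : set Omega) :
  measurable (A : set (past n)) -> measurable (A : set (past n.+1)).
Proof.
apply: smallest_sub; first exact: sigma_algebra_measurable.
by move=> C /cylinderS; exact: sub_sigma_algebra.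
Qed.

Lemma past_increment_measurable n :
  measurable_fun setT (s n : past n.+1 -> borel G).
Proof.
move=> _ B mB; rewrite setTI; apply: sub_sigma_algebra.
exists (fun i => if i == n then B else setT); first by move=> i; case: ifP.
apply/seteqP; split=> w /= wB; first by move=> i /= _; case: eqP => // ->.
by have := wB n; rewrite /= in_initial_fset ltnSn eqxx; apply.
Qed.

Lemma cylinder_setI n : setI_closed (cylinder n).
Proof.
move=> _ _ [B mB ->] [B' mB' ->]; exists (fun i => B i `&` B' i).
  by move=> i; exact: measurableI.
by rewrite -bigcapI.
Qed.

Lemma cylinder_setT n : cylinder n setT.
Proof.
exists (fun=> setT) => //.
by apply/seteqP; split.
Qed.

Lemma cylinder_independent n C B : cylinder n C -> measurable B ->
  P (C `&` s n @^-1` B) = (P C * mu B)%E.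
Proof.
move=> [B' mB' ->] mB; have ind := iid_independent hs.
pose A i := if i == n then B else B' i.
have mA i : measurable (A i) by rewrite /A; case: ifP.
have Ain i : i \in initial_fset n -> A i = B' i.
  by rewrite in_initial_fset /A; case: eqP => // ->; rewrite ltnn.
have nn : n \notin initial_fset n by rewrite in_initial_fset ltnn.
have -> : \bigcap_(i in [set` initial_fset n]) (s i @^-1` B' i) `&` s n @^-1` B =
    \bigcap_(i in [set` initial_fset n.+1]) (s i @^-1` A i).
  apply/seteqP; split=> w.
    move=> [wB' wB] i; rewrite /= [initial_fset n.+1]/initial_fset -/initial_fset in_fset1U => /orP[/eqP ->|iN].
      by rewrite /A eqxx.
    by rewrite Ain //; exact: wB'.
  move=> wA; split; last by have := wA n; rewrite /A eqxx; apply; rewrite /= in_initial_fset.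
  by move=> i /= iN; rewrite -Ain //; apply: wA; move: iN; rewrite /= !in_initial_fset => /leqW.
rewrite !ind // [initial_fset n.+1]/initial_fset -/initial_fset big_fsetU1 //= {1}/A eqxx muleC; congr (_ * _)%E.
  by apply: eq_big_seq => i iN; rewrite Ain.
exact: (iid_law hs n mB).
Qed.

Lemma past_id_measurable n : measurable_fun setT (id : Omega -> past n).
Proof. by move=> _ A mA; rewrite setTI; exact: past_measurable mA. Qed.

Lemma past_independent n (A : set (past n)) B : measurable A -> measurable B ->
  P ((A : set Omega) `&` s n @^-1` B) = (P A * mu B)%E.
Proof.
move=> mA mB.
have mE : measurable (s n @^-1` B).
  by rewrite -[X in measurable X]setTI; exact: measurable_funPT.
have muB : mu B = (fine (mu B))%:E by rewrite fineK // fin_num_measure.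
have r0 : 0 <= fine (mu B) by rewrite fine_ge0.
have mid := @past_id_measurable n.
(* Both sides are finite measures in [A], transported to the coarser measurable space along the
   identity. They agree on the cylinders, which are stable under intersection, hence everywhere. *)
pose m1'  : {measure set (past n) -> \bar R} :=
  pushforward (mrestr P mE) (@id Omega : Omega -> past n).
pose m2'  : {measure set (past n) -> \bar R} :=
  pushforward (mscale (NngNum r0) P) (@id Omega : Omega -> past n).
pose m1 := m1' mid; pose m2 := m2' mid.
have : m1 A = m2 A.
  have cupT : \bigcup_(k in [set: nat]) [set: past n] = setT.
    by apply/seteqP; split=> // w _; exists 0%N.
  have uniq := @measure_unique _ R (past n) (cylinder n) (fun=> setT) erefl
    (@cylinder_setI n) (fun=> @cylinder_setT n) cupT m1 m2.
  apply: uniq mA => [C cC|_].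
    by rewrite /m1 /m2 /m1' /m2' /= /pushforward /mrestr /mscale /= cylinder_independent // muB muleC.
  apply: (@le_lt_trans _ _ (P setT)); last by rewrite probability_setT ltry.
  exact: (le_measure P (mem_set (measurableI _ _ measurableT mE)) (mem_set measurableT) (@subsetT _ _)).
rewrite /m1 /m2 /m1' /m2' /= /pushforward /mrestr /mscale /= => ->.
by rewrite [in RHS]muB muleC.
Qed.

End Past.

Section JointLaw.
Context {R : realType} {G : topologicalGroupType}.
Context d (Omega : measurableType d) (P : probability Omega R).
Variables (mu : probability (borel G) R) (s : nat -> {RV P >-> borel G}).
Hypothesis hs : iid_increments mu s.
Local Notation past := (past s).

(** The identity as a random variable with values in the coarser measurable space: its distribution
    is the restriction of [P] to the past. *)
Definition past_id n : Omega -> past n := id.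

HB.instance Definition _ n :=
  isMeasurableFun.Build _ _ _ _ (past_id n) (@past_id_measurable _ _ _ _ _ s n).

Definition past_joint n (w : Omega) : (past n * borel G)%type := (w, s n w).

Lemma past_joint_measurable n : measurable_fun setT (past_joint n).
Proof.
apply/measurable_fun_pairP; split; first exact: past_id_measurable.
exact: measurable_funPT.
Qed.

HB.instance Definition _ n :=
  isMeasurableFun.Build _ _ _ _ (past_joint n) (@past_joint_measurable n).

Definition past_law n : probability (past n) R := distribution P (past_id n).

Definition joint_law n : probability (past n * borel G)%type R :=
  distribution P (past_joint n).

Lemma joint_lawE n X : measurable X -> (past_law n \x mu)%E X = joint_law n X.
Proof.
apply: product_measure_unique => A B mA mB.
rewrite /joint_law /past_law /distribution /= /pushforward.
rewrite -(past_independent hs mA mB); congr (P _).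
Qed.

Lemma past_step_measurable n (F : past n * borel G -> R) : measurable_fun setT F ->
  measurable_fun setT (fun w : past n.+1 => F (w, s n w)).
Proof.
move=> mF; apply: (measurableT_comp mF); apply/measurable_fun_pairP; split.
  by move=> _ A mA; rewrite setTI; exact: pastS_measurable mA.
exact: past_increment_measurable.
Qed.

Variables (Q : set G) (hQ : generating_neighborhood Q).
Context {H : hilbertType R}.
Variables (pi : G -> {linear H -> H}) (b : G -> H).
Hypotheses (hpi : orthogonal_representation pi) (hb : cocycle pi b).
Hypothesis mom : has_moments b mu.
Local Notation act := (affine_act pi b).

Lemma walkS n w : random_walk s n.+1 w = (random_walk s n w * (s n w : G))%g.
Proof. by rewrite /random_walk big_ord_recr. Qed.

(** Induction on n with [y] free: the last increment acts first and only moves [b y] along the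
    orbit, after which n increments remain, independent of it. Measurability with respect to the
    past belongs to the induction because Fubini's theorem needs it, and the Lipschitz condition is
    there for [joint_measurable]. *)
Theorem walk_markov n (f : H -> R) (L : R) (y : G) :
  (forall u, 0 <= f u) -> (forall u v, `|f u - f v| <= L * `|u - v|) ->
  measurable_fun setT (fun w : past n => f (act (random_walk s n w) (b y))) /\
  (\int[P]_w (f (act (random_walk s n w) (b y)))%:E = (iter n (markov pi b mu) f (b y))%:E)%E.
Proof.
elim: n y => [|n IH] y f0 fL.
  have E0 w : f (act (random_walk s 0 w) (b y)) = f (b y).
    by rewrite /random_walk big_ord0 (act_cocycle hb) mul1g.
  split; first by under eq_fun do rewrite E0; exact: measurable_cst.
  under eq_integral do rewrite E0.
  rewrite integral_cst //; transitivity ((f (b y))%:E * 1)%E; last exact: mule1.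
  by congr (_ * _)%E; exact: probability_setT.
pose Psi (w : past n) (u : H) := f (act (random_walk s n w) u).
have mPsi z : measurable_fun setT (fun w => Psi w (b z)) by case: (IH z f0 fL).
have PsiL w u v : `|Psi w u - Psi w v| <= L * `|u - v|.
  by rewrite /Psi -(act_dist b hpi (random_walk s n w)).
have mPhi := joint_measurable hQ (cocycle_continuous hb) y mPsi PsiL.
have E1 w : f (act (random_walk s n.+1 w) (b y)) = Psi w (b (s n w * y)%g).
  by rewrite walkS (actM hpi hb) (act_cocycle hb).
split; first by under eq_fun do rewrite E1; exact: past_step_measurable mPhi.
under eq_integral do rewrite E1.
pose Phi (z : past n * borel G) := (Psi z.1 (b (z.2 * y)%g))%:E.
have mPhi' : measurable_fun setT Phi by apply/measurable_EFinP; exact: mPhi.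
have Phi0 z : (0 <= Phi z)%E by rewrite lee_fin f0.
have -> : (\int[P]_w (Psi w (b (s n w * y)%g))%:E = \int[joint_law n]_z Phi z)%E.
  by rewrite [RHS]ge0_integral_pushforward //; exact: past_joint_measurable.
transitivity (\int[past_law n \x mu]_z Phi z)%E.
  by apply: eq_measure_integral => A mA _; exact: (esym (joint_lawE mA)).
rewrite fubini_tonelli2 //= /fubini_G.
have pf : polylip f by exact: lipschitz_polylip fL.
have inner_ (x : borel G) : (\int[past_law n]_w Phi (w, x) =
    (iter n (markov pi b mu) f (act x (b y)))%:E)%E.
  rewrite (act_cocycle hb) -(IH (x * y)%g f0 fL).2 /past_law.
  rewrite ge0_integral_pushforward //; last by apply/measurable_EFinP; exact: (mPsi (x * y)%g).
under eq_integral do rewrite inner_.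
rewrite /= /markov /Rintegral fineK //; apply: integrable_fin_num => //.
by apply: (polylip_integrable hpi hb mom); exact: polylip_iter.
Qed.

End JointLaw.

(** * Reversibility of the walk *)

Section Reversal.
Context {R : realType} {G : topologicalGroupType} {H : hilbertType R}.
Variables (Q : set G) (hQ : generating_neighborhood Q).
Variables (pi : G -> {linear H -> H}) (b : G -> H).
Hypotheses (hpi : orthogonal_representation pi) (hb : cocycle pi b).
Variable mu : probability (borel G) R.
Hypothesis mom : has_moments b mu.
Hypothesis mu_sym : forall F : G -> R, continuous F ->
  mu.-integrable setT (EFin \o (fun x : borel G => F (x^-1)%g)) ->
  \int[mu]_x F (x^-1)%g = \int[mu]_x F x.

Local Notation act := (affine_act pi b).
Local Notation M := (markov pi b mu).

Lemma Rintegral_prob_cst (c : R) : \int[mu]_x c = c.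
Proof. exact: (markov_cst pi b mu c 0). Qed.

(** The action is isometric, so the constant [L] does not change; [joint_measurable] requires one
    that is uniform in the parameter. *)
Lemma markov_lipschitz (f : H -> R) L : (forall u v, `|f u - f v| <= L * `|u - v|) ->
  forall u v, `|M f u - M f v| <= L * `|u - v|.
Proof.
move=> fL u v; have pf := lipschitz_polylip fL.
have If u' := polylip_integrable hpi hb mom u' pf.
have iB : mu.-integrable setT (EFin \o (fun x : borel G => f (act x u) - f (act x v))).
  exact: (integrableB measurableT (If u) (If v)).
rewrite /markov -RintegralB // (le_trans (le_normr_Rintegral _ _)) //.
rewrite -[leRHS](Rintegral_prob_cst (L * `|u - v|)); apply: le_Rintegral => //.
- exact: (integrable_norm iB).
- exact: (finite_measure_integrable_cst mu).
- by move=> x _; rewrite -(act_dist b hpi x).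
Qed.

Lemma iter_markov_lipschitz n (f : H -> R) L : (forall u v, `|f u - f v| <= L * `|u - v|) ->
  forall u v, `|iter n M f u - iter n M f v| <= L * `|u - v|.
Proof. by move=> fL; elim: n => // n; exact: markov_lipschitz. Qed.

(** The action preserves the orbit of 0, so a comparison on this orbit suffices. The symmetry
    [iter_markov_radial_sym] gives no more than that. *)
Lemma iter_markov_le_orbit n (f g : H -> R) y : polylip f -> polylip g ->
  (forall z, f (b z) <= g (b z)) -> iter n M f (b y) <= iter n M g (b y).
Proof.
move=> pf pg fg; elim: n y => //= n IH y; apply: le_Rintegral => //.
- by apply: (polylip_integrable hpi hb mom); exact: polylip_iter.
- by apply: (polylip_integrable hpi hb mom); exact: polylip_iter.
- by move=> x _; rewrite (act_cocycle hb).
Qed.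

Section Exchange.
Variables (F : G -> H -> R) (C L : R).
Hypotheses (F_ge0 : forall x u, 0 <= F x u) (F_le : forall x u, F x u <= C).
Hypothesis F_lip : forall x u v, `|F x u - F x v| <= L * `|u - v|.
Hypothesis F_meas : forall u, measurable_fun setT (fun x : borel G => F x u).

Let mean u : R := \int[mu]_x F x u.

Lemma bounded_integrable u : mu.-integrable setT (EFin \o (fun x : borel G => F x u)).
Proof.
apply: (le_integrable _ _ _ (finite_measure_integrable_cst mu C measurableT)) => //.
  by apply/measurable_EFinP.
by move=> x _ /=; rewrite lee_fin ger0_norm // (le_trans (F_le x u)) // ler_norm.
Qed.

Lemma mean_lipschitz u v : `|mean u - mean v| <= L * `|u - v|.
Proof.
have iB : mu.-integrable setT (EFin \o (fun x : borel G => F x u - F x v)).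
  exact: (integrableB measurableT (bounded_integrable u) (bounded_integrable v)).
rewrite /mean -RintegralB //; try exact: bounded_integrable.
rewrite (le_trans (le_normr_Rintegral _ _)) //.
rewrite -[leRHS](Rintegral_prob_cst (L * `|u - v|)); apply: le_Rintegral => //.
- exact: (integrable_norm iB).
- exact: (finite_measure_integrable_cst mu).
Qed.

(** Fubini's theorem for the increment [x] and the increments inside the iterates, at orbit points,
    where [joint_measurable] applies. *)
Lemma iter_markov_exchange n z :
  measurable_fun setT (fun x : borel G => iter n M (F x) (b z)) /\
  (\int[mu]_x (iter n M (F x) (b z))%:E = (iter n M mean (b z))%:E)%E.
Proof.
have pF x : polylip (F x) by exact: lipschitz_polylip (F_lip x).
have pm : polylip mean by exact: lipschitz_polylip mean_lipschitz.
have F0 n' x u : 0 <= iter n' M (F x) u by apply: (iter_markov_ge0 hpi hb mom).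
elim: n z => [|n IH] z.
  split; first exact: F_meas.
  by rewrite /= /mean /Rintegral fineK //; apply: integrable_fin_num => //; exact: bounded_integrable.
have mPhi := joint_measurable hQ (cocycle_continuous hb) (T := borel G)
  (Psi := fun x => iter n M (F x)) z (fun z => (IH z).1) (fun x => iter_markov_lipschitz n (F_lip x)).
pose Phi (t : borel G * borel G) := (iter n M (F t.1) (b (t.2 * z)%g))%:E.
have mPhi' : measurable_fun setT Phi by apply/measurable_EFinP; exact: mPhi.
have Phi0 t : (0 <= Phi t)%E by rewrite lee_fin.
have E1 x : (\int[mu]_y Phi (x, y) = (iter n.+1 M (F x) (b z))%:E)%E.
  rewrite /= /markov /Rintegral fineK; last first.
    by apply: integrable_fin_num => //; apply: (polylip_integrable hpi hb mom); exact: polylip_iter.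
  by apply: eq_integral => y _; rewrite (act_cocycle hb).
split.
  have mG := measurable_fun_fubini_tonelli_F (m2 := mu) Phi mPhi' Phi0.
  apply/measurable_EFinP; apply: eq_measurable_fun mG => x _ /=.
  by rewrite /fubini_F E1.
under eq_integral do rewrite -E1.
rewrite (fubini_tonelli (m1 := mu) (m2 := mu)) //.
have E2 y : (\int[mu]_x Phi (x, y) = (iter n M mean (act y (b z)))%:E)%E.
  by rewrite (act_cocycle hb) -(IH (y * z)%g).2.
under eq_integral do rewrite E2.
rewrite /= [in RHS]/markov /Rintegral fineK //; apply: integrable_fin_num => //.
by apply: (polylip_integrable hpi hb mom); exact: polylip_iter.
Qed.

End Exchange.

Variables (phi : R -> R) (C L : R).
Hypotheses (phi_ge0 : forall t, 0 <= phi t) (phi_le : forall t, phi t <= C).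
Hypothesis phi_lip : forall s t, `|phi s - phi t| <= L * `|s - t|.

Lemma phi_lip_ge0 : 0 <= L.
Proof. by have := phi_lip 0 1; rewrite sub0r normrN1 mulr1; exact: le_trans. Qed.

Lemma radial_lipschitz (w u v : H) : `|phi (`|u - w|) - phi (`|v - w|)| <= L * `|u - v|.
Proof.
apply: le_trans (phi_lip _ _) _; rewrite ler_wpM2l ?phi_lip_ge0 //.
apply: le_trans (ler_dist_dist _ _) _.
by rewrite opprB addrA subrK.
Qed.

(* The law of the increments being symmetric, u moved by the walk and v moved
   by an independent walk play the same role in phi |u - v|. *)
Lemma iter_markov_radial_sym n y z :
  iter n M (fun p => phi `|p - b z|) (b y) = iter n M (fun p => phi `|p - b y|) (b z).
Proof.
elim: n y => [|n IH] y /=; first by rewrite distrC.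
have prad (w : H) : polylip (fun p => phi `|p - w|).
  by apply: (@lipschitz_polylip _ _ _ L) => u v; exact: radial_lipschitz.
pose F (x : G) (p : H) := phi `|p - b (x * y)%g|.
have cF p : continuous (F^~ p).
  have pl : polylip (fun w => phi `|p - w|).
    apply: (@lipschitz_polylip _ _ _ L) => u v.
    by rewrite (distrC p u) (distrC p v) radial_lipschitz.
  move=> x; apply: (cvg_comp (fun x => b (x * y)%g) (fun w => phi `|p - w|)).
    apply: (cvg_comp (fun x => (x * y)%g) b); first exact: mulgr_continuous.
    exact: (cocycle_continuous hb).
  exact: (polylip_continuous pl).
have [] := @iter_markov_exchange F C L (fun _ _ => phi_ge0 _) (fun _ _ => phi_le _)
  (fun x u v => radial_lipschitz _ u v) (fun p => continuous_borel_fun (@cF p)) n z.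
move=> mF EF.
transitivity (iter n M (fun u : H => \int[mu]_x F x u) (b z)).
  apply: EFin_inj; rewrite -EF /markov /Rintegral fineK; last first.
    by apply: integrable_fin_num => //; apply: (polylip_integrable hpi hb mom); exact: polylip_iter.
  by apply: eq_integral => x _; rewrite (act_cocycle hb) IH.
(* On the right one step is moved to the inner end. There, moving the centre [b y] by x amounts, by
   isometry, to moving u by the inverse of x, which has the same law. *)
rewrite -iterS iterSr; congr (iter n M _ _); apply/funext => u.
have Fu x : F x u = phi `|act (x^-1)%g u - b y|.
  rewrite /F -(act_cocycle (pi := pi) hb); congr (phi _).
  by rewrite distrC [LHS](act_distV hpi hb) distrC.
pose F' (x : G) := phi `|act x u - b y|.
transitivity (\int[mu]_x F' (x^-1)%g); first by congr (Rintegral _ _ _); apply/funext => x; exact: Fu.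
apply: mu_sym; first exact: (@polylip_act_continuous _ _ _ pi b hpi hb (fun p => phi `|p - b y|) u (prad (b y))).
have := @bounded_integrable F C (fun _ _ => phi_ge0 _) (fun _ _ => phi_le _)
  (fun p => continuous_borel_fun (@cF p)) u.
by congr (mu.-integrable _ _); apply/funext => x /=; rewrite Fu.
Qed.

(** At an orbit point [b y] the symmetry gives M^n phi|.| (b y) = M^n phi|. - b y| (0), which is at
    least psi (b y) times M^n psi (0). Applying M^n at 0 once more produces the square. *)
Lemma iter_markov_pairing n (psi : H -> R) : polylip psi -> (forall u, 0 <= psi u) ->
  (forall u v, psi u * psi v <= phi `|u - v|) ->
  iter n M psi 0 ^+ 2 <= iter (n + n) M (fun u => phi `|u|) 0.
Proof.
move=> ppsi psi0 pp.
have prad (w : H) : polylip (fun p => phi `|p - w|).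
  by apply: (@lipschitz_polylip _ _ _ L) => u v; exact: radial_lipschitz.
have b1 : b 1%g = 0 by exact: (cocycle1 hpi hb).
have -> : (fun u => phi `|u|) = (fun u => phi `|u - b 1%g|).
  by apply/funext => u; rewrite b1 subr0.
rewrite iterD expr2 -[leLHS]/((fun u => iter n M psi 0 * u) (iter n M psi 0)).
have -> : (fun u => iter n M psi 0 * u) (iter n M psi 0) =
    iter n M (fun u => iter n M psi 0 * psi u) (b 1%g).
  by rewrite (iter_markovZ hpi hb mom) // b1.
rewrite -b1; apply: iter_markov_le_orbit.
- exact: polylipZ.
- exact: (polylip_iter hpi hb mom).
move=> y; rewrite iter_markov_radial_sym mulrC.
have <- : iter n M (fun u => psi (b y) * psi u) (b 1%g) = psi (b y) * iter n M psi (b 1%g).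
  by rewrite (iter_markovZ hpi hb mom).
apply: (iter_markov_le hpi hb mom) => //; first exact: polylipZ.
by move=> v; rewrite distrC.
Qed.

End Reversal.

(** * Finite-dimensional sums have small balls of positive mass *)

Section Bump.
Context {R : realType}.
Implicit Types r s t : R.

(** For r > 0 a Lipschitz function of constant 1/r between the indicators of t <= r and of t < 2
    r. *)
Definition bump r t := Num.max 0 (Num.min 1 (2 - t / r)).

Lemma bump_ge0 r t : 0 <= bump r t.
Proof. by rewrite le_max lexx. Qed.

Lemma bump_le1 r t : bump r t <= 1.
Proof. by rewrite ge_max ler01 ge_min lexx. Qed.

Lemma bump_eq1 r t : 0 < r -> t <= r -> bump r t = 1.
Proof.
move=> r0 tr; have : t / r <= 1 by rewrite ler_pdivrMr // mul1r.
by rewrite /bump => h; rewrite min_l ?max_r //; lra.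
Qed.

Lemma bump_eq0 r t : 0 < r -> 2 * r <= t -> bump r t = 0.
Proof.
move=> r0 tr; have h : 2 <= t / r by rewrite ler_pdivlMr.
by rewrite /bump max_l // ge_min; apply/orP; right; lra.
Qed.

Lemma bump_lip r s t : 0 < r -> `|bump r s - bump r t| <= r^-1 * `|s - t|.
Proof.
move=> r0; have -> : r^-1 * `|s - t| = `|s / r - t / r|.
  by rewrite -mulrBl normrM [X in _ = _ * X]ger0_norm ?invr_ge0 ?ltW // mulrC.
have m1 : Num.max 0 1 = 1 :> R by rewrite max_r.
have key (x y z : R) : - z <= x - y -> x - y <= z ->
    `|Num.max 0 (Num.min 1 (2 - x)) - Num.max 0 (Num.min 1 (2 - y))| <= z.
  move=> l u; rewrite ler_norml.
  case: (leP 1 (2 - x)) => h1; case: (leP 1 (2 - y)) => h2; rewrite ?m1;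
  case: (leP 0 (2 - x)) => h3; case: (leP 0 (2 - y)) => h4; apply/andP; split; lra.
have /andP[l u] : - `|s / r - t / r| <= s / r - t / r <= `|s / r - t / r| by rewrite -ler_norml.
exact: key.
Qed.

End Bump.

Section LimsupProbability.
Context {R : realType}.

Lemma limn_esup_gt0 (u : nat -> \bar R) (e : R) : 0 < e ->
  (forall N, exists2 n, (N <= n)%N & (e%:E <= u n)%E) -> (0 < limn_esup u)%E.
Proof.
move=> e0 ue; apply: (@lt_le_trans _ _ e%:E); first by rewrite lte_fin.
apply: le_ereal_inf_tmp => _ [A [N _ NA] <-].
have [n Nn en] := ue N; apply: le_trans en _.
by apply: ereal_sup_ubound; exists n => //; apply: NA.
Qed.

Lemma limn_esup_le0 (u : nat -> \bar R) :
  (forall e : R, 0 < e -> exists N, forall n, (N <= n)%N -> (u n <= e%:E)%E) ->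
  (limn_esup u <= 0)%E.
Proof.
move=> ue; apply/lee_addgt0Pr => e e0; rewrite add0e.
have [N uN] := ue e e0.
apply: (@le_trans _ _ (ereal_sup [set u n | n in [set n | (N <= n)%N]])).
  by apply: ereal_inf_lbound; exists [set n | (N <= n)%N] => //; exists N.
by apply: ge_ereal_sup => _ [n /= Nn <-]; exact: uN.
Qed.

End LimsupProbability.

Section SecondMoment.
Context {R : realType} {G : topologicalGroupType} {H : hilbertType R}.
Variables (pi : G -> {linear H -> H}) (b : G -> H).
Hypotheses (hpi : orthogonal_representation pi) (hb : cocycle pi b).
Variable mu : probability (borel G) R.
Hypothesis mom : has_moments b mu.
Hypothesis mu_sym : forall F : G -> R, continuous F ->
  mu.-integrable setT (EFin \o (fun x : borel G => F (x^-1)%g)) ->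
  \int[mu]_x F (x^-1)%g = \int[mu]_x F x.
Hypothesis harm : weakly_harmonic mu b.

Local Notation act := (affine_act pi b).
Local Notation M := (markov pi b mu).

Lemma cocycle_normV x : `|b (x^-1)%g| = `|b x|.
Proof. by rewrite (cocycleV hpi hb) normrN (rep_norm hpi). Qed.

Lemma polylip_cocycle_integrable f : polylip f ->
  mu.-integrable setT (EFin \o (fun x : borel G => f (b x))).
Proof.
move=> pf; have := polylip_integrable hpi hb mom 0 pf.
by congr (mu.-integrable _ _); apply/funext => x /=; rewrite act0.
Qed.

Lemma cocycleV_integrable f : polylip f ->
  mu.-integrable setT (EFin \o (fun x : borel G => f (b (x^-1)%g))).
Proof.
move=> pf; have [C [k [C0 fC]]] := polylip_growth pf.
apply: (integrable_dominated mom (C := C) (k := k)) => x.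
  apply: (cvg_comp (fun x => b (x^-1)%g) f); last exact: polylip_continuous.
  apply: (cvg_comp (fun x : G => (x^-1)%g) b); first exact: invg_continuous.
  exact: (cocycle_continuous hb).
by rewrite /weight -cocycle_normV; exact: fC.
Qed.

Lemma Rintegral_cocycleV f : polylip f -> \int[mu]_x f (b (x^-1)%g) = \int[mu]_x f (b x).
Proof.
move=> pf; apply: (mu_sym (F := f \o b)); last exact: cocycleV_integrable.
move=> x; apply: (cvg_comp b f); last exact: polylip_continuous.
exact: (cocycle_continuous hb).
Qed.

Section Functional.
Variables (C : R) (L : H -> R).
Hypothesis LP : forall a u v, L (a *: u + v) = a * L u + L v.
Hypothesis LC : forall u, `|L u| <= C * `|u|.

Lemma polylip_functional : polylip L.
Proof. by apply: (@lipschitz_polylip _ _ _ C) => u v; rewrite -(functionalB LP). Qed.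

Lemma functional_mean0 : \int[mu]_x L (b x) = 0.
Proof. exact: harm LC. Qed.

End Functional.

Lemma form_functional (C : R) (B : H -> H -> R) v : bounded_form C B ->
  [/\ forall a u u', B (a *: u + u') v = a * B u v + B u' v
    & forall u, `|B u v| <= (C * `|v|) * `|u|].
Proof.
move=> fB; split; first by move=> *; rewrite (formP fB).
by move=> u; rewrite (le_trans (form_le fB u v)) // -mulrA (mulrC `|v|).
Qed.

(** By invariance the cross term in B (x.u) (x.u) is -2 B (b (x^-1)) u, which has mean 0 by symmetry
    and harmonicity: each step adds the same constant. Besides the inner product, this serves both
    parts of a projection that commutes with pi. *)
Lemma form_second_moment n (C : R) (B : H -> H -> R) : bounded_form C B ->
  (forall x u v, B (pi x u) (pi x v) = B u v) ->
  iter n M (fun u => B u u) 0 = n%:R * \int[mu]_x B (b x) (b x).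
Proof.
move=> fB iB; have pB := polylip_form fB.
have MB : M (fun u => B u u) = (fun u => B u u + \int[mu]_x B (b x) (b x)).
  apply/funext => u; have [L1 L2] := form_functional u fB.
  have pL := polylip_functional L1 L2.
  have actE x : B (act x u) (act x u) = B u u + B (b x) (b x) - 2 * B (b (x^-1)%g) u.
    rewrite /affine_act (form_sqD fB) iB (cocycleV hpi hb) (formNl fB).
    by rewrite -(iB (x^-1)%g (b x) (pi x u)) (rep_invVK hpi); ring.
  rewrite /markov; under [X in Rintegral _ _ X]eq_fun do rewrite actE.
  have i1 := polylip_cocycle_integrable pB.
  have i2 := cocycleV_integrable pL.
  have i0 := finite_measure_integrable_cst mu (B u u) (@measurableT _ (borel G)).
  rewrite RintegralB //; last 2 first.
  - exact: (integrableD measurableT i0 i1).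
  - exact: (integrableZl measurableT 2 i2).
  rewrite RintegralD // RintegralZl // (Rintegral_cocycleV pL) (functional_mean0 L1 L2).
  by rewrite mulr0 subr0 (Rintegral_prob_cst pi b).
elim: n => [|n IH]; first by rewrite /= mul0r (form0l fB).
rewrite iterSr MB (iter_markovD hpi hb mom) //; last exact: polylip_cst.
by rewrite iter_markov_cst IH -natr1 mulrDl mul1r.
Qed.

End SecondMoment.

Section InnerForms.
Context {R : realType} {H : hilbertType R}.

Lemma inner_form : bounded_form 1 (@inner R H).
Proof.
split=> [u v|a u v w|u v]; first exact: innerC.
  by rewrite innerDl innerZl.
by rewrite mul1r cauchy_schwarz.
Qed.

Lemma contraction_form (p : H -> H) : (forall a u v, p (a *: u + v) = a *: p u + p v) ->
  (forall u, `|p u| <= `|u|) -> bounded_form 1 (fun u v => inner (p u) (p v)).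
Proof.
move=> pl pc; split=> [u v|a u v w|u v]; first exact: innerC.
  by rewrite pl innerDl innerZl.
by rewrite mul1r (le_trans (cauchy_schwarz _ _)) // ler_pM.
Qed.

Variables (e : seq H) (oe : onb e).

Lemma proj_form : bounded_form 1 (fun u v => inner (proj e u) (proj e v)).
Proof. by apply: contraction_form => *; rewrite ?projD ?projZ ?proj_le. Qed.

Lemma projC_form : bounded_form 1 (fun u v => inner (u - proj e u) (v - proj e v)).
Proof.
apply: (@contraction_form (fun u => u - proj e u)) => [a u v|u].
  by rewrite projD projZ opprD addrACA -scalerBr.
rewrite -(@ler_pXn2r _ 2) ?nnegrE // normr_projB // lerBlDr lerDl sqr_ge0 //.
Qed.

End InnerForms.

Section Tightness.
Context {R : realType} {G : topologicalGroupType} {H : hilbertType R}.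
Variables (Q : set G) (hQ : generating_neighborhood Q).
Variables (pi : G -> {linear H -> H}) (b : G -> H).
Hypotheses (hpi : orthogonal_representation pi) (hb : cocycle pi b).
Variable mu : probability (borel G) R.
Hypothesis mom : has_moments b mu.
Hypothesis mu_sym : forall F : G -> R, continuous F ->
  mu.-integrable setT (EFin \o (fun x : borel G => F (x^-1)%g)) ->
  \int[mu]_x F (x^-1)%g = \int[mu]_x F x.
Hypothesis harm : weakly_harmonic mu b.

Local Notation act := (affine_act pi b).
Local Notation M := (markov pi b mu).

Lemma bump_polylip (r : R) (w : H) : 0 < r -> polylip (fun u => bump r `|u - w|).
Proof.
move=> r0; apply: (@lipschitz_polylip _ _ _ r^-1) => u v.
apply: le_trans (bump_lip _ _ r0) _; rewrite ler_wpM2l ?invr_ge0 ?(ltW r0) //.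
by apply: le_trans (ler_dist_dist _ _) _; rewrite opprB addrA subrK.
Qed.

Hypothesis fd_approx : forall eps : R, 0 < eps -> exists e : seq H, [/\ onb e,
  forall x u, proj e (pi x u) = pi x (proj e u) &
  \int[mu]_x `|b x - proj e (b x)| ^+ 2 < eps].

(* The walk rescaled by sqrt n stays with probability 1/2 in a union of N balls
   with N independent of n, hence in one of them with probability 1/(2N); two
   independent walks of length n then end close to each other with probability
   1/(4N^2), that is, the walk of length 2n ends close to its start. *)
Lemma small_ball_lower (c : R) : 0 < c -> exists2 delta : R, 0 < delta &
  forall n, (0 < n)%N ->
    delta <= iter (n + n) M (fun u => bump (c * Num.sqrt n%:R / 2) `|u|) 0.
Proof.
move=> c0; pose s2 := \int[mu]_x `|b x| ^+ 2.
have s20 : 0 <= s2 by apply: Rintegral_ge0 => x _; exact: sqr_ge0.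
(* At the scale sqrt n, a net of mesh r and an orthogonal part of norm at most r leave a distance 2
   r = c / 8 to some centre; this is [rho] below. *)
pose r := c / 16; have r0 : 0 < r by rewrite divr_gt0.
have eps0 : 0 < r ^+ 2 / 4 by rewrite divr_gt0 // exprn_gt0.
have [e [oe eI er]] := fd_approx eps0.
(* As A^2 >= 4 s2, Chebyshev's inequality bounds by 1/4 the probability that the projection has norm
   above A sqrt n. The bound [r ^+ 2 / 4] on the second moment does the same for the orthogonal
   part. *)
pose A := 2 * (s2 + 1); have A0 : 0 < A by rewrite /A; lra.
have [t tP] := proj_net A r0 oe.
have t0 : (0 < size t)%N.
  by have [|x] := tP 0; [rewrite normr0 ltW|case: (t)].
have N0 : (0 : R) < (size t)%:R by rewrite ltr0n.
exists ((2 * (size t)%:R)^-1 ^+ 2); first by rewrite exprn_gt0 // invr_gt0 mulr_gt0.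
move=> n n0; have sn0 : 0 < Num.sqrt n%:R :> R by rewrite sqrtr_gt0 ltr0n.
have sn2 : Num.sqrt n%:R ^+ 2 = n%:R :> R by rewrite sqr_sqrtr.
pose rho := c * Num.sqrt n%:R / 8.
have rho0 : 0 < rho by rewrite divr_gt0 ?mulr_gt0.
pose psi (w u : H) := bump rho `|u - Num.sqrt n%:R *: w|.
have ppsi w : polylip (psi w) by exact: bump_polylip.
have pairw w : iter n M (psi w) 0 ^+ 2 <=
    iter (n + n) M (fun u => bump (c * Num.sqrt n%:R / 2) `|u|) 0.
  (* A cutoff vanishes from 2 rho on, so two points where the same one is positive are within 4 rho
     of each other. *)
  have rho4 : c * Num.sqrt n%:R / 2 = 4 * rho by rewrite /rho; field.
  have rho40 : 0 < 4 * rho by rewrite mulr_gt0.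
  rewrite rho4; apply: (iter_markov_pairing hQ hpi hb mom mu_sym (C := 1) (L := (4 * rho)^-1)) => //.
  - by move=> x; exact: bump_ge0.
  - by move=> x; exact: bump_le1.
  - by move=> x y; exact: bump_lip.
  - by move=> u; exact: bump_ge0.
  move=> u v; rewrite /psi.
  have [hu|hu] := leP (2 * rho) `|u - Num.sqrt n%:R *: w|.
    by rewrite (bump_eq0 rho0 hu) mul0r bump_ge0.
  have [hv|hv] := leP (2 * rho) `|v - Num.sqrt n%:R *: w|.
    by rewrite (bump_eq0 rho0 hv) mulr0 bump_ge0.
  rewrite (@bump_eq1 _ (4 * rho)) //; first by rewrite mulr_ile1 ?bump_ge0 ?bump_le1.
  rewrite -(subrKA (Num.sqrt n%:R *: w)) (le_trans (ler_normD _ _)) //.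
  by rewrite (distrC (Num.sqrt n%:R *: w)); lra.
have pf := polylip_form (proj_form oe); have pg := polylip_form (projC_form oe).
(* Chebyshev's inequality in pointwise form: a function below the sum of the cutoffs, made of two
   invariant quadratic forms whose means are known exactly. *)
pose low u := 1 + (- (A ^+ 2 * n%:R)^-1 * inner (proj e u) (proj e u)
  + - (r ^+ 2 * n%:R)^-1 * inner (u - proj e u) (u - proj e u)).
have plow : polylip low.
  by apply: polylipD; [exact: polylip_cst|apply: polylipD; exact: polylipZ].
have nR : (0 : R) < n%:R by rewrite ltr0n.
have cover u : low u <= \sum_(w <- t) psi w u.
  have sum0 : 0 <= \sum_(w <- t) psi w u by apply: sumr_ge0 => w _; exact: bump_ge0.
  have g1 : 0 <= (A ^+ 2 * n%:R)^-1 * inner (proj e u) (proj e u).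
    by rewrite mulr_ge0 ?inner_ge0 // invr_ge0 mulr_ge0 ?sqr_ge0.
  have g2 : 0 <= (r ^+ 2 * n%:R)^-1 * inner (u - proj e u) (u - proj e u).
    by rewrite mulr_ge0 ?inner_ge0 // invr_ge0 mulr_ge0 ?sqr_ge0.
  have [hA|hA] := ltP (A * Num.sqrt n%:R) `|proj e u|.
    apply: le_trans sum0; rewrite /low.
    have : 1 <= (A ^+ 2 * n%:R)^-1 * inner (proj e u) (proj e u).
      rewrite [leRHS]mulrC ler_pdivlMr; last by rewrite mulr_gt0 ?exprn_gt0.
      rewrite mul1r -normr_inner -sn2 -exprMn.
      by rewrite lerXn2r ?nnegrE ?mulr_ge0 ?addr_ge0 ?(ltW c0) ?(ltW sn0) ?(ltW hA) //.
    by lra.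
  have [hr|hr] := ltP (r * Num.sqrt n%:R) `|u - proj e u|.
    apply: le_trans sum0; rewrite /low.
    have : 1 <= (r ^+ 2 * n%:R)^-1 * inner (u - proj e u) (u - proj e u).
      rewrite [leRHS]mulrC ler_pdivlMr; last by rewrite mulr_gt0 ?exprn_gt0.
      rewrite mul1r -normr_inner -sn2 -exprMn.
      by rewrite lerXn2r ?nnegrE ?mulr_ge0 ?addr_ge0 ?(ltW c0) ?(ltW sn0) ?(ltW hr) //.
    by lra.
  have [|w wt uw] := tP ((Num.sqrt n%:R)^-1 *: proj e u).
    by rewrite normrZ ger0_norm ?invr_ge0 ?(ltW sn0) // mulrC ler_pdivrMr.
  rewrite projZ proj_idem // in uw.
  have uw' : `|u - Num.sqrt n%:R *: w| <= rho.
    rewrite -(subrKA (proj e u)) (le_trans (ler_normD _ _)) //.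
    have -> : proj e u - Num.sqrt n%:R *: w =
        Num.sqrt n%:R *: ((Num.sqrt n%:R)^-1 *: proj e u - w).
      by rewrite scalerBr scalerA divff ?gt_eqF // scale1r.
    rewrite normrZ (ger0_norm (ltW sn0)).
    have : Num.sqrt n%:R * `|(Num.sqrt n%:R)^-1 *: proj e u - w| <= Num.sqrt n%:R * r.
      by rewrite ler_pM2l // ltW.
    have -> : rho = r * Num.sqrt n%:R + Num.sqrt n%:R * r by rewrite /rho /r; field.
    lra.
  have psi1 : psi w u = 1 by exact: bump_eq1.
  apply: (@le_trans _ _ 1); first by rewrite /low; lra.
  by rewrite (big_rem w) //= psi1 lerDl; apply: sumr_ge0 => ? _; exact: bump_ge0.
have sumP : 2^-1 <= \sum_(w <- t) iter n M (psi w) 0.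
  have := iter_markov_le hpi hb mom n 0 plow (polylip_sum t ppsi) cover.
  rewrite (iter_markov_sum hpi hb mom) //; apply: le_trans.
  rewrite /low (iter_markovD hpi hb mom) ?iter_markov_cst //; last 2 first.
  - exact: polylip_cst.
  - by apply: polylipD; exact: polylipZ.
  rewrite (iter_markovD hpi hb mom); [|exact: polylipZ|exact: polylipZ].
  rewrite !(iter_markovZ hpi hb mom) //.
  rewrite (form_second_moment hpi hb mom mu_sym harm n (proj_form oe)); last first.
    by move=> x u v; rewrite !eI (rep_inner hpi).
  rewrite (form_second_moment hpi hb mom mu_sym harm n (projC_form oe)); last first.
    by move=> x u v; rewrite !eI -!linearB (rep_inner hpi).
  set I1 := \int[mu]_x _; set I2 := \int[mu]_x _.
  have i1 : I1 <= s2.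
    apply: le_Rintegral => //.
    - exact: (polylip_cocycle_integrable hpi hb mom pf).
    - have := polylip_cocycle_integrable hpi hb mom (polylip_form inner_form).
      by congr (mu.-integrable _ _); apply/funext => x /=; rewrite normr_inner.
    by move=> x _; rewrite -normr_inner lerXn2r ?nnegrE // proj_le.
  have i2 : I2 < r ^+ 2 / 4.
    apply: le_lt_trans er; rewrite le_eqVlt; apply/orP; left; apply/eqP.
    by congr (Rintegral _ _ _); apply/funext => x; rewrite normr_inner.
  have cancel (a x : R) : (a * n%:R)^-1 * (n%:R * x) = x / a.
    by rewrite invfM -mulrA mulKf ?gt_eqF // mulrC.
  have h1 : (A ^+ 2 * n%:R)^-1 * (n%:R * I1) <= 4^-1.
    rewrite cancel ler_pdivrMr ?exprn_gt0 //.
    apply: le_trans i1 _; rewrite /A exprMn; have := sqr_ge0 s2; lra.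
  have h2 : (r ^+ 2 * n%:R)^-1 * (n%:R * I2) <= 4^-1.
    rewrite cancel ler_pdivrMr ?exprn_gt0 //.
    by rewrite mulrC ltW.
  rewrite !mulNr; move: h1 h2; move: (_ * (n%:R * I1)) (_ * (n%:R * I2)) => y1 y2 h1 h2; lra.
have [w wt hw] : exists2 w, w \in t & (2 * (size t)%:R)^-1 <= iter n M (psi w) 0.
  apply: contrapT => none.
  have : \sum_(w <- t) iter n M (psi w) 0 < \sum_(w <- t) (2 * (size t)%:R)^-1.
    rewrite big_seq [ltRHS]big_seq; apply: ltr_sum.
      case: (t) t0 => // w t' _; apply/hasP; exists w; rewrite ?mem_head //.
    move=> w wt; rewrite ltNge; apply/negP => h; apply: none; by exists w.
  rewrite big_const_seq count_predT iter_addr_0.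
  have -> : (2 * (size t)%:R)^-1 *+ size t = 2^-1 :> R.
    by rewrite -[LHS]mulr_natr invfM -mulrA mulVf ?gt_eqF // mulr1.
  by move=> /(le_lt_trans sumP); rewrite ltxx.
apply: le_trans (pairw w); rewrite lerXn2r ?nnegrE ?invr_ge0 ?mulr_ge0 ?ler0n //.
by apply: (iter_markov_ge0 hpi hb mom) => // u; exact: bump_ge0.
Qed.

End Tightness.

(** * Finite-dimensional approximation of the cocycle *)

Section Tail.
Context {R : realType} {G : topologicalGroupType}.
Variables (Q : set G) (hQ : generating_neighborhood Q).
Variable mu : probability (borel G) R.

(** [D] is the complement of finitely many balls of a countable net. These complements decrease to
    the empty set, so that dominated convergence makes their share of the integral small. *)
Lemma finite_net_tail (V : normedModType R) (phi : G -> V) (F : G -> R) (eta eps : R) :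
  continuous phi -> (forall x, 0 <= F x) ->
  mu.-integrable setT (EFin \o (F : borel G -> R)) -> 0 < eta -> 0 < eps ->
  exists (xs : seq G) (D : set (borel G)), [/\ measurable D,
    \int[mu]_x (F x * \1_D x) < eps &
    forall x, ~ D x -> exists2 y, y \in xs & `|phi x - phi y| < eta].
Proof.
move=> cphi F0 iF eta0 eps0; have [z zP] := countable_net hQ cphi eta0.
pose U k : set G := [set x | `|phi x - phi (z k)| < eta].
have mU k : measurable (U k : set (borel G)).
  apply: borel_open.
  have cz : continuous (fun x => `|phi x - phi (z k)|).
    by move=> x; apply: cvg_norm; apply: cvgB; [exact: cphi|exact: cvg_cst].
  by move/continuousP: cz => /(_ _ (@open_lt R eta)).
pose D N : set (borel G) := ~` (\bigcup_(k < N) U k).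
have mD N : measurable (D N) by apply: measurableC; apply: bigcup_measurable.
have [mF _] := integrableP _ _ _ iF.
pose f_ N (x : borel G) := (F x * \1_(D N) x)%:E.
have mf_ N : measurable_fun setT (f_ N).
  by apply/measurable_EFinP; apply: measurable_funM; [exact/measurable_EFinP|exact: measurable_indic].
have f_le N x : (`|f_ N x| <= (F x)%:E)%E.
  rewrite lee_fin normrM ger0_norm // [X in _ * X]ger0_norm //.
  by rewrite ler_piMr // indicE; case: (_ \in _).
have f_cvg x : f_ ^~ x @ \oo --> 0%E.
  have [k kx] := zP x; apply: cvg_near_cst; exists k.+1 => // N /= kN.
  by rewrite /f_ indicE memNset ?mulr0 // => /(_ (ex_intro2 _ _ k kN kx)).
have [_ _] := dominated_convergence measurableT mf_ (measurable_cst 0%E)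
  (aeW _ (fun x _ => f_cvg x)) iF (aeW _ (fun x N _ => f_le N x)).
rewrite integral0 => /fine_cvgP[_ /cvgrPdist_lt /(_ _ eps0)] [N _ /(_ N (leqnn N)) /= hN].
exists [seq z k | k <- iota 0 N], (D N); split=> //.
  by move: hN; rewrite sub0r normrN; apply: le_lt_trans; exact: ler_norm.
move=> x /contrapT [k /= kN kx]; exists (z k) => //.
by apply/mapP; exists k => //; rewrite mem_iota.
Qed.

End Tail.

Section InvariantSpan.
Context {R : realType} {G : topologicalGroupType} {H : hilbertType R}.
Variables (pi : G -> {linear H -> H}).
Hypotheses (hpi : orthogonal_representation pi).

(** A subspace that is stable under the whole group, hence under inverses, has a stable orthogonal
    complement. *)
Lemma proj_rep (e : seq H) : onb e ->
  (forall x u, linear_span [set` e] u -> linear_span [set` e] (pi x u)) ->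
  forall x u, proj e (pi x u) = pi x (proj e u).
Proof.
move=> oe; rewrite linear_span_onb // => eI x u.
rewrite -[u in LHS](subrK (proj e u)) linearD projD.
have -> : proj e (pi x (u - proj e u)) = 0.
  rewrite /proj big1_seq // => c /= ce; rewrite (rep_adjoint hpi).
  have <- : proj e (pi (x^-1)%g c) = pi (x^-1)%g c by apply: eI; exact: proj_self.
  by rewrite proj_orth // scale0r.
by rewrite add0r; apply: eI => /=; exact: proj_idem.
Qed.

Lemma closure_span_rep (S : set H) : (forall x u, S u -> linear_span S (pi x u)) ->
  forall x u, closure (linear_span S) u -> closure (linear_span S) (pi x u).
Proof.
move=> SI x u; have cpi : continuous (pi x).
  apply: (@local_lipschitz_continuous _ _ _ _ (fun=> 1)) => v w _.
  by rewrite mul1r -linearB (rep_norm hpi).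
have sI v : linear_span S v -> linear_span S (pi x v).
  apply: (@linear_span_min _ _ _ (fun v => linear_span S (pi x v))); last exact: SI.
  have lS := @linear_span_linear R H S.
  split; first by rewrite linear0; case: lS.
  by move=> a y z Sy Sz; rewrite linearP; case: lS => _; apply.
move=> cu B /cpi nB; have [v [Sv Bv]] := cu _ nB.
by exists (pi x v); split=> //; exact: sI.
Qed.

End InvariantSpan.

Section FiniteDimensionalSum.
Context {R : realType} {G : topologicalGroupType} {H : hilbertType R}.
Variables (Q : set G) (hQ : generating_neighborhood Q).
Variables (pi : G -> {linear H -> H}) (b : G -> H).
Hypotheses (hpi : orthogonal_representation pi) (hb : cocycle pi b).
Variable mu : probability (borel G) R.
Hypothesis mom : has_moments b mu.

Section Decomposition.
Variables (I : Type) (V : I -> set H).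
Hypotheses (dV : orthogonal_decomposition V)
  (piV : forall i g v, V i v -> V i (pi g v))
  (fdV : forall i, finite_dimensional_cocycle (orthogonal_projection (V i) \o b)).

Local Notation P i := (orthogonal_projection (V i)).

Lemma projection_rep i x u : P i (pi x u) = pi x (P i u).
Proof.
have cV := od_closed dV i.
apply: orthogonal_projection_eq => //.
  by apply: piV; exact: orthogonal_projection_in.
move=> z Vz; rewrite -linearB (rep_adjoint hpi).
by apply: orthogonal_projection_orth => //; exact: piV.
Qed.

(** Approximate the vectors [b y] by vectors [w] of finitely many summands, and let [e] span the
    components of b in these. The residue d of [b y] is then orthogonal to these summands, hence to
    [w], and |d|^2 = inner d (b y - w) <= |d| |b y - w|. *)
Lemma decomposition_approx (xs : seq G) (eta : R) : 0 < eta ->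
  exists e : seq H, [/\ onb e, forall x u, proj e (pi x u) = pi x (proj e u) &
    forall y, y \in xs -> `|b y - proj e (b y)| < eta].
Proof.
move=> eta0.
(* The index type is arbitrary and has no decidable equality, whence [List.In]. *)
have [js jsP] : exists js : seq I, forall y, y \in xs -> exists w,
    linear_span (\bigcup_(j in [set j | List.In j js]) V j) w /\ `|b y - w| < eta.
  elim: xs => [|y xs [js IH]]; first by exists [::].
  have : closure (linear_span (\bigcup_i V i)) (b y) by rewrite (od_total dV).
  move=> /(_ _ (nbhsx_ballx (b y) eta eta0)) [w [[n [a [v [vV wE]]]] /= yw]].
  have exV k : exists i, V i (v k) by have [i _ Vi] := vV k; exists i.
  pose ks k := projT1 (cid (exV k)).
  have ksP k : V (ks k) (v k) := projT2 (cid (exV k)).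
  exists ([seq ks k | k <- enum 'I_n] ++ js) => x; rewrite inE => /orP[/eqP ->|/IH [w' [ww xw]]].
    exists (\sum_(i < n) a i *: v i); split; last by rewrite -wE; rewrite -ball_normE in yw.
    apply: linear_subset_sum; first exact: linear_span_linear.
    move=> k _; apply: linear_subsetZ; first exact: linear_span_linear.
    apply: linear_span_incl; exists (ks k) => //=; apply: List.in_or_app; left.
    apply/List.in_map; have : k \in enum 'I_n by rewrite mem_enum.
    by elim: (enum 'I_n) => //= k' s IHs; rewrite inE => /orP[/eqP ->|/IHs]; [left|right].
  exists w'; split=> //; apply: linear_span_min ww; first exact: linear_span_linear.
  move=> u [j /= jjs Vj]; apply: linear_span_incl; exists j => //=.
  by apply: List.in_or_app; right.
pose s i : seq H := projT1 (cid (fdV i)).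
have sE i : closure (linear_span (range (P i \o b))) = linear_span [set` s i] :=
  projT2 (cid (fdV i)).
pose S := flatten [seq s j | j <- js].
have sS j : List.In j js -> [set` s j] `<=` [set` S].
  rewrite /S; elim: (js) => //= k ks IH [->|/IH h] v vs; rewrite /= mem_cat; apply/orP.
    by left.
  by right; exact: h.
have Ss v : v \in S -> exists2 j, List.In j js & v \in s j.
  rewrite /S; elim: (js) => //= k ks IH; rewrite mem_cat => /orP[vs|/IH [j jk vj]].
    by exists k => //; left.
  by exists j => //; right.
have sV j : linear_span [set` s j] `<=` V j.
  rewrite -sE; have [clV V0 VP] := od_closed dV j.
  rewrite [X in _ `<=` X](closure_id _).1 //; apply: closure_subset.
  apply: linear_span_min => // _ [x _ <-]; apply: orthogonal_projection_in; exact: od_closed.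
have [e oe eS] := gram_schmidt S.
have lsp := @linear_span_linear R H.
have sSp j : List.In j js -> linear_span [set` s j] `<=` linear_span [set` S].
  move=> jj; apply: linear_span_min => // v vs; apply: linear_span_incl.
  exact: (sS j jj).
exists e; split=> //.
  apply: proj_rep => // x; rewrite eS.
  apply: (@linear_span_min _ _ _ (fun u => linear_span [set` S] (pi x u))).
    split; first by rewrite linear0; case: (lsp [set` S]).
    by move=> a y z Sy Sz; rewrite linearP; case: (lsp [set` S]) => _; apply.
  move=> v /Ss [j jj vs]; apply: (sSp j jj); rewrite -sE.
  (* The closed span of the values of a cocycle is invariant: pi g (b y) is the difference of b (g
     y) and b g. *)
  apply: closure_span_rep => //; last by rewrite sE; exact: linear_span_incl.
  move=> g _ [y _ <-] /=; rewrite -projection_rep.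
  have -> : pi g (b y) = b (g * y)%g - b g by rewrite (cocycleM hb) addrC addKr.
  have cV := od_closed dV j.
  have -> : P j (b (g * y)%g - b g) = P j (b (g * y)%g) - P j (b g).
    rewrite -scaleN1r addrC orthogonal_projection_linear // scaleN1r addrC //.
  by apply: linear_subsetB => //; apply: linear_span_incl; eexists.
move=> y yxs; have [w [ww yw]] := jsP y yxs.
set d := b y - proj e (b y).
have de u : linear_span [set` e] u -> inner d u = 0.
  by rewrite linear_span_onb // => /= <-; exact: proj_orth.
(* A generator lies in a single summand, so [P i] fixes it or kills it. *)
have Pe i u : linear_span [set` S] u -> linear_span [set` S] (P i u).
  have cV := od_closed dV i.
  apply: (@linear_span_min _ _ _ (fun u => linear_span [set` S] (P i u))).
    split.
      by rewrite orthogonal_projection_eq0 //; [case: (lsp [set` S])|move=> z _; rewrite inner0l].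
    move=> a p q Sp Sq; rewrite orthogonal_projection_linear //.
    by case: (lsp [set` S]) => _; apply.
  move=> v vS; have [j jj vs] := Ss _ vS.
  have Vjv : V j v by apply: sV; exact: linear_span_incl.
  have [<-|ji] := pselect (j = i).
    by rewrite orthogonal_projection_id //; [exact: linear_span_incl|exact: od_closed].
  rewrite orthogonal_projection_eq0 //; first by case: (lsp [set` S]).
  by move=> z Viz; exact: (od_orthogonal dV ji).
(* [P i d] lies in the span of [e], to which d is orthogonal; and its inner product with d is its
   own squared norm. *)
have Pd i : List.In i js -> P i d = 0.
  move=> ijs; have cV := od_closed dV i; apply: inner_eq0.
  rewrite orthogonal_projection_inner //; last exact: orthogonal_projection_in.
  apply: de; rewrite eS /d.
  have -> : P i (b y - proj e (b y)) = P i (b y) - P i (proj e (b y)).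
    by rewrite -scaleN1r addrC orthogonal_projection_linear // scaleN1r addrC.
  apply: linear_subsetB => //.
    apply: (sSp i ijs); rewrite -sE; apply: subset_closure; apply: linear_span_incl.
    by exists y.
  by apply: Pe; rewrite -eS linear_span_onb //=; exact: proj_idem.
have dw : inner d w = 0.
  move: w ww {yw}; apply: (@linear_span_min _ _ _ (fun w => inner d w = 0)).
    split; first exact: inner0r.
    by move=> a p q dp dq; rewrite innerDr innerZr dp dq mulr0 addr0.
  move=> u [i /= ijs Viu]; have cV := od_closed dV i.
  by rewrite -(orthogonal_projection_inner cV) // Pd // inner0l.
have dd : `|d| ^+ 2 <= `|d| * `|b y - w|.
  rewrite normr_inner {2}/d innerBr (de (proj e (b y))); last first.
    by rewrite linear_span_onb //=; exact: proj_idem.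
  rewrite subr0 -[inner d (b y)]subr0 -dw -innerBr.
  by apply: le_trans (cauchy_schwarz _ _); exact: ler_norm.
have [d0|dn] := eqVneq `|d| 0; first by rewrite d0.
have dp : 0 < `|d| by rewrite lt_neqAle eq_sym dn normr_ge0.
by apply: le_lt_trans yw; rewrite -(ler_pM2l dp) -expr2.
Qed.

End Decomposition.

Lemma sum_fd_approx : sum_of_finite_dimensional pi b ->
  forall eps : R, 0 < eps -> exists e : seq H, [/\ onb e,
    forall x u, proj e (pi x u) = pi x (proj e u) &
    \int[mu]_x `|b x - proj e (b x)| ^+ 2 < eps].
Proof.
move=> [I [V [dV piV fdV]]] eps eps0.
(* Outside [D] the distance from b x to the subspace is at most 2 eta, which contributes at most 4
   eta^2 = eps / 4; the set [D] contributes less than eps / 2. *)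
pose eta := Num.sqrt eps / 4.
have se : 0 < Num.sqrt eps by rewrite sqrtr_gt0.
have eta0 : 0 < eta by rewrite divr_gt0.
have eta2 : eta ^+ 2 = eps / 16.
  by rewrite /eta exprMn sqr_sqrtr ?ltW //; field.
have ib : mu.-integrable setT (EFin \o (fun x : borel G => `|b x| ^+ 2)).
  have := polylip_cocycle_integrable hpi hb mom (polylip_form inner_form).
  by congr (mu.-integrable _ _); apply/funext => x /=; rewrite normr_inner.
have eps2 : 0 < eps / 2 by rewrite divr_gt0.
have [xs [D [mD iD xsP]]] := finite_net_tail hQ (cocycle_continuous hb)
  (fun x => sqr_ge0 `|b x|) ib eta0 eps2.
have [e [oe eI eP]] := decomposition_approx dV piV fdV xs eta0.
exists e; split=> //.
have i1 : mu.-integrable setT (EFin \o (fun x : borel G => `|b x| ^+ 2 * \1_D x)).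
  apply: (le_integrable _ _ _ ib) => //.
    have [mb _] := integrableP _ _ _ ib.
    apply/measurable_EFinP; apply: measurable_funM; last exact: measurable_indic.
    exact/measurable_EFinP.
  move=> x _ /=; rewrite lee_fin normrM ler_piMr // indicE.
  by case: (_ \in _); rewrite ?normr1 ?normr0.
have ic := finite_measure_integrable_cst mu (4 * eta ^+ 2) (@measurableT _ (borel G)).
have i2 : mu.-integrable setT (EFin \o (fun x : borel G => `|b x - proj e (b x)| ^+ 2)).
  have := polylip_cocycle_integrable hpi hb mom (polylip_form (projC_form oe)).
  by congr (mu.-integrable _ _); apply/funext => x /=; rewrite normr_inner.
apply: (@le_lt_trans _ _ (\int[mu]_x (`|b x| ^+ 2 * \1_D x + 4 * eta ^+ 2))).
  apply: le_Rintegral => //; first exact: (integrableD measurableT i1 ic).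
  move=> x _; rewrite indicE; have [xD|xD] := boolP (x \in D).
    rewrite mulr1 (le_trans (y := `|b x| ^+ 2)) ?lerDl ?mulr_ge0 ?sqr_ge0 //.
    by rewrite normr_projB // gerBl sqr_ge0.
  rewrite mulr0 add0r; have [|y yxs xy] := xsP x; first by rewrite notin_setE in xD.
  rewrite (_ : 4 * _ = (2 * eta) ^+ 2); last by ring.
  rewrite lerXn2r ?nnegrE ?mulr_ge0 ?(ltW eta0) //.
  apply: le_trans (proj_best (v := proj e (b y)) _ oe (proj_idem _ oe)) _.
  rewrite -(subrKA (b y)) (le_trans (ler_normD _ _)) //.
  by have := eP y yxs; lra.
rewrite RintegralD // (Rintegral_prob_cst pi b) eta2; lra.
Qed.

End FiniteDimensionalSum.

(** * Fourth moments and averaged covariance forms *)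

Section RealIntegrable.
Context d (T : measurableType d) (R : realType) (m : {measure set T -> \bar R}).
Implicit Types f g : T -> R.

Lemma integrable_add f g : m.-integrable setT (EFin \o f) -> m.-integrable setT (EFin \o g) ->
  m.-integrable setT (EFin \o (fun x => f x + g x)).
Proof. exact: integrableD. Qed.

Lemma integrable_scale (c : R) f : m.-integrable setT (EFin \o f) ->
  m.-integrable setT (EFin \o (fun x => c * f x)).
Proof. exact: integrableZl. Qed.

End RealIntegrable.

Section AveragedForms.
Context {R : realType} {G : topologicalGroupType} {H : hilbertType R}.
Variables (pi : G -> {linear H -> H}) (b : G -> H).
Hypotheses (hpi : orthogonal_representation pi) (hb : cocycle pi b).
Variable mu : probability (borel G) R.
Hypothesis mom : has_moments b mu.
Hypothesis mu_sym : forall F : G -> R, continuous F ->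
  mu.-integrable setT (EFin \o (fun x : borel G => F (x^-1)%g)) ->
  \int[mu]_x F (x^-1)%g = \int[mu]_x F x.
Hypothesis harm : weakly_harmonic mu b.

Local Notation act := (affine_act pi b).
Local Notation M := (markov pi b mu).

Lemma form_polar C (B : H -> H -> R) u v : bounded_form C B ->
  B u v = 4^-1 * (B (u + v) (u + v) - B (u - v) (u - v)).
Proof. by move=> fB; rewrite (form_sqD fB) (form_sqB fB); field. Qed.

Lemma form_continuous C (B : H -> H -> R) (f g : G -> H) : bounded_form C B ->
  continuous f -> continuous g -> continuous (fun x => B (f x) (g x)).
Proof.
move=> fB cf cg.
under eq_fun do rewrite (form_polar _ _ fB).
have cB := form_sq_continuous fB.
move=> x; apply: cvgMl_tmp; apply: cvgB.
  apply: (cvg_comp (fun x => f x + g x) (fun u => B u u)); last exact: cB.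
  by apply: cvgD; [exact: cf|exact: cg].
apply: (cvg_comp (fun x => f x - g x) (fun u => B u u)); last exact: cB.
by apply: cvgB; [exact: cf|exact: cg].
Qed.

Lemma rep_form_integrable C (B : H -> H -> R) u v : bounded_form C B ->
  mu.-integrable setT (EFin \o (fun x : borel G => B (pi x u) (pi x v))).
Proof.
move=> fB; apply: (integrable_dominated mom (C := C * (`|u| * `|v|)) (k := 0)).
  by apply: (form_continuous fB); exact: (rep_continuous hpi).
by move=> x; rewrite expr0 mulr1 (le_trans (form_le fB _ _)) // !(rep_norm hpi).
Qed.

Lemma cocycle_rep_form_integrable C (B : H -> H -> R) v : bounded_form C B ->
  mu.-integrable setT (EFin \o (fun x : borel G => B (b x) (pi x v))).
Proof.
move=> fB; apply: (integrable_dominated mom (C := `|C| * `|v|) (k := 1)).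
  by apply: (form_continuous fB); [exact: (cocycle_continuous hb)|exact: (rep_continuous hpi)].
move=> x; rewrite expr1 (le_trans (form_le fB _ _)) // (rep_norm hpi) (mulrC `|b x|) mulrA.
apply: (@le_trans _ _ (`|C| * `|v| * `|b x|)); first by rewrite !ler_wpM2r // ler_norm.
by rewrite ler_wpM2l ?mulr_ge0 // /weight lerDr.
Qed.

Lemma functional_rep_integrable (C : R) (L : H -> R) v :
  (forall a u v, L (a *: u + v) = a * L u + L v) -> (forall u, `|L u| <= C * `|u|) ->
  mu.-integrable setT (EFin \o (fun x : borel G => L (pi x v))).
Proof.
move=> LP LC; apply: (integrable_dominated mom (C := C * `|v|) (k := 0)).
  move=> x; apply: (cvg_comp (fun x => pi x v) L); first exact: (rep_continuous hpi).
  exact: (polylip_continuous (polylip_functional LP LC)).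
by move=> x; rewrite expr0 mulr1 (le_trans (LC _)) // (rep_norm hpi).
Qed.

Lemma Rintegral_norm_le (F : G -> R) (K : R) :
  mu.-integrable setT (EFin \o (F : borel G -> R)) -> (forall x, `|F x| <= K) ->
  `|\int[mu]_x F x| <= K.
Proof.
move=> iF FK; rewrite (le_trans (le_normr_Rintegral _ _)) //.
rewrite -[leRHS](Rintegral_prob_cst pi b mu); apply: le_Rintegral => //.
- exact: (integrable_norm iF).
- exact: (finite_measure_integrable_cst mu).
Qed.

Definition average_form (B : H -> H -> R) u v : R := \int[mu]_x B (pi x u) (pi x v).

Lemma average_form_bounded C B : bounded_form C B -> bounded_form C (average_form B).
Proof.
move=> fB; split=> [u v|a u v w|u v].
- by congr (Rintegral _ _ _); apply/funext => x; rewrite (formC fB).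
- rewrite /average_form.
  under [X in Rintegral _ _ X]eq_fun do rewrite linearP (formP fB).
  rewrite RintegralD //; last exact: rep_form_integrable fB.
    by rewrite RintegralZl //; exact: rep_form_integrable fB.
  exact: (integrableZl measurableT a (rep_form_integrable u w fB)).
- apply: Rintegral_norm_le; first exact: rep_form_integrable fB.
  by move=> x; rewrite (le_trans (form_le fB _ _)) // !(rep_norm hpi).
Qed.

Lemma iter_average_form_bounded n C B : bounded_form C B ->
  bounded_form C (iter n average_form B).
Proof. by move=> fB; elim: n => // n; exact: average_form_bounded. Qed.

(** Harmonicity removes the constant L (b x) on average, so that the image is again a linear
    functional with the same bound. *)
Lemma markov_functional (C : R) (L : H -> R) :
  (forall a u v, L (a *: u + v) = a * L u + L v) -> (forall u, `|L u| <= C * `|u|) ->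
  (forall a u v, M L (a *: u + v) = a * M L u + M L v) /\ (forall u, `|M L u| <= C * `|u|).
Proof.
move=> LP LC; have iL v := functional_rep_integrable v LP LC.
have iLb := polylip_cocycle_integrable hpi hb mom (polylip_functional LP LC).
have ME v : M L v = \int[mu]_x L (pi x v).
  rewrite /markov; under [X in Rintegral _ _ X]eq_fun do rewrite (functionalD LP).
  by rewrite RintegralD // (functional_mean0 harm LP LC) add0r.
split=> [a u v|u]; rewrite !ME.
  under [X in Rintegral _ _ X]eq_fun do rewrite linearP LP.
  rewrite RintegralD ?RintegralZl //; first exact: (integrableZl measurableT a (iL u)).
by apply: Rintegral_norm_le => // x; rewrite (le_trans (LC _)) // (rep_norm hpi).
Qed.

Lemma iter_markov_functional0 n (C : R) (L : H -> R) :
  (forall a u v, L (a *: u + v) = a * L u + L v) -> (forall u, `|L u| <= C * `|u|) ->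
  iter n M L 0 = 0.
Proof.
elim: n L => [|n IH] L LP LC; first exact: functional0 LP.
have [MP MC] := markov_functional LP LC.
by rewrite iterSr; exact: IH.
Qed.

(** Expand A at b x + pi x v: the pure cocycle term joins the constant, the mixed term joins the
    linear part, and the remaining term is the averaged form. The linear part is left unspecified
    since it vanishes at 0, where the iterates will be evaluated. *)
Lemma markov_quadratic (c C C' : R) (L f : H -> R) (A : H -> H -> R) : bounded_form C A ->
  (forall a u v, L (a *: u + v) = a * L u + L v) -> (forall u, `|L u| <= C' * `|u|) ->
  (forall v, f v = c + L v + A v v) ->
  exists (D : R) (L' : H -> R), [/\ forall a u v, L' (a *: u + v) = a * L' u + L' v,
    forall u, `|L' u| <= D * `|u| &
    forall v, M f v = c + \int[mu]_x A (b x) (b x) + L' v + average_form A v v].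
Proof.
move=> fS LP LC fE.
have [MP MC] := markov_functional LP LC.
have iA v := cocycle_rep_form_integrable v fS.
have iAA v := rep_form_integrable v v fS.
have iAb := polylip_cocycle_integrable hpi hb mom (polylip_form fS).
have iL v := polylip_integrable hpi hb mom v (polylip_functional LP LC).
pose X v := \int[mu]_x A (b x) (pi x v).
exists (C' + 2 * (`|C| * \int[mu]_x weight (b x))), (fun v => M L v + 2 * X v).
have iW : mu.-integrable setT (EFin \o (fun x : borel G => weight (b x))).
  by have := mom 1; congr (mu.-integrable _ _); apply/funext => x /=; rewrite expr1.
split=> [a u v|u|v].
- rewrite MP /X; under [X in Rintegral _ _ X]eq_fun do rewrite linearP (formDr fS) (formZr fS).
  rewrite RintegralD ?RintegralZl //; first by ring.
  exact: (integrableZl measurableT a (iA u)).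
- rewrite (le_trans (ler_normD _ _)) // (mulrDl C') lerD // normrM ger0_norm // -mulrA.
  rewrite ler_pM2l // (le_trans (le_normr_Rintegral _ _)) // mulrAC -RintegralZl //.
  apply: le_Rintegral => //.
  + exact: (integrable_norm (iA u)).
  + exact: (integrableZl measurableT _ iW).
  move=> x _; rewrite (le_trans (form_le fS _ _)) // (rep_norm hpi) (mulrC `|b x|) mulrA.
  apply: (@le_trans _ _ (`|C| * `|u| * `|b x|)); first by rewrite !ler_wpM2r // ler_norm.
  by rewrite ler_wpM2l ?mulr_ge0 // /weight lerDr.
rewrite [LHS]/markov.
have E x : f (act x v) = (c + L (act x v)) + (A (b x) (b x) + 2 * A (b x) (pi x v)
    + A (pi x v) (pi x v)).
  by rewrite fE /affine_act (form_sqD fS).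
under [X in Rintegral _ _ X]eq_fun do rewrite E.
have ic := finite_measure_integrable_cst mu c (@measurableT _ (borel G)).
have ic2 : mu.-integrable setT (EFin \o (fun _ : borel G => c)) := ic.
have i1 := integrable_add ic2 (iL v).
have i2 := integrable_add iAb (integrable_scale 2 (iA v)).
have i3 := integrable_add i2 (iAA v).
rewrite (RintegralD measurableT i1 i3) (RintegralD measurableT ic2 (iL v)).
rewrite (RintegralD measurableT i2 (iAA v)).
rewrite (RintegralD measurableT iAb (integrable_scale 2 (iA v))).
rewrite (RintegralZl 2 measurableT (iA v)) (Rintegral_prob_cst pi b).
by rewrite /= /average_form /X /markov; ring.
Qed.

Lemma iter_markov_quadratic n C (B : H -> H -> R) : bounded_form C B ->
  exists (D : R) (L : H -> R), [/\ forall a u v, L (a *: u + v) = a * L u + L v,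
    forall u, `|L u| <= D * `|u| &
    forall v, iter n M (fun u => B u u) v =
      \sum_(j < n) \int[mu]_x iter j average_form B (b x) (b x) + L v +
      iter n average_form B v v].
Proof.
move=> fB; elim: n => [|n [D [L [LP LC fE]]]].
  exists 0, (fun=> 0); split=> [a _ _|u|v]; rewrite ?mulr0 ?addr0 ?normr0 ?mul0r //.
  by rewrite big_ord0 !add0r.
have [D' [L' [L'P L'C f'E]]] :=
  markov_quadratic (iter_average_form_bounded n fB) LP LC fE.
by exists D', L'; split=> // v; rewrite big_ord_recr; exact: f'E.
Qed.

(* The cross terms between different increments vanish by harmonicity, although
   the form is not invariant. *)
Lemma iter_markov_form n C (B : H -> H -> R) : bounded_form C B ->
  iter n M (fun u => B u u) 0 = \sum_(j < n) \int[mu]_x iter j average_form B (b x) (b x).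
Proof.
move=> fB; have [D [L [LP LC ->]]] := iter_markov_quadratic n fB.
by rewrite (functional0 LP) (form0l (iter_average_form_bounded n fB)) !addr0.
Qed.

Definition covariance_form u v : R := \int[mu]_x (inner (b x) u * inner (b x) v).

Local Notation sigma2 := (\int[mu]_x `|b x| ^+ 2).

Lemma normsq_integrable : mu.-integrable setT (EFin \o (fun x : borel G => `|b x| ^+ 2)).
Proof.
have := polylip_cocycle_integrable hpi hb mom (polylip_form inner_form).
by congr (mu.-integrable _ _); apply/funext => x /=; rewrite normr_inner.
Qed.

Lemma polylip_inner u : polylip (fun w : H => inner w u).
Proof.
have [L1 L2] := form_functional u (@inner_form R H).
exact: (polylip_functional L1 L2).
Qed.

Lemma covariance_integrable u v :
  mu.-integrable setT (EFin \o (fun x : borel G => inner (b x) u * inner (b x) v)).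
Proof.
exact: (polylip_cocycle_integrable hpi hb mom (polylipM (polylip_inner u) (polylip_inner v))).
Qed.

Lemma covariance_form_bounded : bounded_form sigma2 covariance_form.
Proof.
split=> [u v|a u v w|u v].
- by congr (Rintegral _ _ _); apply/funext => x; rewrite mulrC.
- have E x : inner (b x) (a *: u + v) * inner (b x) w =
      a * (inner (b x) u * inner (b x) w) + inner (b x) v * inner (b x) w.
    by rewrite innerDr innerZr; ring.
  rewrite /covariance_form; under [X in Rintegral _ _ X]eq_fun do rewrite E.
  rewrite RintegralD ?RintegralZl //; try exact: covariance_integrable.
  exact: (integrableZl measurableT a (covariance_integrable u w)).
- rewrite (le_trans (le_normr_Rintegral _ _)) //; first exact: covariance_integrable.
  rewrite mulrC -RintegralZl //; last exact: normsq_integrable.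
  apply: le_Rintegral => //.
  + exact: (integrable_norm (covariance_integrable u v)).
  + exact: (integrableZl measurableT _ normsq_integrable).
  move=> x _; rewrite normrM.
  rewrite [leRHS](_ : _ = (`|b x| * `|u|) * (`|b x| * `|v|)); last ring.
  by rewrite ler_pM // cauchy_schwarz.
Qed.

Local Notation B_ n := (iter n average_form covariance_form).

Lemma covariance_bounded n : bounded_form sigma2 (B_ n).
Proof. exact: iter_average_form_bounded covariance_form_bounded. Qed.

Lemma covariance_ge0 n u : 0 <= B_ n u u.
Proof.
elim: n u => [|n IH] u /=; apply: Rintegral_ge0 => x _; last exact: IH.
by rewrite -expr2 sqr_ge0.
Qed.

Lemma onb_map x (e : seq H) : onb e -> onb [seq pi x c | c <- e].
Proof.
elim: e => //= c e IH [c1 ce oe]; split; [by rewrite (rep_inner hpi)| |exact: IH].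
by move=> _ /mapP[v ve ->]; rewrite (rep_inner hpi) ce.
Qed.

(** For the covariance form this is Bessel's inequality under the integral; averaging keeps the
    bound because pi maps orthonormal families to orthonormal families. *)
Lemma covariance_trace n (e : seq H) : onb e -> \sum_(c <- e) B_ n c c <= sigma2.
Proof.
elim: n e => [|n IH] e oe /=.
  have [i1 <-] := Rintegral_sum_seq e (fun c => covariance_integrable c c).
  apply: le_Rintegral => //; first exact: normsq_integrable.
  by move=> x _; under eq_bigr do rewrite -expr2; exact: bessel.
have [i1 <-] := Rintegral_sum_seq e
  (fun c => rep_form_integrable c c (covariance_bounded n)).
rewrite -[leRHS](Rintegral_prob_cst pi b mu); apply: le_Rintegral => //.
  exact: (finite_measure_integrable_cst mu).
by move=> x _; have := IH _ (onb_map x oe); rewrite big_map.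
Qed.

Local Notation c_ j := (\int[mu]_x B_ j (b x) (b x)).
Local Notation tau4 := (\int[mu]_x (inner (b x) (b x) * inner (b x) (b x))).

Lemma covariance_correlation_ge0 j : 0 <= c_ j.
Proof. by apply: Rintegral_ge0 => x _; exact: covariance_ge0. Qed.

Lemma Rintegral_normsq : \int[mu]_x inner (b x) (b x) = sigma2.
Proof. by congr (Rintegral _ _ _); apply/funext => x; rewrite normr_inner. Qed.

Let sqn (u : H) := inner u u.

Lemma polylip_sqn : polylip sqn.
Proof. exact: polylip_form inner_form. Qed.

(** The cubic term of the fourth power has no reason to vanish, but it is linear in [u], so that its
    iterates vanish at 0. *)
Lemma cubic_functional : let l := fun u => \int[mu]_x (sqn (b x) * inner (b x) u) in
  exists C : R, (forall a u v, l (a *: u + v) = a * l u + l v) /\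
    (forall u, `|l u| <= C * `|u|).
Proof.
move=> l; pose N (w : H) := `|w| * sqn w.
have pN : polylip N by apply: polylipM; [exact: polylip_norm|exact: polylip_sqn].
have iN := polylip_cocycle_integrable hpi hb mom pN.
have il u := polylip_cocycle_integrable hpi hb mom (polylipM polylip_sqn (polylip_inner u)).
exists (\int[mu]_x N (b x)); split=> [a u v|u].
  have E x : sqn (b x) * inner (b x) (a *: u + v) =
      a * (sqn (b x) * inner (b x) u) + sqn (b x) * inner (b x) v.
    by rewrite innerDr innerZr; ring.
  rewrite /l; under [X in Rintegral _ _ X]eq_fun do rewrite E.
  rewrite RintegralD ?RintegralZl //.
  exact: (integrableZl measurableT a (il u)).
rewrite (le_trans (le_normr_Rintegral _ _)) // mulrC -RintegralZl //.
apply: le_Rintegral => //.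
- exact: (integrable_norm (il u)).
- exact: (integrableZl measurableT _ iN).
move=> x _; rewrite normrM (ger0_norm (inner_ge0 _)) /N.
rewrite [leRHS](_ : _ = sqn (b x) * (`|b x| * `|u|)); last ring.
by rewrite ler_wpM2l ?inner_ge0 // cauchy_schwarz.
Qed.

(** The norm of x.u is that of u - b (x^-1), and x^-1 has the law of x: it remains to expand |u - b
    x|^4 and integrate. The term of degree 1 in b x disappears by harmonicity. *)
Lemma markov_fourth u : M (fun v => sqn v * sqn v) u =
  sqn u * sqn u + (2 * sigma2) * sqn u + tau4 + 4 * covariance_form u u
  + (- 4) * \int[mu]_x (sqn (b x) * inner (b x) u).
Proof.
pose p1 w := inner w u * inner w u; pose p2 w := sqn w * inner w u.
pose p3 w := sqn w * sqn w; pose p4 w := inner w u.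
have pp1 : polylip p1 := polylipM (polylip_inner u) (polylip_inner u).
have pp2 : polylip p2 := polylipM polylip_sqn (polylip_inner u).
have pp3 : polylip p3 := polylipM polylip_sqn polylip_sqn.
have pp4 : polylip p4 := polylip_inner u.
pose p w := (sqn u * sqn u + (2 * sqn u) * sqn w) + (p3 w + (4 * p1 w + ((- 4) * p2 w + (- 4 * sqn u) * p4 w))).
have q1 : polylip (fun w => (2 * sqn u) * sqn w) := polylipZ _ polylip_sqn.
have q2 : polylip (fun w => sqn u * sqn u + (2 * sqn u) * sqn w) := polylipD (polylip_cst _) q1.
have q3 : polylip (fun w => (- 4) * p2 w + (- 4 * sqn u) * p4 w) :=
  polylipD (polylipZ _ pp2) (polylipZ _ pp4).
have q4 : polylip (fun w => 4 * p1 w + ((- 4) * p2 w + (- 4 * sqn u) * p4 w)) :=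
  polylipD (polylipZ _ pp1) q3.
have q5 : polylip (fun w => p3 w + (4 * p1 w + ((- 4) * p2 w + (- 4 * sqn u) * p4 w))) :=
  polylipD pp3 q4.
have pp : polylip p := polylipD q2 q5.
have E x : sqn (act x u) * sqn (act x u) = p (b (x^-1)%g).
  rewrite /sqn -normr_inner (act_normV hpi hb) normr_sqB !normr_inner.
  by rewrite (innerC u) /p /p1 /p2 /p3 /p4 /sqn; ring.
rewrite /markov; under [X in Rintegral _ _ X]eq_fun do rewrite E.
rewrite (Rintegral_cocycleV hpi hb mom mu_sym pp).
have int f pf := @polylip_cocycle_integrable _ _ _ _ _ hpi hb mu mom f pf.
rewrite /p (RintegralD measurableT (int _ q2) (int _ q5)).
rewrite (RintegralD measurableT (int _ (polylip_cst _)) (int _ q1)).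
rewrite (RintegralD measurableT (int _ pp3) (int _ q4)).
rewrite (RintegralD measurableT (int _ (polylipZ 4 pp1)) (int _ q3)).
rewrite (RintegralD measurableT (int _ (polylipZ _ pp2)) (int _ (polylipZ _ pp4))).
rewrite (RintegralZl _ measurableT (int _ polylip_sqn)) (RintegralZl _ measurableT (int _ pp1)).
rewrite (RintegralZl _ measurableT (int _ pp2)) (RintegralZl _ measurableT (int _ pp4)).
have [L1 L2] := form_functional u (@inner_form R H).
rewrite (functional_mean0 harm L1 L2) Rintegral_normsq (Rintegral_prob_cst pi b).
rewrite /covariance_form /p1 /p2 /p3; ring.
Qed.

(** The correlations enter through the covariance term of [markov_fourth]: the form is not
    invariant, and [iter_markov_form] gives its mean after n steps. *)
Lemma fourth_moment_recursion n : iter n.+1 M (fun v => sqn v * sqn v) 0 =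
  iter n M (fun v => sqn v * sqn v) 0 + (2 * sigma2) * (n%:R * sigma2) + tau4
  + 4 * \sum_(j < n) c_ j.
Proof.
have [C [lP lC]] := cubic_functional.
have -> : iter n.+1 M (fun v => sqn v * sqn v) 0 = iter n M (fun u =>
    sqn u * sqn u + (2 * sigma2) * sqn u + tau4 + 4 * covariance_form u u
    + (- 4) * \int[mu]_x (sqn (b x) * inner (b x) u)) 0.
  by rewrite iterSr; congr (iter n M _ _); apply/funext => u; exact: markov_fourth.
have p1 : polylip (fun v => sqn v * sqn v) := polylipM polylip_sqn polylip_sqn.
have p2 : polylip (fun v => (2 * sigma2) * sqn v) := polylipZ _ polylip_sqn.
have p3 := polylip_form covariance_form_bounded.
have p4 := polylip_functional lP lC.
have p12 := polylipD p1 p2; have p12c := polylipD p12 (polylip_cst tau4).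
rewrite (iter_markovD hpi hb mom); [|exact: (polylipD p12c (polylipZ 4 p3))|exact: (polylipZ (- 4) p4)].
rewrite (iter_markovD hpi hb mom n p12c (polylipZ 4 p3)).
rewrite (iter_markovD hpi hb mom n p12 (polylip_cst tau4)) (iter_markovD hpi hb mom n p1 p2).
rewrite !(iter_markovZ hpi hb mom) //; last exact: polylip_sqn.
rewrite iter_markov_cst (iter_markov_functional0 n lP lC) mulr0 addr0.
rewrite (form_second_moment hpi hb mom mu_sym harm n inner_form); last first.
  by move=> x u v; rewrite (rep_inner hpi).
by rewrite Rintegral_normsq (iter_markov_form n covariance_form_bounded).
Qed.

(** As the c_j are nonnegative, each partial sum in the recursion is at most the last one, whence
    the factor n; and 2 n sigma2^2 is at most ((n + 1)^2 - n^2) sigma2^2. *)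
Lemma fourth_moment_bound n : iter n M (fun v => sqn v * sqn v) 0 - n%:R ^+ 2 * sigma2 ^+ 2 <=
  n%:R * tau4 + 4 * (n%:R * \sum_(j < n) c_ j).
Proof.
elim: n => [|n IH]; first by rewrite /= /sqn inner0l !mul0r expr0n /= mul0r !subr0 !mulr0 addr0.
rewrite fourth_moment_recursion big_ord_recr /= -(natr1 n).
have key (t cc s t4 S I : R) : 0 <= t * cc -> 0 <= cc -> 0 <= s ^+ 2 ->
    I - t ^+ 2 * s ^+ 2 <= t * t4 + 4 * (t * S) ->
    I + 2 * s * (t * s) + t4 + 4 * S - (t + 1) ^+ 2 * s ^+ 2 <=
    (t + 1) * t4 + 4 * ((t + 1) * (S + cc)).
  by move=> h1 h2 h3 h4; lra.
apply: key IH; [|exact: covariance_correlation_ge0|exact: sqr_ge0].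
by rewrite mulr_ge0 // covariance_correlation_ge0.
Qed.

Lemma variance_bound n :
  iter n M (fun u => (sqn u - n%:R * sigma2) * (sqn u - n%:R * sigma2)) 0 <=
  n%:R * tau4 + 4 * (n%:R * \sum_(j < n) c_ j).
Proof.
apply: le_trans (fourth_moment_bound n).
have -> : (fun u => (sqn u - n%:R * sigma2) * (sqn u - n%:R * sigma2)) =
    (fun u => sqn u * sqn u + (- (2 * (n%:R * sigma2))) * sqn u + (n%:R * sigma2) ^+ 2).
  by apply/funext => u; ring.
have p1 : polylip (fun v => sqn v * sqn v) := polylipM polylip_sqn polylip_sqn.
have p2 : polylip (fun v => (- (2 * (n%:R * sigma2))) * sqn v) := polylipZ _ polylip_sqn.
rewrite (iter_markovD hpi hb mom n (polylipD p1 p2) (polylip_cst _)).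
rewrite (iter_markovD hpi hb mom n p1 p2) (iter_markovZ hpi hb mom) ?iter_markov_cst; last exact: polylip_sqn.
rewrite (form_second_moment hpi hb mom mu_sym harm n inner_form); last first.
  by move=> x u v; rewrite (rep_inner hpi).
rewrite Rintegral_normsq le_eqVlt; apply/orP; left; apply/eqP; ring.
Qed.

End AveragedForms.

Lemma cvg_sum_seq (R : realType) (T I : Type) (U : set_system T) (r : seq I)
  (F : T -> I -> R) (l : I -> R) : Filter U -> (forall i, F ^~ i @ U --> l i) ->
  (fun t => \sum_(i <- r) F t i) @ U --> \sum_(i <- r) l i.
Proof.
move=> FU Fl; elim: r => [|i r IH].
  by under eq_fun do rewrite big_nil; rewrite big_nil; exact: cvg_cst.
by under eq_fun do rewrite big_cons; rewrite big_cons; exact: cvgD.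
Qed.

Lemma bounded_form_sum (R : realType) (H : hilbertType R) (I : Type) (r : seq I)
  (C c : R) (F : I -> H -> H -> R) : 0 <= c -> (forall i, bounded_form C (F i)) ->
  bounded_form (c * (C *+ size r)) (fun u v => c * \sum_(i <- r) F i u v).
Proof.
move=> c0 fF; split=> [u v|a u v w|u v].
- by congr (_ * _); apply: eq_bigr => i _; rewrite (formC (fF i)).
- under eq_bigr do rewrite (formP (fF _)).
  by rewrite big_split /= -mulr_sumr; ring.
rewrite normrM ger0_norm // -mulrA ler_wpM2l //.
apply: (@le_trans _ _ (\sum_(i <- r) C * (`|u| * `|v|))).
  apply: le_trans (ler_norm_sum _ _ _) _.
  by apply: ler_sum => i _; exact: form_le.
by rewrite big_const_seq count_predT iter_addr_0 mulrnAl.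
Qed.

(** * Ultralimits of forms and their integrals *)

Section WeakMixing.
Context {R : realType} {G : topologicalGroupType} {H : hilbertType R}.
Variables (Q : set G) (hQ : generating_neighborhood Q).
Variables (pi : G -> {linear H -> H}) (b : G -> H).
Hypotheses (hpi : orthogonal_representation pi) (hb : cocycle pi b).
Variable mu : probability (borel G) R.
Hypothesis mom : has_moments b mu.
Hypothesis mu_sym : forall F : G -> R, continuous F ->
  mu.-integrable setT (EFin \o (fun x : borel G => F (x^-1)%g)) ->
  \int[mu]_x F (x^-1)%g = \int[mu]_x F x.
Hypothesis harm : weakly_harmonic mu b.
Hypothesis mu_open : forall O : set G, open O -> O !=set0 -> O `<=` Q -> (0 < mu O)%E.

(** If h were positive at a point of [O], it would exceed half of this value on a nonempty open
    subset of [Q], which mu charges. *)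
Lemma vanishing_integral (h : G -> R) (O : set G) : continuous h -> (forall x, 0 <= h x) ->
  mu.-integrable setT (EFin \o (h : borel G -> R)) -> \int[mu]_x h x = 0 ->
  open O -> O `<=` Q -> forall x, O x -> h x = 0.
Proof.
move=> ch h0 ih ih0 oO OQ x Ox; apply: contrapT => /eqP hx.
have hx0 : 0 < h x by rewrite lt_neqAle eq_sym hx h0.
pose t := h x / 2; have t0 : 0 < t by rewrite divr_gt0.
pose O' := O `&` h @^-1` [set y | t < y].
have oO' : open O'.
  by apply: openI => //; move/continuousP: ch; apply; exact: open_gt.
have mO' : measurable (O' : set (borel G)) by exact: borel_open.
have : (0 < mu O')%E.
  apply: mu_open => //; last by move=> y [/OQ].
  by exists x; split=> //=; rewrite /t ltr_pdivrMr // mulrC mulr2n mulrDl mul1r ltrDl.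
have i1 : mu.-integrable setT (EFin \o (fun y : borel G => t * \1_O' y)).
  exact: (integrable_scale t (integrable_indic mu mO')).
have : \int[mu]_y (t * \1_O' y) <= \int[mu]_y h y.
  apply: le_Rintegral => // y _; rewrite indicE; have [yO|yO] := boolP (y \in O').
    by rewrite mulr1; move: yO; rewrite inE => -[_ /= /ltW].
  by rewrite mulr0.
rewrite ih0 RintegralZl //; last exact: integrable_indic.
rewrite pmulr_rle0 // /Rintegral integral_indic // setIT.
have fO : mu O' \is a fin_num by exact: fin_num_measure.
by move=> f0; rewrite -(fineK fO) lte_fin ltNge f0.
Qed.

Section Ultralimit.
Variables (U : set_system nat) (UU : UltraFilter U).
Variables (A : nat -> H -> H -> R) (C : R).
Hypotheses (fA : forall n, bounded_form C (A n)).

Lemma ultralimit_ex : exists q : H -> H -> R, forall u v, (fun n => A n u v) @ U --> q u v.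
Proof.
have ex u v : exists l : R, (fun n => A n u v) @ U --> l.
  by apply: (ultra_cvg (M := C * (`|u| * `|v|)) UU) => n; exact: form_le.
by exists (fun u v => projT1 (cid (ex u v))) => u v; case: (cid (ex u v)).
Qed.

Variable q : H -> H -> R.
Hypothesis qP : forall u v, (fun n => A n u v) @ U --> q u v.

Lemma ultralimit_unique (f : nat -> R) (l l' : R) : f @ U --> l -> f @ U --> l' -> l = l'.
Proof. by have PU := @ultra_proper _ _ UU; exact: cvg_unique. Qed.

Lemma ultralimit_form : bounded_form C q.
Proof.
have PU := @ultra_proper _ _ UU.
split=> [u v|a u v w|u v].
- apply: (@ultralimit_unique (fun n => A n u v)); first exact: qP.
  by under eq_fun do rewrite (formC (fA _)); exact: qP.
- apply: (@ultralimit_unique (fun n => A n (a *: u + v) w)); first exact: qP.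
  under eq_fun do rewrite (formP (fA _)).
  by apply: cvgD; [apply: cvgMl_tmp|]; exact: qP.
have h1 : (fun n => `|A n u v|) @ U --> `|q u v| by apply: cvg_norm; exact: qP.
have h2 : (fun _ : nat => C * (`|u| * `|v|)) @ U --> C * (`|u| * `|v|) by exact: cvg_cst.
apply: (ler_cvg_to h1 h2).
by apply: nearW => n; exact: form_le.
Qed.

Lemma ultralimit_ge0 u : (forall n, 0 <= A n u u) -> 0 <= q u u.
Proof.
have PU := @ultra_proper _ _ UU.
have h2 : (fun _ : nat => (0 : R)) @ U --> (0 : R) by exact: cvg_cst.
have h1 : (fun n => A n u u) @ U --> q u u by exact: qP.
move=> A0; apply: (ler_cvg_to h2 h1).
exact: nearW.
Qed.

Lemma ultralimit_trace (S : R) (e : seq H) : (forall n, \sum_(c <- e) A n c c <= S) ->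
  \sum_(c <- e) q c c <= S.
Proof.
have PU := @ultra_proper _ _ UU.
move=> AS; have cs : (fun n => \sum_(c <- e) A n c c) @ U --> \sum_(c <- e) q c c.
  by apply: cvg_sum_seq => c; exact: qP.
have h2 : (fun _ : nat => S) @ U --> S by exact: cvg_cst.
apply: (ler_cvg_to cs h2).
exact: nearW.
Qed.

(* Limits along an ultrafilter do not commute with integrals in general; here
   the forms are equi-Lipschitz on bounded sets and phi is separably valued. *)
Lemma ultralimit_integral (phi : G -> H) : continuous phi ->
  mu.-integrable setT (EFin \o (fun x : borel G => `|phi x| ^+ 2)) ->
  (fun n => \int[mu]_x A n (phi x) (phi x)) @ U --> \int[mu]_x q (phi x) (phi x).
Proof.
move=> cphi iphi; have PU := @ultra_proper _ _ UU; have fq := ultralimit_form.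
have iform (B : H -> H -> R) : bounded_form C B ->
    mu.-integrable setT (EFin \o (fun x : borel G => B (phi x) (phi x))).
  move=> fB; apply: (le_integrable _ _ _ (integrable_scale C iphi)) => //.
    apply/measurable_EFinP; apply: continuous_borel_fun.
    exact: (form_continuous fB cphi cphi).
  move=> x _ /=; rewrite lee_fin expr2 (le_trans (form_le fB _ _)) //; exact: ler_norm.
pose I2 := \int[mu]_x `|phi x| ^+ 2.
have I20 : 0 <= I2 by apply: Rintegral_ge0 => x _; exact: sqr_ge0.
pose K := `|C|.
have K0 : 0 <= K by exact: normr_ge0.
have formK (F : H -> H -> R) u : bounded_form C F -> `|F u u| <= K * `|u| ^+ 2.
  move=> fB; rewrite (le_trans (form_le fB u u)) // -expr2.
  by apply: ler_wpM2r; [exact: sqr_ge0|exact: ler_norm].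
have distK (F : H -> H -> R) u v : bounded_form C F ->
    `|F u u - F v v| <= K * (`|u - v| * (`|u| + `|v|)).
  move=> fB; rewrite (le_trans (form_dist fB u v)) //.
  by apply: ler_wpM2r; [rewrite mulr_ge0 // addr_ge0|exact: ler_norm].
apply/cvgrPdist_le => eps eps0.
(* This dominates the coefficient of eta in the final estimate, once eta^2 is replaced by eta. *)
pose Z := 1 + 2 * K * (3 + I2) + 2 * K.
have Z0 : 0 < Z by rewrite /Z; have := mulr_ge0 K0 I20; lra.
pose eta := Num.min 1 (eps / Z).
have eta0 : 0 < eta by rewrite lt_min ltr01 divr_gt0.
have eta1 : eta <= 1 by rewrite ge_min lexx.
have etaZ : eta * Z <= eps by rewrite -ler_pdivlMr // ge_min lexx orbT.
have [xs [D [mD iD xsP]]] := finite_net_tail hQ cphi (fun x => sqr_ge0 `|phi x|) iphi eta0 eta0.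
have nearxs : U [set n | forall y, y \in xs -> `|q (phi y) (phi y) - A n (phi y) (phi y)| <= eta].
  elim: (xs) => [|y ys IH]; first by apply: filterS (@filterT _ U _).
  have := @qP (phi y) (phi y); move/cvgrPdist_le => /(_ _ eta0) hy.
  apply: filterS2 hy IH => n /= ny nys z; rewrite inE => /orP[/eqP ->//|]; exact: nys.
apply: filterS nearxs => n /= nP.
have iq := iform _ fq; have iA := iform _ (fA n).
have iqA : mu.-integrable setT (EFin \o (fun x : borel G => q (phi x) (phi x) - A n (phi x) (phi x))).
  exact: (integrableB measurableT iq iA).
rewrite -RintegralB // (le_trans (le_normr_Rintegral _ _)) //.
have mD1 : mu.-integrable setT (EFin \o (fun x : borel G => `|phi x| ^+ 2 * \1_D x)).
  apply: (le_integrable _ _ _ iphi) => //.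
    have [mp _] := integrableP _ _ _ iphi.
    apply/measurable_EFinP; apply: measurable_funM; last exact: measurable_indic.
    exact/measurable_EFinP.
  move=> x _ /=; rewrite lee_fin normrM ler_piMr // indicE.
  by case: (_ \in _); rewrite ?normr1 ?normr0.
pose c1 := eta + 2 * K * eta * (1 + eta).
have ic : mu.-integrable setT (EFin \o (fun _ : borel G => c1)).
  exact: (finite_measure_integrable_cst mu).
have i1 := integrable_scale (2 * K * eta) iphi; have i2 := integrable_scale (2 * K) mD1.
have i3 := integrable_add ic i1.
apply: (@le_trans _ _ (\int[mu]_x ((c1 + 2 * K * eta * `|phi x| ^+ 2) + 2 * K * (`|phi x| ^+ 2 * \1_D x)))).
  apply: le_Rintegral => //; first exact: (integrable_norm iqA).
    exact: (integrable_add i3 i2).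
  move=> x _; have p0 := sqr_ge0 `|phi x|.
  have c10 : 0 <= c1 by rewrite /c1 addr_ge0 ?mulr_ge0 ?addr_ge0 // ltW.
  have k0 : 0 <= 2 * K * eta * `|phi x| ^+ 2 by rewrite !mulr_ge0 // ltW.
  rewrite indicE; have [xD|xD] := boolP (x \in D).
    rewrite mulr1 (le_trans (ler_normB _ _)) //.
    have h1 := formK _ (phi x) fq; have h2 := formK _ (phi x) (fA n).
    by apply: le_trans (lerD h1 h2) _; lra.
  rewrite !mulr0 addr0; have [|y yxs xy] := xsP x; first by rewrite notin_setE in xD.
  have h1 := distK _ (phi x) (phi y) fq; have h2 := distK _ (phi x) (phi y) (fA n).
  have h3 := nP y yxs.
  have yx : `|phi y| <= `|phi x| + eta.
    rewrite -[phi y](subKr (phi x)) (le_trans (ler_normB _ _)) // lerD2l ltW //.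
  (* From 2 |phi x| <= 1 + |phi x|^2, so that only the second moment of phi is needed. *)
  have h4 : `|phi x - phi y| * (`|phi x| + `|phi y|) <= eta * (1 + `|phi x| ^+ 2 + eta).
    apply: ler_pM; [by []|by rewrite addr_ge0|exact: ltW|].
    have h := sqr_ge0 (`|phi x| - 1); lra.
  have h5 : K * (`|phi x - phi y| * (`|phi x| + `|phi y|)) <= K * (eta * (1 + `|phi x| ^+ 2 + eta)).
    exact: ler_wpM2l.
  have -> : q (phi x) (phi x) - A n (phi x) (phi x) =
     (q (phi x) (phi x) - q (phi y) (phi y)) + (q (phi y) (phi y) - A n (phi y) (phi y))
     - (A n (phi x) (phi x) - A n (phi y) (phi y)) by ring.
  apply: le_trans (ler_normB _ _) _.
  apply: le_trans (lerD (ler_normD _ _) (lexx _)) _.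
  rewrite /c1; lra.
rewrite (RintegralD measurableT i3 i2) (RintegralD measurableT ic i1).
rewrite (RintegralZl _ measurableT iphi) (RintegralZl _ measurableT mD1).
rewrite (Rintegral_prob_cst pi b) -/I2 /c1.
have h6 : 2 * K * \int[mu]_x (`|phi x| ^+ 2 * \1_D x) <= 2 * K * eta.
  by rewrite ler_wpM2l ?mulr_ge0 // ltW.
have h7 : 2 * K * eta * eta <= 2 * K * eta by rewrite ler_piMr // !mulr_ge0 // ltW.
have h8 : 0 <= K * eta by rewrite mulr_ge0 // ltW.
apply: le_trans etaZ; rewrite /Z; lra.
Qed.

End Ultralimit.

End WeakMixing.

(** * Cocycles in a space without finite-dimensional invariant subspaces *)

Section NoFiniteDimensionalPart.
Context {R : realType} {G : topologicalGroupType} {H : hilbertType R}.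
Variables (Q : set G) (hQ : generating_neighborhood Q).
Variables (pi : G -> {linear H -> H}) (b : G -> H).
Hypotheses (hpi : orthogonal_representation pi) (hb : cocycle pi b).
Variable mu : probability (borel G) R.
Hypothesis mom : has_moments b mu.
Hypothesis mu_sym : forall F : G -> R, continuous F ->
  mu.-integrable setT (EFin \o (fun x : borel G => F (x^-1)%g)) ->
  \int[mu]_x F (x^-1)%g = \int[mu]_x F x.
Hypothesis harm : weakly_harmonic mu b.
Hypothesis mu_open : forall O : set G, open O -> O !=set0 -> O `<=` Q -> (0 < mu O)%E.

Variables (W : set H) (cW : closed_subspace W).
Hypotheses (piW : forall g v, W v -> W (pi g v)) (bW : forall x, W (b x)).
Hypothesis noW : forall e : seq H, onb e -> e <> [::] -> [set` e] `<=` W ->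
  ~ (forall x u, linear_span [set` e] u -> linear_span [set` e] (pi x u)).

Local Notation M := (markov pi b mu).
Local Notation sigma2 := (\int[mu]_x `|b x| ^+ 2).
Local Notation B_ n := (iter n (average_form pi mu) (covariance_form b mu)).
Local Notation c_ j := (\int[mu]_x B_ j (b x) (b x)).

Lemma bounded_form_weaken C C' (B : H -> H -> R) : C <= C' -> bounded_form C B ->
  bounded_form C' B.
Proof.
move=> CC' fB; split; [exact: formC fB|exact: formP fB|move=> u v].
by rewrite (le_trans (form_le fB u v)) // ler_wpM2r // mulr_ge0.
Qed.

(** The maximum principle works at the points of an open subset of [Q]; the symmetry of this subset
    then gives stability under inverses too. *)
Lemma generating_symmetric_open : exists O : set G,
  [/\ open O, O `<=` Q, forall x, O x -> O (x^-1)%g & generates O].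
Proof.
have [S0 [oO _ OQ gO]] := gn_open hQ.
exists (S0 `|` (fun x => (x^-1)%g) @^-1` S0); split.
- by apply: openU => //; move/continuousP: (@invg_continuous G); apply.
- move=> x [/OQ //|/= /OQ /(gn_symmetric hQ)]; by rewrite invgK.
- by move=> x [Ox|/= Ox]; [right; rewrite /= invgK|left].
- by move=> K K1 KM OK; apply: gO => // x Ox; apply: OK; left.
Qed.

(** Otherwise b vanishes on an open generating subset of [Q], and then everywhere because its zero
    set is a subgroup. *)
Lemma sigma2_gt0 : (exists x, b x <> 0) -> 0 < sigma2.
Proof.
move=> [x bx]; rewrite lt_neqAle; apply/andP; split; last first.
  by apply: Rintegral_ge0 => y _; exact: sqr_ge0.
apply/eqP => s0; apply: bx.
have [S0 [oO OQ OV gO]] := generating_symmetric_open.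
apply: (cocycle_invariant hpi hb gO) => y Oy; apply/eqP; rewrite -normr_eq0 -sqrf_eq0; apply/eqP.
apply: (vanishing_integral mu_open (h := fun y => `|b y| ^+ 2) (O := S0)) => //.
- move=> z; apply: (cvg_comp (fun y => `|b y|) (fun t : R => t ^+ 2)); last exact: exprn_continuous.
  by apply: cvg_norm; exact: (cocycle_continuous hb).
- exact: (normsq_integrable hpi hb mom).
Qed.

Lemma projW_rep x u : orthogonal_projection W (pi x u) = pi x (orthogonal_projection W u).
Proof.
apply: orthogonal_projection_eq => //.
  by apply: piW; exact: orthogonal_projection_in.
move=> z Wz; rewrite -linearB (rep_adjoint hpi).
by apply: orthogonal_projection_orth => //; exact: piW.
Qed.

(** As b takes its values in the invariant subspace [W], the forms ignore the orthogonal complement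
    of [W]. This will confine the top eigenvectors of the limit to [W]. *)
Lemma covariance_projW n u :
  B_ n (orthogonal_projection W u) (orthogonal_projection W u) = B_ n u u.
Proof.
elim: n u => [|n IH] u /=.
  rewrite /covariance_form; congr (Rintegral _ _ _); apply/funext => x.
  by rewrite -!(innerC (orthogonal_projection W u)) orthogonal_projection_inner // (innerC u).
by rewrite /average_form; congr (Rintegral _ _ _); apply/funext => x; rewrite -projW_rep IH.
Qed.

(** At n = 0 the inverse is 0 and the form vanishes, so that the bounds below hold for all n. *)
Definition cesaro_form n u v : R := n%:R^-1 * \sum_(j <- index_iota 0 n) B_ j u v.

Lemma sigma2_ge0 : 0 <= sigma2.
Proof. by apply: Rintegral_ge0 => y _; exact: sqr_ge0. Qed.

Lemma cesaro_form_bounded n : bounded_form sigma2 (cesaro_form n).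
Proof.
apply: (bounded_form_weaken (C := n%:R^-1 * (sigma2 *+ size (index_iota 0 n)))).
  rewrite size_iota subn0; case: n => [|n]; first by rewrite invr0 mul0r sigma2_ge0.
  by rewrite -(mulr_natl sigma2) mulKf // pnatr_eq0.
apply: bounded_form_sum; first by rewrite invr_ge0.
by move=> j; exact: (covariance_bounded hpi hb mom).
Qed.

Lemma cesaro_form_ge0 n u : 0 <= cesaro_form n u u.
Proof.
by rewrite mulr_ge0 ?invr_ge0 //; apply: sumr_ge0 => j _; exact: covariance_ge0.
Qed.

Lemma cesaro_form_trace n (e : seq H) : onb e -> \sum_(c <- e) cesaro_form n c c <= sigma2.
Proof.
move=> oe; rewrite -mulr_sumr exchange_big /=.
apply: (@le_trans _ _ (n%:R^-1 * (\sum_(j <- index_iota 0 n) sigma2))).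
  rewrite ler_wpM2l ?invr_ge0 //; apply: ler_sum => j _.
  exact: (covariance_trace hpi hb mom).
rewrite big_const_seq count_predT iter_addr_0 size_iota subn0.
case: n => [|n]; first by rewrite invr0 mul0r sigma2_ge0.
by rewrite -(mulr_natl sigma2) mulKf // pnatr_eq0.
Qed.

Lemma cesaro_form_cocycle n :
  \int[mu]_x cesaro_form n (b x) (b x) = n%:R^-1 * \sum_(j < n) c_ j.
Proof.
have i_ j := polylip_cocycle_integrable hpi hb mom (polylip_form (covariance_bounded hpi hb mom j)).
have [i1 i2] := Rintegral_sum_seq (index_iota 0 n) i_.
by rewrite RintegralZl // i2 big_mkord.
Qed.

(** Averaging shifts the index j by 1 and the sum telescopes: the mean is harmonic up to O(1/n). *)
Lemma cesaro_form_rep n u : \int[mu]_x cesaro_form n (pi x u) (pi x u) =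
  cesaro_form n u u + n%:R^-1 * (B_ n u u - B_ 0 u u).
Proof.
have i_ j := rep_form_integrable hpi mom u u (covariance_bounded hpi hb mom j).
have [i1 i2] := Rintegral_sum_seq (index_iota 0 n) i_.
rewrite RintegralZl // i2 /cesaro_form -mulrDr; congr (_ * _).
rewrite -[X in _ = _ + X](@telescope_sumr _ 0 n (fun j => B_ j u u)) //.
by rewrite -big_split /=; apply: eq_bigr => j _; rewrite addrC subrK.
Qed.

(* If the averages stayed away from 0, the top eigenspace of an ultralimit of
   the averaged forms would be a finite-dimensional subspace of W, invariant by
   the maximum principle. *)
Lemma cesaro_correlation_cvg0 (eps : R) : 0 < eps ->
  exists N, forall n, (N <= n)%N -> n%:R^-1 * \sum_(j < n) c_ j <= eps.
Proof.
move=> eps0; apply: contrapT => noN.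
pose I : set nat := [set n | eps <= n%:R^-1 * \sum_(j < n) c_ j].
have exI N : exists2 n, (N <= n)%N & I n.
  apply: contrapT => none; apply: noN; exists N => n Nn; rewrite leNgt; apply/negP => h.
  by apply: none; exists n => //; exact: ltW.
(* An ultrafilter finer than this filter contains both [I] and all the tails of the integers: limits
   along it are limits at infinity that only see times where the average is at least [eps]. *)
pose F := [set A : set nat | exists N, forall n, (N <= n)%N -> I n -> A n].
have FF : ProperFilter F.
  apply: Build_ProperFilter_ex.
    by move=> A [N NA]; have [n Nn In] := exI N; exists n; exact: NA.
  split; first by exists 0%N.
    move=> A A' [N NA] [N' N'A]; exists (maxn N N') => n; rewrite geq_max => /andP[h1 h2] In.
    by split; [exact: NA|exact: N'A].
  by move=> A A' AA' [N NA]; exists N => n Nn In; apply: AA'; exact: NA.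
have [U [UU FU]] := ultraFilterLemma FF.
have PU := @ultra_proper _ _ UU.
have UI : U I by apply: FU; exists 0%N.
have Uoo : \oo `<=` U by move=> A [N _ NA]; apply: FU; exists N => n Nn _; exact: NA.
have [q qP] := ultralimit_ex UU cesaro_form_bounded.
have fq := ultralimit_form UU cesaro_form_bounded qP.
have q0 u : 0 <= q u u by apply: (ultralimit_ge0 UU qP) => n; exact: cesaro_form_ge0.
have qtr e : onb e -> \sum_(c <- e) q c c <= sigma2.
  by move=> oe; apply: (ultralimit_trace UU qP) => n; exact: cesaro_form_trace.
have qW u : q (orthogonal_projection W u) (orthogonal_projection W u) = q u u.
  apply: (@ultralimit_unique _ U UU (fun n => cesaro_form n u u)); last exact: qP.
  rewrite (_ : (fun n => cesaro_form n u u) = (fun n => cesaro_form n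
    (orthogonal_projection W u) (orthogonal_projection W u))); first exact: qP.
  by apply/funext => n; rewrite /cesaro_form; under [in RHS]eq_bigr do rewrite covariance_projW.
(* If q vanished on the diagonal, so would its integral at b x; but this integral is the ultralimit
   of averages that are at least [eps] on [I]. *)
have q_neq0 : exists u, 0 < q u u.
  apply: contrapT => none.
  have qz u : q u u = 0.
    apply/eqP; rewrite eq_le q0 andbT leNgt; apply/negP => h; apply: none; by exists u.
  have h1 : (fun n => \int[mu]_x cesaro_form n (b x) (b x)) @ U -->
      \int[mu]_x q (b x) (b x).
    exact: (ultralimit_integral hQ pi b UU cesaro_form_bounded qP (cocycle_continuous hb)
      (normsq_integrable hpi hb mom)).
  have h2 : (fun _ : nat => eps) @ U --> eps by exact: cvg_cst.
  have : eps <= \int[mu]_x q (b x) (b x).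
    apply: (ler_cvg_to h2 h1); apply: filterS UI => n; rewrite cesaro_form_cocycle //.
  under [X in Rintegral _ _ X]eq_fun do rewrite qz.
  by rewrite (Rintegral_prob_cst pi b) leNgt eps0.
have [lam [lam0 lamP [v v0 vE]]] := top_eigenvector fq q0 qtr q_neq0.
have [lE [e oe eE]] := top_eigenspace fq qtr lam0 lamP.
set E := [set u | q u u = lam * `|u| ^+ 2] in lE eE.
(* For u in [E], lam |u|^2 = q u u is the value of q at the projection of u, hence at most lam times
   the squared norm of this projection: u is its own projection. *)
have EW u : E u -> W u.
  move=> Eu; have := lamP (orthogonal_projection W u); rewrite qW Eu ler_pM2l // => h.
  have := orthogonal_projection_norm cW u => hn.
  have : `|u - orthogonal_projection W u| ^+ 2 <= 0 by lra.
  rewrite le_eqVlt ltNge sqr_ge0 orbF sqrf_eq0 normr_eq0 subr_eq0 => /eqP ->.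
  exact: orthogonal_projection_in.
have crep u : continuous (fun x => pi x u) by exact: (rep_continuous hpi).
have irep u : mu.-integrable setT (EFin \o (fun x : borel G => `|pi x u| ^+ 2)).
  have := rep_form_integrable hpi mom u u inner_form.
  by congr (mu.-integrable _ _); apply/funext => x /=; rewrite normr_inner.
have qS u : \int[mu]_x q (pi x u) (pi x u) = q u u.
  have h1 : (fun n => \int[mu]_x cesaro_form n (pi x u) (pi x u)) @ U -->
      \int[mu]_x q (pi x u) (pi x u).
    exact: (ultralimit_integral hQ pi b UU cesaro_form_bounded qP (crep u) (irep u)).
  apply: (@ultralimit_unique _ U UU _ _ _ h1).
  under eq_fun do rewrite cesaro_form_rep.
  rewrite -[q u u]addr0; apply: cvgD; first exact: qP.
  have K0 : 0 < 2 * (sigma2 * `|u| ^+ 2) + 1.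
    by have := mulr_ge0 sigma2_ge0 (sqr_ge0 `|u|); lra.
  apply/cvgrPdist_le => x x0; apply: Uoo.
  have xK : 0 < x / (2 * (sigma2 * `|u| ^+ 2) + 1) by rewrite divr_gt0.
  have [N _ NP] := near_infty_natSinv_lt (PosNum xK).
  exists N.+1 => // n /= Nn; case: n Nn => // n Nn.
  rewrite sub0r normrN normrM ger0_norm ?invr_ge0 //.
  have := NP n Nn; rewrite /= ltr_pdivlMr // => /ltW; apply: le_trans.
  rewrite ler_wpM2l ?invr_ge0 //.
  have hB k : `|B_ k u u| <= sigma2 * `|u| ^+ 2.
    by rewrite expr2; exact: (form_le (covariance_bounded hpi hb mom k)).
  have hBn := hB n.+1; have hB0 := hB 0%N.
  by apply: le_trans (ler_normB _ _) _; apply: le_trans (lerD hBn hB0) _; lra.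
have [S0 [oO OQ OV gO]] := generating_symmetric_open.
(* Maximum principle: lam |u|^2 - q (pi x u) (pi x u) is continuous and nonnegative in x, and its
   mean is 0 because q is harmonic. *)
have OE x u : S0 x -> E u -> E (pi x u).
  move=> Ox Eu; pose h x := lam * `|u| ^+ 2 - q (pi x u) (pi x u).
  have iq := rep_form_integrable hpi mom u u fq.
  have ic : mu.-integrable setT (EFin \o (fun _ : borel G => lam * `|u| ^+ 2)).
    exact: (finite_measure_integrable_cst mu).
  have hx : h x = 0.
    apply: (vanishing_integral mu_open (O := S0)) => //.
    - move=> y; apply: cvgB; first exact: cvg_cst.
      exact: (form_continuous fq (crep u) (crep u)).
    - by move=> y; rewrite /h subr_ge0 -(rep_norm hpi y u).
    - exact: (integrableB measurableT ic iq).
    - by rewrite /h RintegralB // qS (Rintegral_prob_cst pi b) Eu subrr.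
  by rewrite /E /= (rep_norm hpi); apply/esym/subr0_eq.
pose K := [set g | forall u, E u -> E (pi g u) /\ E (pi (g^-1)%g u)].
have KT : K = setT.
  apply: gO.
  - by move=> u Eu; rewrite invg1 !(rep1 hpi).
  - move=> x y Kx Ky u Eu; rewrite invgM invgK !(repM hpi); split.
      exact: (Kx _ (Ky _ Eu).2).1.
    exact: (Ky _ (Kx _ Eu).2).1.
  - by move=> x Ox u Eu; split; apply: OE => //; exact: OV.
apply: (noW oe).
- move=> e0; apply: v0.
  have : E v by rewrite /E /= vE.
  by rewrite eE e0 linear_span_onb //= /proj big_nil => ->.
- by move=> c ce; apply: EW; rewrite eE; exact: linear_span_incl.
- move=> x u; rewrite -eE => Eu; have Kx : K x by rewrite KT.
  exact: (Kx u Eu).1.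
Qed.

(** Chebyshev's inequality for |b(X_n)|^2 around its mean n sigma2, as the variance is o(n^2). *)
Lemma small_ball_upper : (exists x, b x <> 0) -> exists2 c : R, 0 < c &
  forall delta : R, 0 < delta -> exists N, forall n, (N <= n)%N ->
    iter n M (fun u => bump (c * Num.sqrt n%:R) `|u|) 0 <= delta.
Proof.
move=> /sigma2_gt0 s0.
(* On the support of the cutoff, |u| <= 2 c sqrt n, that is |u|^2 <= n sigma2 / 2: at least n sigma2
   / 2 below the mean. *)
pose c := Num.sqrt (sigma2 / 8).
have c0 : 0 < c by rewrite sqrtr_gt0 divr_gt0.
have c2 : c ^+ 2 = sigma2 / 8 by rewrite sqr_sqrtr // ltW // divr_gt0.
exists c => // delta delta0.
pose tau4 := \int[mu]_x (inner (b x) (b x) * inner (b x) (b x)).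
have t40 : 0 <= tau4 by apply: Rintegral_ge0 => x _; rewrite -expr2 sqr_ge0.
(* For large n the variance is at most 5 n^2 eps; divided by the square of n sigma2 / 2, this is
   delta / 2. *)
pose eps := delta * sigma2 ^+ 2 / 40.
have eps0 : 0 < eps by rewrite divr_gt0 // mulr_gt0 // exprn_gt0.
have [N1 N1P] := cesaro_correlation_cvg0 eps0.
pose N2 := (Num.truncn (tau4 / eps)).+1.
exists (maxn N1 N2).+1 => n; rewrite ltnNge => hn.
have n0 : (0 < n)%N by case: n hn => //; rewrite leq0n.
have hN1 : (N1 <= n)%N by move: hn; rewrite -ltnNge => /ltnW; rewrite geq_max => /andP[].
have hN2 : (N2 <= n)%N by move: hn; rewrite -ltnNge => /ltnW; rewrite geq_max => /andP[].
have nR : (0 : R) < n%:R by rewrite ltr0n.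
have tn : tau4 <= eps * n%:R.
  rewrite mulrC -ler_pdivrMr // ltW //; apply: lt_le_trans (truncnS_gt _) _.
  by rewrite ler_nat.
have avg := N1P n hN1; rewrite mulrC ler_pdivrMr // in avg.
pose g (u : H) := (inner u u - n%:R * sigma2) * (inner u u - n%:R * sigma2).
have pg : polylip g.
  have p1 : polylip (fun u : H => inner u u - n%:R * sigma2).
    apply: polylipB; [exact: (polylip_form inner_form)|exact: polylip_cst].
  exact: polylipM.
pose a := 4 / (n%:R ^+ 2 * sigma2 ^+ 2).
have den : 0 < n%:R ^+ 2 * sigma2 ^+ 2 by rewrite mulr_gt0 ?exprn_gt0.
have csn : 0 < c * Num.sqrt n%:R by rewrite mulr_gt0 // sqrtr_gt0.
have bg u : bump (c * Num.sqrt n%:R) `|u| <= a * g u.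
  have a0 : 0 <= a by rewrite divr_ge0 // ltW.
  have g0 : 0 <= g u by rewrite /g -expr2 sqr_ge0.
  have [hu|hu] := leP (2 * (c * Num.sqrt n%:R)) `|u|.
    by rewrite bump_eq0 // mulr_ge0.
  apply: le_trans (bump_le1 _ _) _; rewrite /a mulrAC ler_pdivlMr // mul1r.
  have u2 : inner u u <= n%:R * sigma2 / 2.
    rewrite -normr_inner; have -> : n%:R * sigma2 / 2 = (2 * (c * Num.sqrt n%:R)) ^+ 2.
      by rewrite !exprMn c2 sqr_sqrtr //; field.
    by rewrite lerXn2r ?nnegrE ?mulr_ge0 // ?(ltW c0) //; exact: ltW.
  have h1 : 0 <= n%:R * sigma2 / 2 by rewrite !mulr_ge0 // ltW.
  have h2 : (n%:R * sigma2 / 2) ^+ 2 <= (n%:R * sigma2 - inner u u) ^+ 2.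
    by rewrite lerXn2r ?nnegrE //; lra.
  have -> : 4 * g u = 4 * (n%:R * sigma2 - inner u u) ^+ 2 by rewrite /g; ring.
  have -> : n%:R ^+ 2 * sigma2 ^+ 2 = 4 * (n%:R * sigma2 / 2) ^+ 2 by field.
  by rewrite ler_pM2l.
have pb : polylip (fun u : H => bump (c * Num.sqrt n%:R) `|u|).
  have := bump_polylip (0 : H) csn.
  by congr polylip; apply/funext => u; rewrite subr0.
apply: le_trans (iter_markov_le hpi hb mom n 0 pb (polylipZ a pg) bg) _.
rewrite (iter_markovZ hpi hb mom) //.
have vb := variance_bound hpi hb mom mu_sym harm n.
rewrite -/g -/tau4 in vb.
rewrite /a mulrAC ler_pdivrMr // mulrC.
have h1 : n%:R * tau4 <= n%:R * (eps * n%:R) by rewrite ler_pM2l.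
have h2 : n%:R * (\sum_(j < n) c_ j) <= n%:R * (eps * n%:R) by rewrite ler_pM2l.
have h3 : iter n M g 0 <= 5 * (n%:R * (eps * n%:R)) by apply: le_trans vb _; lra.
have -> : delta * (n%:R ^+ 2 * sigma2 ^+ 2) = 40 * (n%:R * (eps * n%:R)).
  by rewrite /eps; field.
have h4 : 0 <= n%:R * (eps * n%:R) by rewrite !mulr_ge0 // ltW.
rewrite mulrC; lra.
Qed.

End NoFiniteDimensionalPart.

(** * Maximal families of finite-dimensional invariant subspaces *)

Section MaximalFamily.
Context {R : realType} {G : topologicalGroupType} {H : hilbertType R}.
Variables (pi : G -> {linear H -> H}).
Hypotheses (hpi : orthogonal_representation pi).

Lemma closure_linear_subset (S : set H) : linear_subset S -> closed_subspace (closure S).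
Proof.
move=> lS; split; [exact: closed_closure|by apply: subset_closure; case: lS|].
move=> a u v cu cv B /nbhs_ballP [r /= r0 rB].
have a0 : 0 < `|a| + 1 by rewrite ltr_wpDl.
have r1 : 0 < r / 2 / (`|a| + 1) by rewrite !divr_gt0.
have r2 : 0 < r / 2 by rewrite divr_gt0.
have [u' [Su' /= uu']] := cu _ (nbhsx_ballx u _ r1).
have [v' [Sv' /= vv']] := cv _ (nbhsx_ballx v _ r2).
exists (a *: u' + v'); split; first by case: lS => _; apply.
apply: rB; move: uu' vv'; rewrite -!ball_normE /= => uu' vv'.
rewrite opprD addrACA -scalerBr (le_lt_trans (ler_normD _ _)) // normrZ.
have : `|a| * `|u - u'| <= r / 2.
  apply: (@le_trans _ _ ((`|a| + 1) * `|u - u'|)); first by rewrite ler_wpM2r // lerDl.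
  by rewrite mulrC -ler_pdivlMr // ltW.
by move=> h; lra.
Qed.

Lemma finite_dimensional_closure_span (S : set H) (e : seq H) : onb e ->
  S `<=` linear_span [set` e] -> finite_dimensional (closure (linear_span S)).
Proof.
move=> oe Se; apply: (@finite_dimensional_sub _ _ _ (linear_span [set` e])).
- exact/closed_subspace_linear/closure_linear_subset/linear_span_linear.
- by exists e.
have [ce _ _] := closed_span_onb oe.
rewrite [X in _ `<=` X](closure_id _).1 //; apply: closure_subset.
by apply: linear_span_min => //; exact: linear_span_linear.
Qed.

Definition orthogonal_fd_family (A : set (set H)) :=
  (forall V, A V -> exists e : seq H, [/\ onb e, e <> [::], V = linear_span [set` e] &
     forall x u, V u -> V (pi x u)]) /\
  (forall V V', A V -> A V' -> V <> V' -> forall u v, V u -> V' v -> inner u v = 0).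

(** Zorn's lemma: the conditions bear on one or two members at a time, so they pass to the union of
    a chain. *)
Lemma maximal_orthogonal_fd_family :
  exists A, orthogonal_fd_family A /\ forall A', A `<` A' -> ~ orthogonal_fd_family A'.
Proof.
apply: Zorn_bigcup => F FP totF; split.
  by move=> V [A FA AV]; case: (FP _ FA) => h _; exact: h.
move=> V V' [A FA AV] [A' FA' A'V'].
by have [AA'|A'A] := totF _ _ FA FA'; [case: (FP _ FA') => _ h|case: (FP _ FA) => _ h];
  apply: h => //; [exact: AA'|exact: A'A].
Qed.

Variables (A : set (set H)) (hA : orthogonal_fd_family A).
Hypothesis A_max : forall A', A `<` A' -> ~ orthogonal_fd_family A'.

Definition ortho_complement := [set u : H | forall V, A V -> forall v, V v -> inner u v = 0].
Local Notation W := ortho_complement.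

Lemma ortho_complement_closed : closed_subspace W.
Proof.
split.
- rewrite (_ : W = \bigcap_(v in [set v | exists2 V, A V & V v]) [set u | inner u v = 0]).
    apply: closed_bigI => v _; rewrite (_ : [set u | _] = (fun u => inner u v) @^-1` [set 0]) //.
    apply: preimage_closed; last exact: closed_eq.
    by move=> u _; exact: inner_continuous.
  apply/seteqP; split=> u /= h; first by move=> v [V AV Vv]; exact: h Vv.
  by move=> V AV v Vv; apply: h; exists V.
- by move=> V _ v _; rewrite inner0l.
- by move=> a u v Wu Wv V AV w Vw; rewrite innerDl innerZl (Wu V AV) // (Wv V AV) // mulr0 addr0.
Qed.

Lemma ortho_complement_rep g v : W v -> W (pi g v).
Proof.
move=> Wv V AV w Vw; rewrite (rep_adjoint hpi); apply: (Wv V AV).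
by have [e [_ _ _]] := hA.1 _ AV; apply.
Qed.

(** Such a span could be added to [A]. It is not already a member, since it would be orthogonal to
    itself. *)
Lemma ortho_complement_no_fd (e : seq H) : onb e -> e <> [::] -> [set` e] `<=` W ->
  ~ (forall x u, linear_span [set` e] u -> linear_span [set` e] (pi x u)).
Proof.
move=> oe e0 eW eI; have lsp := @linear_span_linear R H.
have spW : linear_span [set` e] `<=` W.
  by apply: linear_span_min => //; exact/closed_subspace_linear/ortho_complement_closed.
apply: (@A_max (A `|` [set linear_span [set` e]])).
  split=> [V AV|sub]; first by left.
  have AE : A (linear_span [set` e]) by apply: sub; right.
  case: e e0 oe eW AE {eI spW sub} => // c e _ oe eW AE.
  have ce : [set` c :: e] c by rewrite /= inE eqxx.
  have := eW c ce _ AE c (linear_span_incl ce).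
  by case: oe => -> _ _ /eqP; rewrite oner_eq0.
split=> [V [AV|->]|V V' [AV|->] [AV'|->] VV' u v Vu Vv].
- exact: hA.1.
- by exists e.
- exact: (hA.2 V V').
- by rewrite innerC; exact: (spW v Vv V AV).
- exact: (spW u Vu V' AV').
- by exfalso; apply: VV'.
Qed.

(** [W] enters the decomposition as one more summand, of index [None]. It may be
    infinite-dimensional: only the component of b in it has to be finite-dimensional, and this
    component is 0. *)
Lemma complement_decomposition (b : G -> H) : (forall x, orthogonal_projection W (b x) = 0) ->
  sum_of_finite_dimensional pi b.
Proof.
move=> b0; pose V (i : option {V : set H | A V}) := if i is Some V then sval V else W.
have cV i : closed_subspace (V i).
  case: i => [[U AU]|] /=; last exact: ortho_complement_closed.
  by have [e [oe _ -> _]] := hA.1 _ AU; exact: closed_span_onb.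
have lsp := @linear_span_linear R H.
exists (option {V : set H | A V}), V; split.
- split=> //.
    move=> [[U AU]|] [[U' AU']|] u v ij /= Vu Vv.
    + apply: (hA.2 U U') => // UU'; apply: ij; congr Some; exact: eq_exist.
    + by rewrite innerC; exact: (Vv _ AU).
    + exact: (Vu _ AU').
    + by exfalso; apply: ij.
  apply/seteqP; split=> // x _.
  pose N := closure (linear_span (\bigcup_(U in A) U)).
  have cN : closed_subspace N by apply: closure_linear_subset; exact: lsp.
  have cT := closure_linear_subset (lsp (\bigcup_i V i)).
  have lT := closed_subspace_linear cT.
  rewrite -[x](subrK (orthogonal_projection N x)).
  apply: (linear_subsetD lT).
    apply: subset_closure; apply: linear_span_incl; exists None => //= U AU v Uv.
    apply: orthogonal_projection_orth => //; apply: subset_closure.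
    by apply: linear_span_incl; exists U.
  have NT : N `<=` closure (linear_span (\bigcup_i V i)).
    apply: closure_subset; apply: linear_span_min => // u [U AU Uu].
    by apply: linear_span_incl; exists (Some (exist _ U AU)).
  by apply: NT; exact: orthogonal_projection_in.
- move=> [[U AU]|] g v /=; last exact: ortho_complement_rep.
  by have [e [_ _ _]] := hA.1 _ AU; apply.
move=> [[U AU]|] /=.
  have [e [oe _ UE _]] := hA.1 _ AU.
  apply: (finite_dimensional_closure_span oe) => _ [x _ <-] /=; rewrite -UE.
  exact: (orthogonal_projection_in (cV (Some (exist _ U AU)))).
apply: (@finite_dimensional_closure_span _ [::]) => // _ [x _ <-] /=; rewrite b0.
by case: (lsp [set` [::]]).
Qed.

End MaximalFamily.

(** * Projected cocycles, probabilities of balls and the equivalence *)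

Section ProjectedCocycle.
Context {R : realType} {G : topologicalGroupType} {H : hilbertType R}.
Variables (pi : G -> {linear H -> H}) (b : G -> H).
Hypotheses (hpi : orthogonal_representation pi) (hb : cocycle pi b).
Variables (W : set H) (cW : closed_subspace W).
Hypothesis piW : forall g v, W v -> W (pi g v).
Local Notation P := (orthogonal_projection W).

Lemma orthogonal_projectionD u v : P (u + v) = P u + P v.
Proof. by rewrite -[u in LHS]scale1r orthogonal_projection_linear // scale1r. Qed.

Lemma orthogonal_projectionB u v : P (u - v) = P u - P v.
Proof.
by rewrite addrC -scaleN1r orthogonal_projection_linear // scaleN1r addrC.
Qed.

Lemma projected_cocycle : cocycle pi (P \o b).
Proof.
split=> [|g x]; last first.
  by rewrite /= (cocycleM hb) orthogonal_projectionD (projW_rep hpi cW piW).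
move=> x; apply: (cvg_comp b P); first exact: (cocycle_continuous hb).
have cP : continuous P.
  apply: (@local_lipschitz_continuous _ _ _ _ (fun=> 1)) => u v _.
  by rewrite mul1r -orthogonal_projectionB orthogonal_projection_le.
exact: cP.
Qed.

Lemma projected_harmonic (mu : probability (borel G) R) : weakly_harmonic mu b ->
  weakly_harmonic mu (P \o b).
Proof.
move=> harm C L LP LC; apply: (harm `|C| (L \o P)) => [a u v|u] /=.
  by rewrite orthogonal_projection_linear // LP.
apply: le_trans (LC _) _; apply: (@le_trans _ _ (`|C| * `|P u|)).
  by rewrite ler_wpM2r // ler_norm.
by rewrite ler_wpM2l // orthogonal_projection_le.
Qed.

End ProjectedCocycle.

Section WalkProbability.
Context {R : realType} {G : topologicalGroupType} {H : hilbertType R}.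
Variables (Q : set G) (hQ : generating_neighborhood Q).
Variables (pi : G -> {linear H -> H}) (b : G -> H).
Hypotheses (hpi : orthogonal_representation pi) (hb : cocycle pi b).
Variable mu : probability (borel G) R.
Hypothesis mom : has_moments b mu.
Context d (Omega : measurableType d) (P : probability Omega R).
Variables (s : nat -> {RV P >-> borel G}) (hs : iid_increments mu s).
Local Notation M := (markov pi b mu).

Lemma walk_measurable n (f : H -> R) L :
  (forall u, 0 <= f u) -> (forall u v, `|f u - f v| <= L * `|u - v|) ->
  measurable_fun setT (fun w => f (b (random_walk s n w))) /\
  (\int[P]_w (f (b (random_walk s n w)))%:E = (iter n M f 0)%:E)%E.
Proof.
move=> f0 fL; have [mf If] := walk_markov hs hQ hpi hb mom n 1%g f0 fL.
have E w : f (affine_act pi b (random_walk s n w) (b 1%g)) = f (b (random_walk s n w)).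
  by rewrite (cocycle1 hpi hb) act0.
split.
  move=> _ B mB; rewrite setTI; apply: (@past_measurable _ _ _ _ _ s n).
  have := mf measurableT B mB; rewrite setTI.
  by congr (measurable _); apply/seteqP; split=> w /=; rewrite E.
by rewrite -[X in iter n _ _ X](cocycle1 hpi hb) -If; apply: eq_integral => w _; rewrite E.
Qed.

Lemma walk_ball_measurable n (r : R) :
  measurable [set w | `|b (random_walk s n w)| < r].
Proof.
have [|u v|mf _] := @walk_measurable n (fun u => `|u|) 1; first by [].
  by rewrite mul1r ler_dist_dist.
have := mf measurableT _ (open_measurable (@open_lt R r)).
by rewrite setTI.
Qed.

Lemma walk_bump n (r : R) : 0 < r ->
  measurable_fun setT (fun w => (bump r `|b (random_walk s n w)|)%:E) /\
  (\int[P]_w (bump r `|b (random_walk s n w)|)%:E =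
    (iter n M (fun u => bump r `|u|) 0)%:E)%E.
Proof.
move=> r0; have [|u v|mf If] := @walk_measurable n (fun u => bump r `|u|) r^-1.
- by move=> u; exact: bump_ge0.
- apply: le_trans (bump_lip _ _ r0) _; rewrite ler_wpM2l ?invr_ge0 ?(ltW r0) //.
  exact: ler_dist_dist.
- by split; [exact/measurable_EFinP|].
Qed.

Lemma walk_ball_lower n (r t : R) : 0 < r -> 2 * r <= t ->
  ((iter n M (fun u => bump r `|u|) 0)%:E <= P [set w | `|b (random_walk s n w)| < t]%R)%E.
Proof.
move=> r0 rt; have [mf <-] := walk_bump n r0.
have mB := walk_ball_measurable n t.
rewrite -[X in P X]setIT -integral_indic //; apply: ge0_le_integral => //.
- by move=> w _; rewrite lee_fin bump_ge0.
- by apply/measurable_EFinP; exact: measurable_indic.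
move=> w _; rewrite lee_fin indicE; case: (boolP (w \in _)) => wB; first exact: bump_le1.
rewrite bump_eq0 //; move: wB; rewrite notin_setE /= => /negP; rewrite -leNgt.
exact: le_trans.
Qed.

Lemma walk_ball_upper n (r : R) : 0 < r ->
  (P [set w | `|b (random_walk s n w)| < r]%R <= (iter n M (fun u => bump r `|u|) 0)%:E)%E.
Proof.
move=> r0; have [mf <-] := walk_bump n r0.
have mB := walk_ball_measurable n r.
rewrite -[X in P X]setIT -integral_indic //; apply: ge0_le_integral => //.
- by apply/measurable_EFinP; exact: measurable_indic.
move=> w _; rewrite lee_fin indicE; case: (boolP (w \in _)) => wB; last exact: bump_ge0.
by rewrite bump_eq1 //; move: wB; rewrite inE /= => /ltW.
Qed.

End WalkProbability.

Theorem mainTheorem2 (R : realType) (G : topologicalGroupType)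
  (hausG : hausdorff_space G) (lcG : locally_compact [set: G])
  (cgG : compactly_generated G)
  (m : {measure set (borel G) -> \bar R}) (haar_m : haar_measure m)
  (Q : set G) (hQ : generating_neighborhood Q)
  (mu : probability (borel G) R) (hmu : driving_measure m Q mu)
  (H : hilbertType R) (pi : G -> {linear H -> H})
  (hpi : orthogonal_representation pi)
  (b : G -> H) (hb : cocycle pi b) (harm_b : harmonic_cocycle mu b)
  (d : measure_display) (Omega : measurableType d) (P : probability Omega R)
  (s : nat -> {RV P >-> borel G}) (hs : iid_increments mu s) :
  sum_of_finite_dimensional pi b <->
  (forall c : R, 0 < c ->
     (0 < limn_esup (fun n =>
        P [set w | (`|b (random_walk s n w)| < c * Num.sqrt n%:R)%R]))%E).
Proof.
have mom := cocycle_has_moments hQ hmu hpi hb.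
have mu_sym := Rintegral_inv hmu.
have harm := harmonic_weakly (cocycle_continuous hb) mom harm_b.
have mu_open := driving_open_gt0 hausG haar_m hmu.
split=> [fd c c0|small].
  have [delta delta0 low] := small_ball_lower hQ hpi hb mom mu_sym harm
    (sum_fd_approx hQ hpi hb mom fd) c0.
  (* The lower bound is known at even times only, which is enough for an upper limit. The cutoff of
     radius c sqrt (N + 1) / 2 is supported within c sqrt (N + 1), below c sqrt (2 (N + 1)). *)
  apply: (limn_esup_gt0 delta0) => N; exists (N.+1 + N.+1)%N.
    exact: leq_trans (leqnSn N) (leq_addr _ _).
  apply: (@le_trans _ _ (iter (N.+1 + N.+1) (markov pi b mu)
      (fun u => bump (c * Num.sqrt N.+1%:R / 2) `|u|) 0)%:E).
    by rewrite lee_fin low.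
  have sN : 0 < Num.sqrt N.+1%:R :> R by rewrite sqrtr_gt0 ltr0n.
  apply: (walk_ball_lower hQ hpi hb mom hs); first by rewrite divr_gt0 // mulr_gt0.
  rewrite mulrCA divff ?pnatr_eq0 // mulr1 ler_pM2l // ler_sqrt ?ler0n //.
  by rewrite ler_nat leq_addr.
have [A [hA A_max]] := maximal_orthogonal_fd_family pi.
have cW := ortho_complement_closed A; have piW := ortho_complement_rep hpi hA.
apply: (complement_decomposition hpi hA) => x0.
apply: contrapT => bx0.
set W := ortho_complement A in cW piW bx0.
pose bW := orthogonal_projection W \o b.
have hbW : cocycle pi bW by exact: projected_cocycle.
have momW : has_moments bW mu := cocycle_has_moments hQ hmu hpi hbW.
have harmW : weakly_harmonic mu bW by exact: projected_harmonic.
have [] := small_ball_upper hQ hpi hbW momW mu_sym harmW mu_open cW piW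
  (fun x => orthogonal_projection_in cW (b x)) (ortho_complement_no_fd hA A_max).
  by exists x0.
move=> c c0 up; have := small c c0; apply/negP; rewrite -leNgt.
apply: limn_esup_le0 => e e0; have [N NP] := up e e0; exists N.+1 => n Nn.
have n0 : (0 < n)%N by exact: leq_ltn_trans Nn.
have cn : 0 < c * Num.sqrt n%:R by rewrite mulr_gt0 // sqrtr_gt0 ltr0n.
(* A projection does not increase norms, so the event that b is small is included in the same event
   for [bW]. *)
apply: (@le_trans _ _ (P [set w | (`|bW (random_walk s n w)| < c * Num.sqrt n%:R)%R])).
  apply: le_measure; rewrite ?inE.
  - exact: (walk_ball_measurable hQ hpi hb mom hs).
  - exact: (walk_ball_measurable hQ hpi hbW momW hs).
  by move=> w /=; apply: le_lt_trans; exact: orthogonal_projection_le.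
apply: le_trans (walk_ball_upper hQ hpi hbW momW hs n cn) _.
by rewrite lee_fin NP // ltnW.
Qed.
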